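(* Let $(G_m^n)_{n\ge n_0}$ be a random graph process belonging to the T-subclass of the PA-class with parameters $A,B,D,m$, where $A>0$ and $D>0$. Then for any $\delta>0$ there exists a function $\varphi(n)=o(1)$ (as $n\to\infty$) such that (with $d$ ranging over integers $d\ge m$, $d\ge 2$): (1) if $2A\le 1$: $$\lim_{n\to\infty}\mathsf{P}\left(\exists\, d\le n^{\frac{A-\delta}{4A+2}}:\ \left|C(d)-\frac{K(d)}{\binom d2\,c(m,d)}\right|\ge\frac{\varphi(n)}{d}\right)=0;$$ (2) if $2A>1$: $$\lim_{n\to\infty}\mathsf{P}\left(\exists\, d\le n^{\frac{A(3-4A)-\delta}{4A+2}}:\ \left|C(d)-\frac{K(d)}{\binom d2\,c(m,d)}\right|\ge\frac{\varphi(n)}{d}\right)=0.$$ Moreover, $$\frac{K(d)}{\binom d2\,c(m,d)}=\frac{2D}{d(d-1)m}\left(m+\sum_{i=m}^{d-1}\frac{i}{Ai+B}\right)\sim\frac{2D}{mA}\,d^{-1}\qquad(d\to\infty).$$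
   Context: PA-class. Fix integers $m\ge1$, $n_0\ge 1$. A random graph process $(G_m^n)_{n\ge n_0}$ is as follows. $G_m^{n_0}$ is an arbitrary (fixed) graph with vertices $\{1,\dots,n_0\}$ and $mn_0$ edges. For $n\ge n_0$, $G_m^{n+1}$ is obtained from $G_m^n$ by adding a new vertex $n+1$ and $m$ edges connecting this vertex to some (randomly chosen) $m$ vertices from $\{1,\dots,n,n+1\}$; loops and multiple edges may occur. So $G_m^n$ has $n$ vertices $\{1,\dots,n\}$ and $mn$ edges. Let $d_v^n$ be the degree of vertex $v$ in $G_m^n$. The process belongs to the PA-class if for some constants $A,B$ with $2mA+B=m$ and $0\le A\le1$, one has, for $1\le v\le n$, $$\mathsf{P}(d_v^{n+1}=d_v^n\mid G_m^n)=1-A\frac{d_v^n}{n}-B\frac1n+O\left(\frac{(d_v^n)^2}{n^2}\right),$$ $$\mathsf{P}(d_v^{n+1}=d_v^n+1\mid G_m^n)=A\frac{d_v^n}{n}+B\frac1n+O\left(\frac{(d_v^n)^2}{n^2}\right),$$ $$\mathsf{P}(d_v^{n+1}=d_v^n+j\mid G_m^n)=O\left(\frac{(d_v^n)^2}{n^2}\right),\quad 2\le j\le m,$$ and $$\mathsf{P}(d_{n+1}^{n+1}=m+j)=O\left(\frac1n\right),\quad 1\le j\le m.$$ T-subclass. A process in the PA-class belongs to the T-subclass (with constant $D>0$) if in addition, for distinct vertices $i,j\in\{1,\dots,n\}$, $$\mathsf{P}(d_i^{n+1}=d_i^n+1,\ d_j^{n+1}=d_j^n+1\mid G_m^n)=e_{ij}\frac{D}{mn}+O\left(\frac{d_i^nd_j^n}{n^2}\right),$$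 where $e_{ij}$ is the number of edges between $i$ and $j$ in $G_m^n$. All $O$-constants above are uniform (independent of $n$, of the vertices and of the realization of $G_m^n$). Notation. $N_n(d)$ is the number of vertices of degree $d$ in $G_m^n$. $T_n(d)$ is the number of triangles on the vertices of degree $d$ in $G_m^n$, i.e. the sum over all vertices $v$ of degree $d$ of the number of edges between neighbors of $v$ (multiplicities of edges are not taken into account when counting triangles). The average local clustering over vertices of degree $d$ in $G_m^n$ is $$C(d)=\frac{T_n(d)}{N_n(d)\binom d2}$$ (with, say, $C(d)=0$ when $N_n(d)=0$). For $d\ge m$, $$c(m,d)=\frac{\Gamma\left(d+\frac BA\right)\Gamma\left(m+\frac{B+1}{A}\right)}{A\,\Gamma\left(d+\frac{B+A+1}{A}\right)\Gamma\left(m+\frac BA\right)},\qquad K(d)=c(m,d)\left(D+\frac Dm\sum_{i=m}^{d-1}\frac{i}{Ai+B}\right),$$ where $\Gamma$ is the gamma function.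
   Formalization: The ''Moreover'' formulas are stated for A<1 only: the class allows A=1, but then B=-m, so Γ(m+B/A)=Γ(0) and the term i=m of the sum (denominator Am+B=0) are undefined. *)

(* Defs.v *)
From HB Require Import structures.
From mathcomp Require Import all_boot all_order all_algebra.
From mathcomp Require Import all_classical all_reals all_analysis.

Set Implicit Arguments.
Unset Strict Implicit.
Unset Printing Implicit Defensive.

Import Order.TTheory GRing.Theory Num.Theory.
Import numFieldNormedType.Exports.

Local Open Scope classical_set_scope.
Local Open Scope ring_scope.

(* A multigraph with vertices 1, ..., n is its symmetric matrix of
   multiplicities, vertex v being the ordinal v - 1; the diagonal entry g i i
   is the number of loops at i. *)
Definition multigraph (n : nat) (g : 'M[nat]_n) : Prop := (g^T = g)%R.

Definition nb_edges (n : nat) (g : 'M[nat]_n) : nat :=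
  (\sum_(i < n) \sum_(j < n | i <= j) g i j)%N.

(* A loop contributes 2 to the degree. *)
Definition deg (n : nat) (g : 'M[nat]_n) (v : 'I_n) : nat :=
  (\sum_(j < n) g v j + g v v)%N.

Definition adjacent (n : nat) (g : 'M[nat]_n) (i j : 'I_n) : bool :=
  (i != j) && (0 < g i j)%N.

(* Edges between neighbours of v, each unordered pair {p.1, p.2} being counted
   once whatever its multiplicity. *)
Definition triangles_at (n : nat) (g : 'M[nat]_n) (v : 'I_n) : nat :=
  #|[set p : 'I_n * 'I_n | [&& (p.1 < p.2)%N, adjacent g v p.1,
       adjacent g v p.2 & adjacent g p.1 p.2]]%SET|.

Definition nb_vertices_deg (n : nat) (g : 'M[nat]_n) (d : nat) : nat :=
  #|[set v : 'I_n | deg g v == d]%SET|.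

Definition nb_triangles_deg (n : nat) (g : 'M[nat]_n) (d : nat) : nat :=
  (\sum_(v < n | deg g v == d) triangles_at g v)%N.

(* Equal to 0 when no vertex has degree d, since x / 0 = 0. *)
Definition local_clustering (R : realType) (n : nat) (g : 'M[nat]_n) (d : nat)
    : R :=
  (nb_triangles_deg g d)%:R / ((nb_vertices_deg g d)%:R * 'C(d, 2)%:R).

Definition old_vertex (n : nat) (v : 'I_n) : 'I_n.+1 := widen_ord (leqnSn n) v.

(* Only the values G n with n0 <= n are meaningful. *)
Record graph_process (dT : measure_display) (T : measurableType dT)
    (m n0 : nat) (G : forall n : nat, T -> 'M[nat]_n) : Prop := GraphProcess {
  process_measurable : forall (n : nat) (g : 'M[nat]_n), (n0 <= n)%N ->
    measurable [set w | G n w = g];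
  process_init : exists g0 : 'M[nat]_n0,
    [/\ multigraph g0, nb_edges g0 = (m * n0)%N & forall w, G n0 w = g0];
  process_step : forall (n : nat) (w : T), (n0 <= n)%N ->
    [/\ multigraph (G n.+1 w),
        forall i j : 'I_n,
          G n.+1 w (old_vertex i) (old_vertex j) = G n w i j &
        (\sum_(j < n.+1) G n.+1 w ord_max j)%N = m]
}.

Definition cond_prob (dT : measure_display) (T : measurableType dT)
    (R : realType) (P : probability T R) (E F : set T) : R :=
  fine (P (E `&` F)) / fine (P F).

(* The event that vertex v gains k in degree from time n to time n + 1. *)
Definition deg_incr (T : Type) (G : forall n : nat, T -> 'M[nat]_n)
    (n : nat) (v : 'I_n) (k : nat) : set T :=
  [set w | deg (G n.+1 w) (old_vertex v) = (deg (G n w) v + k)%N].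

(* Conditioning on G n is conditioning on each of its values g of positive
   probability. The constant C is that of all the O-terms. *)
Record PA_class (dT : measure_display) (T : measurableType dT) (R : realType)
    (P : probability T R) (m n0 : nat) (A B : R)
    (G : forall n : nat, T -> 'M[nat]_n) : Prop := PAClass {
  PA_process : graph_process m n0 G;
  PA_sum : 2 * m%:R * A + B = m%:R;
  PA_range : 0 <= A <= 1;
  PA_old : exists C : R, forall (n : nat) (g : 'M[nat]_n) (v : 'I_n),
    (n0 <= n)%N -> P [set w | G n w = g] != 0%E ->
    let x := (deg g v)%:R : R in
    let N := n%:R : R in
    let pr k := cond_prob P (deg_incr G v k) [set w | G n w = g] in
    [/\ `|pr 0%N - (1 - A * (x / N) - B * N^-1)| <= C * (x ^+ 2 / N ^+ 2),
        `|pr 1%N - (A * (x / N) + B * N^-1)| <= C * (x ^+ 2 / N ^+ 2) &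
        forall j : nat, (2 <= j <= m)%N -> `|pr j| <= C * (x ^+ 2 / N ^+ 2)];
  PA_new : exists C : R, forall n j : nat, (n0 <= n)%N -> (1 <= j <= m)%N ->
    fine (P [set w | deg (G n.+1 w) ord_max = (m + j)%N]) <= C / n%:R
}.

Record T_subclass (dT : measure_display) (T : measurableType dT) (R : realType)
    (P : probability T R) (m n0 : nat) (A B D : R)
    (G : forall n : nat, T -> 'M[nat]_n) : Prop := TSubclass {
  T_PA : PA_class P m n0 A B G;
  T_D_gt0 : 0 < D;
  T_pair : exists C : R, forall (n : nat) (g : 'M[nat]_n) (i j : 'I_n),
    (n0 <= n)%N -> P [set w | G n w = g] != 0%E -> i != j ->
    `|cond_prob P (deg_incr G i 1 `&` deg_incr G j 1) [set w | G n w = g]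
      - (g i j)%:R * (D / (m%:R * n%:R))|
    <= C * ((deg g i)%:R * (deg g j)%:R / n%:R ^+ 2)
}.

(* Euler's integral; meaningful for x > 0. *)
Definition Gamma (R : realType) (x : R) : R :=
  (\int[lebesgue_measure]_(t in `]0, +oo[) (t `^ (x - 1) * expR (- t)))%R.

(* For 0 < A < 1, 2 m A + B = m and d >= m >= 1, the arguments of Gamma are
   positive: m + B / A = m (1 - A) / A. *)
Definition cdeg (R : realType) (A B : R) (m d : nat) : R :=
  Gamma (d%:R + B / A) * Gamma (m%:R + (B + 1) / A) /
  (A * Gamma (d%:R + (B + A + 1) / A) * Gamma (m%:R + B / A)).

Definition Kdeg (R : realType) (A B D : R) (m d : nat) : R :=
  cdeg A B m d *
  (D + D / m%:R * \sum_(m <= i < d) (i%:R / (A * i%:R + B))).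

(* Main.v *)
Require Import Defs.
From HB Require Import structures.
From mathcomp Require Import all_boot all_order all_algebra.
From mathcomp Require Import all_classical all_reals all_analysis.
From mathcomp Require Import measurable_realfun ring lra zify.

Set Implicit Arguments.
Unset Strict Implicit.
Unset Printing Implicit Defensive.

Import Order.TTheory GRing.Theory Num.Theory.
Import numFieldNormedType.Exports.

Local Open Scope classical_set_scope.
Local Open Scope ring_scope.

(** Let [c d] and [k d] be the limits of the proportions of vertices of degree
    [d] and of triangles on them. Given the present graph, the expected change
    of a count in degree class [d] is an affine combination of the counts in
    classes [d] and [d - 1] with weights [1 - (A d + B) / n] and
    [(A (d - 1) + B) / n]. Their sum is [1 - A / n], so deviations from [c d n]
    and [k d n] are damped, and a supersolution bounds their second moments by
    [O(d n)] for vertices and [O(d^3 n^(1 + g) + c d n^(3/2 + g))] for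
    triangles, for every [g > max(0, 2 A - 1)].

    The loss [n^g] is the growth rate of [n^-1 \sum_v (deg v)^2], which
    controls the errors in the probability that two vertices are linked in the
    same step. Bounding this sum requires the maximal degree to be [o(n)]; this
    follows from the second moments of the vertex counts, because the degrees
    below a large constant already carry almost all of the total degree [2 m n].

    Chebyshev's inequality and a union bound over [d <= n^x] then make all the
    relative errors at most [n^(-zeta)] with high probability. The quotient of
    the limits does not involve Gamma, which only has to be nonzero. *)

(** * Limiting proportions *)

(** The form of the triangle bound reflects where errors enter. A newborn vertex joins class [m] and
    may be linked to two neighbours of any degrees; the errors [O(deg v deg w / n^2)], summed over
    all edges, are of order [n^(g - 1/2)] in mean. They enter at class [m] only and are then
    transported like the density, hence the factor [c d] in front of [n^(3/2 + g)]. The noise and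
    the other errors fit under [d^3 n^(1 + g)].

    Since [c d] decays like [d^(-1 - 1/A)] and [k d] like [d^(-1/A)], division by the squares of
    [c d n] and [k d n] leaves [d^(3 + 2/A) n^(g - 1)] and [d^(1/A - 1) n^(g - 1/2)]. The union
    bound adds one power of [n^x], so the range [d <= n^x] is admissible when [x (4 + 2/A) < 1 - g]
    and [x / A < 1/2 - g]. For [g] near [0] the first condition binds and reads [x < A / (4 A + 2)];
    for [g] near [2 A - 1] a positive [x < A (3 - 4 A) / (4 A + 2)] satisfies both, which leaves a
    range only if [A < 3/4]. *)

Lemma powR_bernoulli (R : realType) (p x : R) :
  1 <= p -> 0 < 1 + x -> 1 + p * x <= (1 + x) `^ p.
Proof.
rewrite le_eqVlt => /orP[/eqP <- x0|p1 x0].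
  by rewrite (powRr1 (ltW x0)) mul1r.
have p0 : 0 < p by lra.
have pq : p^-1 + (1 - p^-1) = 1 by lra.
have q0 : 0 < (1 - p^-1)^-1 by rewrite invr_gt0 subr_gt0 invf_lt1.
(* Young's inequality for the product [(1 + x) * 1], with conjugate exponents [p] and
   [(1 - p^-1)^-1]. *)
have := @conjugate_powR R (1 + x) 1 p (1 - p^-1)^-1 (ltW x0) ler01 p0 q0.
rewrite invrK => /(_ pq); rewrite mulr1 powR1 => h.
have : p * (1 + x) <= p * ((1 + x) `^ p / p + 1 * (1 - p^-1)).
  by rewrite ler_pM2l.
rewrite (_ : p * (_ / p + _) = (1 + x) `^ p + (p - 1)); first lra.
by field; rewrite gt_eqF.
Qed.

Lemma powR_nat_ge (R : realType) (M s : R) : 0 < s ->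
  exists N, forall n, (N <= n)%N -> M <= n%:R `^ s.
Proof.
move=> s0; pose M1 := Num.max M 1.
exists (Num.truncn (M1 `^ s^-1)).+1 => n hn.
apply: (@le_trans _ _ M1); first by rewrite le_max lexx.
have M10 : 0 <= M1 by rewrite le_max ler01 orbT.
have -> : M1 = (M1 `^ s^-1) `^ s by rewrite -powRrM mulVf ?gt_eqF// powRr1.
apply: ge0_ler_powR; rewrite ?nnegrE ?powR_ge0 ?ler0n ?(ltW s0)//.
apply: (@le_trans _ _ (Num.truncn (M1 `^ s^-1)).+1%:R); last by rewrite ler_nat.
by rewrite ltW// truncnS_gt.
Qed.

Lemma cvg_powR_natN (R : realType) (s : R) : 0 < s ->
  n%:R `^ (- s) @[n --> \oo] --> (0 : R).
Proof.
move=> s0; apply/cvgrPdist_lt => e e0.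
have [N hN] := powR_nat_ge (e^-1 + 1) s0.
exists N => // n /= /hN h; rewrite sub0r normrN ger0_norm ?powR_ge0// powRN.
have h0 : 0 < e^-1 by rewrite invr_gt0.
by rewrite invf_plt ?posrE//; lra.
Qed.

Section Weights.
Context {R : realType}.
Variables (A B D : R) (m : nat).
Hypotheses (A_gt0 : 0 < A) (A_lt1 : A < 1) (m_gt0 : (0 < m)%N).
Hypotheses (D_gt0 : 0 < D) (AB : 2 * m%:R * A + B = m%:R).

Local Ltac lin := move: (A_gt0) (A_lt1) (AB) => ? ? ?; lra.
Local Ltac nlin := move: (A_gt0) (A_lt1) (AB) => ? ? ?; nra.

(** [rate d / n] is, up to [O(d^2 / n^2)], the probability that a vertex of degree [d] receives
    exactly one edge at step [n]. *)
Definition rate (d : nat) : R := A * d%:R + B.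

(* Proportional to [cdeg A B m] in [d], without the functional equation of
   Gamma; the theorem only involves the quotient [Kdeg / cdeg]. *)
Definition deg_density (d : nat) : R :=
  if (d < m)%N then 0 else
  (1 + rate m)^-1 * \prod_(m <= i < d) (rate i / (1 + rate i.+1)).

(** Limiting average number of triangles at a vertex of degree [d]: [D] at birth, then
    [D i / (m * rate i)] when the degree passes from [i] to [i + 1], the ratio of the expected gain
    [D i / (m n)] per step to the probability [rate i / n] of leaving degree [i]. *)
Definition mean_triangles (d : nat) : R :=
  D + D / m%:R * \sum_(m <= i < d) (i%:R / rate i).

Definition tri_density (d : nat) : R := deg_density d * mean_triangles d.

Lemma rateS d : rate d.+1 = A + rate d.
Proof. by rewrite /rate -natr1; ring. Qed.

(** [B] may be negative; the bound comes from [rate d = A (d - m) + (1 - A) m]. *)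
Lemma rate_ge d : (m <= d)%N -> Num.min A (1 - A) * d%:R <= rate d.
Proof.
move=> md; rewrite /rate.
have md' : m%:R <= d%:R :> R by rewrite ler_nat.
have m0 : 0 < m%:R :> R by rewrite ltr0n.
have -> : B = m%:R - 2 * m%:R * A by lin.
have [h1 h2] : Num.min A (1 - A) <= A /\ Num.min A (1 - A) <= 1 - A.
  by rewrite !ge_min !lexx orbT.
set k := Num.min _ _ in h1 h2 *.
have h3 : k * (d%:R - m%:R) <= A * (d%:R - m%:R) by rewrite ler_wpM2r ?subr_ge0.
have h4 : k * m%:R <= (1 - A) * m%:R by rewrite ler_wpM2r ?ler0n.
lra.
Qed.

Lemma minA_gt0 : 0 < Num.min A (1 - A).
Proof. by rewrite lt_min A_gt0/= subr_gt0. Qed.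

Lemma rate_gt0 d : (m <= d)%N -> 0 < rate d.
Proof.
move=> md; apply: lt_le_trans (rate_ge md).
by rewrite mulr_gt0 ?minA_gt0// ltr0n (leq_trans m_gt0).
Qed.

Lemma rate_le d : (m <= d)%N -> rate d <= 2 * d%:R.
Proof.
move=> md; have : m%:R <= d%:R :> R by rewrite ler_nat.
have : 0 < m%:R :> R by rewrite ltr0n.
move=> m0 md'; have Am : 0 <= A * m%:R by rewrite mulr_ge0 ?ltW.
have : 0 <= (1 - A) * d%:R by rewrite mulr_ge0 ?subr_ge0 ?(ltW A_lt1).
by rewrite /rate; lin.
Qed.

Lemma deg_density_lt d : (d < m)%N -> deg_density d = 0.
Proof. by rewrite /deg_density => ->. Qed.

Lemma deg_density_min : deg_density m * (1 + rate m) = 1.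
Proof.
rewrite /deg_density ltnn big_geq// mulr1 mulVf// gt_eqF//.
by have := rate_gt0 (leqnn m); lra.
Qed.

Lemma deg_densityS d : (m <= d)%N ->
  deg_density d.+1 * (1 + rate d.+1) = rate d * deg_density d.
Proof.
move=> md; rewrite /deg_density !ltnNge md leqW//= big_nat_recr//=.
have := @rate_gt0 d.+1 (leqW md) => h.
by field; rewrite !gt_eqF//=; have := rate_gt0 (leqnn m); lra.
Qed.

Lemma deg_density_gt0 d : (m <= d)%N -> 0 < deg_density d.
Proof.
move=> md; rewrite /deg_density ltnNge md/=.
apply: mulr_gt0; first by rewrite invr_gt0; have := rate_gt0 (leqnn m); lra.
rewrite big_nat_cond prodr_gt0// => i /andP[/andP[mi _] _].
have := rate_gt0 mi; have := @rate_gt0 i.+1 (leqW mi) => h1 h2.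
by rewrite divr_gt0//; lra.
Qed.

Lemma deg_density_ge0 d : 0 <= deg_density d.
Proof.
by have [/deg_density_lt ->//|/deg_density_gt0/ltW] := ltnP d m.
Qed.

(** By the recurrence, [d * deg_density d] is nonincreasing from [m] on because [B <= m <= d]. *)
Lemma deg_density_mass d : d%:R * deg_density d <= m%:R.
Proof.
have [dm|] := ltnP d m; first by rewrite deg_density_lt// mulr0 ler0n.
elim: d => [|d IH]; first by move=> h; move: m_gt0; rewrite ltnNge h.
rewrite leq_eqVlt => /orP[/eqP <-|].
  have := deg_density_min; have := deg_density_gt0 (leqnn m).
  have := rate_gt0 (leqnn m); have := ler0n R m => h1 h2 h3 h4.
  by rewrite ler_piMr//; nra.
rewrite ltnS => md; apply: le_trans (IH md).
have := deg_densityS md; have := deg_density_gt0 (leqW md).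
have := deg_density_gt0 md; have := rate_gt0 md; rewrite rateS.
have md' : m%:R <= d%:R :> R by rewrite ler_nat.
have m0 : 0 < m%:R :> R by rewrite ltr0n.
rewrite -natr1 => l0 c0 c1 e.
have s0 : 0 < 1 + (A + rate d) by lin.
rewrite -(ler_pM2r s0) -mulrA e mulrCA [X in _ <= X](_ : _ = (d%:R * (1 + (A + rate d))) * deg_density d); last by ring.
have Am : 0 < A * m%:R by rewrite mulr_gt0.
rewrite mulrA ler_wpM2r ?ltW//; rewrite /rate; lin.
Qed.

Lemma deg_density_le1 d : deg_density d <= 1.
Proof.
have [dm|] := ltnP d m; first by rewrite deg_density_lt.
elim: d => [|d IH]; first by move=> h; move: m_gt0; rewrite ltnNge h.
rewrite leq_eqVlt => /orP[/eqP <-|].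
  have := deg_density_min; have := deg_density_gt0 (leqnn m).
  by have := rate_gt0 (leqnn m) => h1 h2 h3; nra.
rewrite ltnS => md; have := IH md; have := deg_densityS md.
have := deg_density_gt0 (leqW md); have := deg_density_gt0 md.
have := rate_gt0 md; rewrite rateS => l0 c0 c1 e cd1.
have s0 : 0 < 1 + (A + rate d) by lin.
by rewrite -(ler_pM2r s0) e; nlin.
Qed.

Lemma mean_trianglesS d : (m <= d)%N ->
  mean_triangles d.+1 = mean_triangles d + D / m%:R * (d%:R / rate d).
Proof. by move=> md; rewrite /mean_triangles big_nat_recr//= mulrDr addrA. Qed.

Lemma mean_triangles_min : mean_triangles m = D.
Proof. by rewrite /mean_triangles big_geq// mulr0 addr0. Qed.

(** Growth is linear because each [i / rate i] lies between [1/2] and [1 / Num.min A (1 - A)]; the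
    lower half gives [mean_triangles_ge]. *)
Lemma mean_triangles_le : exists2 C : R, 0 < C &
  forall d, (m <= d)%N -> mean_triangles d <= C * d%:R.
Proof.
have k0 := minA_gt0; have m0 : 0 < m%:R :> R by rewrite ltr0n.
exists (D + D / m%:R * (Num.min A (1 - A))^-1) => [|d].
  by rewrite addr_gt0// mulr_gt0// ?invr_gt0// divr_gt0.
elim: d => [|d IH]; first by move=> h; move: m_gt0; rewrite ltnNge h.
rewrite leq_eqVlt => /orP[/eqP <-|].
  rewrite mean_triangles_min mulrDl -[leLHS]addr0 lerD//.
    by rewrite ler_peMr ?(ltW D_gt0)// ler1n.
  by rewrite !mulr_ge0 ?invr_ge0// ltW.
rewrite ltnS => md; rewrite mean_trianglesS// -natr1 mulrDr mulr1 lerD ?IH//.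
apply: (@le_trans _ _ (D / m%:R / Num.min A (1 - A))); last by rewrite lerDr ltW.
rewrite ler_pM2l ?divr_gt0// ler_pdivrMr ?rate_gt0// -ler_pdivrMl ?invr_gt0//.
by rewrite invrK rate_ge.
Qed.

Lemma mean_triangles_ge : exists2 k : R, 0 < k &
  forall d, (m <= d)%N -> k * d%:R <= mean_triangles d.
Proof.
have m0 : 0 < m%:R :> R by rewrite ltr0n.
exists (D / m%:R / 2) => [|d]; first by rewrite !divr_gt0.
elim: d => [|d IH]; first by move=> h; move: m_gt0; rewrite ltnNge h.
rewrite leq_eqVlt => /orP[/eqP <-|].
  rewrite mean_triangles_min [leLHS](_ : _ = D / 2); first by move: D_gt0 => ?; lra.
  by field; rewrite gt_eqF.
rewrite ltnS => md; rewrite mean_trianglesS// -[d.+1%:R]natr1.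
rewrite (mulrDr (D / m%:R / 2)) mulr1 lerD ?IH//.
rewrite ler_pM2l ?divr_gt0// ler_pdivlMr ?rate_gt0//.
by have := rate_le md; lra.
Qed.

Lemma mean_triangles_gt0 d : (m <= d)%N -> 0 < mean_triangles d.
Proof.
have [k k0 h] := mean_triangles_ge => md; apply: lt_le_trans (h _ md).
by rewrite mulr_gt0// ltr0n (leq_trans m_gt0).
Qed.

Lemma tri_density_min : tri_density m * (1 + rate m) = D.
Proof. by rewrite /tri_density mean_triangles_min mulrAC deg_density_min mul1r. Qed.

Lemma tri_densityS d : (m <= d)%N ->
  tri_density d.+1 * (1 + rate d.+1) =
  rate d * tri_density d + D / m%:R * (d%:R * deg_density d).
Proof.
move=> md; rewrite /tri_density mulrAC deg_densityS// mean_trianglesS//.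
by field; rewrite (gt_eqF (rate_gt0 md)) pnatr_eq0 -lt0n m_gt0.
Qed.

Lemma tri_density_gt0 d : (m <= d)%N -> 0 < tri_density d.
Proof. by move=> md; rewrite mulr_gt0 ?deg_density_gt0// mean_triangles_gt0. Qed.

Lemma tri_density_le : exists C : R, forall d, tri_density d <= C.
Proof.
have [C C0 h] := mean_triangles_le; exists (C * m%:R) => d.
have [dm|md] := ltnP d m.
  by rewrite /tri_density deg_density_lt// mul0r mulr_ge0// ltW.
apply: (@le_trans _ _ (deg_density d * (C * d%:R))).
  by rewrite ler_wpM2l ?h// deg_density_ge0.
by rewrite mulrCA ler_wpM2l ?(ltW C0)// mulrC deg_density_mass.
Qed.

Let p := A^-1.

Let p_gt1 : 1 < p. Proof. by rewrite invf_gt1. Qed.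

Let p_gt0 : 0 < p. Proof. by rewrite invr_gt0. Qed.

Let p1_ge1 : 1 <= 1 + p. Proof. by rewrite lerDl ltW. Qed.

Let rateE d : rate d = A * (d%:R + B / A).
Proof. by rewrite /rate mulrDr mulrCA mulfV ?gt_eqF// mulr1. Qed.

Let shift_gt0 d : (m <= d)%N -> 0 < d%:R + B / A.
Proof. by move=> md; have := rate_gt0 md; rewrite rateE pmulr_rgt0. Qed.

Let density_ratio d : (m <= d)%N ->
  deg_density d.+1 = deg_density d * ((d%:R + B / A) / (d.+1%:R + B / A + p)).
Proof.
move=> md; have := deg_densityS md; rewrite !rateE => e.
have h1 := shift_gt0 md; have h2 := shift_gt0 (leqW md).
have Ap : A * p = 1 by rewrite /p mulfV ?gt_eqF.
have s0 : 0 < 1 + A * (d.+1%:R + B / A) by rewrite addr_gt0// mulr_gt0.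
apply: (mulIf (lt0r_neq0 s0)); rewrite e.
rewrite [1 + _](_ : _ = A * (d.+1%:R + B / A + p)); last by rewrite [RHS]mulrDr Ap addrC.
set y := d.+1%:R + B / A + p; have y0 : 0 < y by rewrite addr_gt0.
by set x := d%:R + B / A; field; rewrite gt_eqF.
Qed.

(** Power law of exponent [1 + 1/A], lower half. By Bernoulli's inequality the product of
    [deg_density d] with the power [1 + p] of [d + B / A] is nondecreasing; the shift [B / A] is
    then absorbed into the factor [M]. *)
Lemma deg_density_ge : exists2 k : R, 0 < k &
  forall d, (m <= d)%N -> k * d%:R `^ (- (1 + p)) <= deg_density d.
Proof.
pose x d : R := d%:R + B / A.
have mono d : (m <= d)%N ->
    deg_density m * x m `^ (1 + p) <= deg_density d * x d `^ (1 + p).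
  elim: d => [|d IH]; first by move=> h; move: m_gt0; rewrite ltnNge h.
  rewrite leq_eqVlt => /orP[/eqP <-//|]; rewrite ltnS => md.
  apply: (le_trans (IH md)); rewrite density_ratio// -[leRHS]mulrA.
  rewrite ler_pM2l ?deg_density_gt0//.
  have x0 : 0 < x d := shift_gt0 md.
  have xS : x d.+1 = x d + 1 by rewrite /x -natr1; ring.
  rewrite -/(x d) -/(x d.+1) xS; have x10 : 0 < x d + 1 := addr_gt0 x0 ltr01.
  rewrite mulrAC ler_pdivlMr; last exact: addr_gt0 x10 p_gt0.
  have bern : 1 + p * (x d)^-1 <= (1 + (x d)^-1) `^ p.
    by rewrite powR_bernoulli ?ltW// addr_gt0 ?invr_gt0.
  have ex : x d + 1 = x d * (1 + (x d)^-1) by field; rewrite gt_eqF.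
  have y0 : 0 < 1 + (x d)^-1 by rewrite addr_gt0 ?invr_gt0.
  rewrite {2}ex (powRM _ (ltW x0) (ltW y0)) mulrC [leRHS]mulrCA mulrC.
  rewrite ler_pM2l ?powR_gt0// (powRD (x := 1 + _)) ?(gt_eqF y0) ?implybT//.
  rewrite (powRr1 (ltW y0)).
  rewrite mulrA -ex.
  apply: (@le_trans _ _ ((x d + 1) * (1 + p * (x d)^-1))).
    have : 0 <= p / x d by rewrite divr_ge0 ?ltW.
    have : p = x d * (p / x d) by field; rewrite gt_eqF.
    by move: p_gt0 => *; nra.
  by rewrite ler_pM2l.
pose M := 1 + `|B / A|; have M0 : 0 < M by rewrite ltr_wpDr.
exists (deg_density m * x m `^ (1 + p) * M `^ (- (1 + p))).
  by rewrite !mulr_gt0 ?powR_gt0 ?deg_density_gt0// shift_gt0.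
move=> d md; have d0 : 0 < d%:R :> R by rewrite ltr0n (leq_trans m_gt0).
rewrite -mulrA -powRM ?(ltW M0) ?(ltW d0)// powRN ler_pdivrMr ?powR_gt0 ?mulr_gt0//.
apply: (le_trans (mono d md)); rewrite ler_pM2l ?deg_density_gt0//.
apply: ge0_ler_powR; rewrite ?nnegrE; [by rewrite (le_trans _ p1_ge1)|
  exact/ltW/shift_gt0|by rewrite mulr_ge0// ltW|].
rewrite /x /M mulrDl mul1r lerD2l.
by rewrite (le_trans (ler_norm _))// ler_peMr// ler1n (leq_trans m_gt0).
Qed.

(** With the shift [B / A + p] in place of [B / A], the ratio of consecutive densities is
    [1 - (1 + p) / x d.+1], and Bernoulli's inequality now makes the product with the power of [x d]
    nonincreasing. *)
Lemma deg_density_le : exists C : R, forall d, (m <= d)%N ->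
  deg_density d * d%:R `^ (1 + p) <= C.
Proof.
pose x d : R := d%:R + B / A + p.
have xgt d : (m <= d)%N -> 0 < x d.
  by move=> md; rewrite addr_gt0 ?shift_gt0.
have mono d : (m <= d)%N ->
    deg_density d * x d `^ (1 + p) <= deg_density m * x m `^ (1 + p).
  elim: d => [|d IH]; first by move=> h; move: m_gt0; rewrite ltnNge h.
  rewrite leq_eqVlt => /orP[/eqP <-//|]; rewrite ltnS => md.
  apply: le_trans (IH md); rewrite density_ratio// -[leLHS]mulrA.
  rewrite ler_pM2l ?deg_density_gt0//.
  have x0 := xgt _ md; have xS0 := xgt _ (leqW md).
  have xS : x d.+1 = x d + 1 by rewrite /x -natr1; ring.
  have y0 : 0 < 1 + - (x d.+1)^-1.
    by rewrite subr_gt0 invf_lt1// xS ltrDr.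
  have bern : 1 + (1 + p) * - (x d.+1)^-1 <= (1 - (x d.+1)^-1) `^ (1 + p).
    by rewrite powR_bernoulli.
  have -> : x d = x d.+1 * (1 - (x d.+1)^-1) by rewrite mulrBr mulfV ?gt_eqF// xS; ring.
  rewrite (powRM _ (ltW xS0) (ltW y0)) mulrC ler_pM2l ?powR_gt0//.
  apply: le_trans bern.
  have dS : d.+1%:R = d%:R + 1 :> R by rewrite -natr1.
  rewrite le_eqVlt; apply/orP; left; apply/eqP.
  rewrite -/(x d.+1) -[d%:R + B / A](_ : x d.+1 - (1 + p) = _).
    by rewrite mulrBl mulfV ?gt_eqF//; ring.
  by rewrite /x dS; ring.
(* It remains to compare [d] with [x d]. For a nonnegative shift [d <= x d]; for a negative one
   [d / x d] is largest at [d = m], which gives [q]. *)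
have [B0|B0] := leP 0 (B / A + p).
  exists (deg_density m * x m `^ (1 + p)) => d md; apply: le_trans (mono d md).
  rewrite ler_pM2l ?deg_density_gt0//; apply: ge0_ler_powR; rewrite ?nnegrE ?ler0n//.
  - by rewrite ltW// addr_gt0.
  - exact/ltW/xgt.
  - by rewrite /x -addrA lerDl.
have xm := xgt m (leqnn m); have m0 : 0 < m%:R :> R by rewrite ltr0n.
pose q := m%:R / x m; have q0 : 0 < q by rewrite divr_gt0.
exists (q `^ (1 + p) * (deg_density m * x m `^ (1 + p))) => d md.
apply: le_trans (_ : q `^ (1 + p) * (deg_density d * x d `^ (1 + p)) <= _).
  rewrite mulrCA ler_pM2l ?deg_density_gt0// -powRM ?(ltW q0) ?(ltW (xgt _ md))//.
  apply: ge0_ler_powR; rewrite ?nnegrE ?ler0n//.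
  - by rewrite ltW// addr_gt0.
  - by rewrite mulr_ge0// ltW// xgt.
  rewrite /q mulrAC ler_pdivlMr//.
  have md' : m%:R <= d%:R :> R by rewrite ler_nat.
  by rewrite /x; nra.
by rewrite ler_pM2l ?powR_gt0// mono.
Qed.

(** The recurrence makes the sum telescope. As [m + B = 2 m (1 - A)], the full series is [2 m], the
    average degree, as soon as the boundary term vanishes: no degree mass escapes to infinity. *)
Lemma deg_density_sum1 L : (m <= L)%N ->
  (1 - A) * (\sum_(k < L.+1) k%:R * deg_density k) =
  m%:R + B - (L.+1%:R + B) * (rate L * deg_density L).
Proof.
elim: L => [|L IH]; first by move=> h; move: m_gt0; rewrite ltnNge h.
rewrite leq_eqVlt => /orP[/eqP mL|]; rewrite big_ord_recr/=.
  rewrite big1 => [|i _]; last by rewrite deg_density_lt ?mulr0// mL ltn_ord.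
  have := deg_density_min; rewrite -mL /rate -[m.+1%:R]natr1 => e.
  have e' : deg_density m * (A * m%:R + B) = 1 - deg_density m by lra.
  have -> : m%:R + B = (m%:R + B) * (deg_density m * (1 + (A * m%:R + B))).
    by rewrite e mulr1.
  ring.
rewrite ltnS => mL; rewrite mulrDr IH//.
have e := deg_densityS mL; rewrite -e !rateS -[L.+2%:R]natr1 /rate -natr1; ring.
Qed.

(** The boundary term of [deg_density_sum1] is [O(L^(1 - 1/A))] by the power law, hence tends to [0]
    because [A < 1]. *)
Lemma deg_density_tail (e : R) : 0 < e ->
  exists L, 2 * m%:R - e <= \sum_(k < L) k%:R * deg_density k.
Proof.
move=> e0; have [C hC] := deg_density_le.
have A1 : 0 < 1 - A by rewrite subr_gt0.
have pm1 : 0 < p - 1 by rewrite subr_gt0.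
have [N hN] := powR_nat_ge (6 * C / (e * (1 - A))) pm1.
pose L := maxn N m; exists L.+1.
have mL : (m <= L)%N by rewrite leq_maxr.
have L0 : 0 < L%:R :> R by rewrite ltr0n (leq_trans m_gt0).
have mL' : m%:R <= L%:R :> R by rewrite ler_nat.
have L1 : 1 <= L%:R :> R by rewrite ler1n (leq_trans m_gt0).
have := hN _ (leq_maxl N m); rewrite -/L ler_pdivrMr ?mulr_gt0// => hL.
have cL := deg_density_gt0 mL; have rL := rate_gt0 mL.
have Bm : B <= m%:R.
  by have : 0 <= A * m%:R by [rewrite mulr_ge0// ltW]; lin.
have key : (L.+1%:R + B) * (rate L * deg_density L) <= e * (1 - A).
  apply: (@le_trans _ _ (3 * L%:R * (2 * L%:R * deg_density L))).
    apply: ler_pM => //.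
    - have : 0 <= A * m%:R by rewrite mulr_ge0// ltW.
      have : A * m%:R <= m%:R by rewrite ler_piMl// ltW.
      by rewrite -natr1; lin.
    - by rewrite mulr_ge0// ltW.
    - by rewrite -natr1; lra.
    - by rewrite ler_pM2r// rate_le.
  have w0 : 0 < L%:R `^ (p - 1) by rewrite powR_gt0.
  rewrite -(ler_pM2r w0) [leRHS]mulrC; apply: le_trans hL.
  rewrite (_ : 3 * L%:R * _ * _ = 6 * (deg_density L * L%:R `^ (1 + p))).
    by rewrite ler_pM2l// hC.
  have -> : 1 + p = 2%:R + (p - 1) by ring.
  rewrite (powRD (r := 2%:R)) ?(gt_eqF L0) ?implybT//.
  by rewrite (powR_mulrn 2 (ltW L0)); ring.
rewrite -(ler_pM2l A1) deg_density_sum1//.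
rewrite mulrBr [_ * e]mulrC.
have -> : (1 - A) * (2 * m%:R) = m%:R + B.
  rewrite (_ : _ * _ = m%:R + (m%:R - 2 * m%:R * A)); last by ring.
  by lin.
by rewrite lerD2l lerN2.
Qed.

End Weights.

(** * Adding one vertex *)

Section Extension.
Variables (m n : nat).
Local Notation adjacent := Defs.adjacent.

Implicit Types (g : 'M[nat]_n) (v w : 'I_n).

Definition extends g (g' : 'M[nat]_n.+1) : Prop :=
  [/\ multigraph g',
      forall i j : 'I_n, g' (old_vertex i) (old_vertex j) = g i j &
      (\sum_(j < n.+1) g' ord_max j)%N = m].

Definition links (g' : 'M[nat]_n.+1) v : nat := g' ord_max (old_vertex v).

(** The triangles at the old vertex [v] that contain the new vertex. *)
Definition new_triangles g (g' : 'M[nat]_n.+1) v : nat :=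
  if (0 < links g' v)%N then (\sum_w (adjacent g v w && (0 < links g' w)))%N
  else 0%N.

Definition birth_triangles g (g' : 'M[nat]_n.+1) : nat :=
  (\sum_(v < n) \sum_(w < n) [&& (v < w)%N, adjacent g v w, 0 < links g' v & 0 < links g' w])%N.

Lemma triangles_atE k (g : 'M[nat]_k) (v : 'I_k) :
  triangles_at g v = (\sum_(i < k) \sum_(j < k)
    [&& (i < j)%N, adjacent g v i, adjacent g v j & adjacent g i j])%N.
Proof.
rewrite /triangles_at -sum1_card pair_big/= big_mkcond/=.
by apply: eq_bigr => -[i j] _; rewrite inE/=; case: ifP.
Qed.

Section Step.
Variables (g : 'M[nat]_n) (g' : 'M[nat]_n.+1).
Hypothesis gg' : extends g g'.

Let old_inj : injective (@old_vertex n).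
Proof. by move=> i j /(congr1 val)/= /val_inj. Qed.

Let sym i j : g' i j = g' j i.
Proof. by case: gg' => /matrixP/(_ j i); rewrite mxE. Qed.

Lemma links_sum : (\sum_v links g' v + g' ord_max ord_max)%N = m.
Proof. by case: gg' => _ _; rewrite big_ord_recr. Qed.

Lemma links_le v : (links g' v <= m)%N.
Proof. by rewrite -links_sum (bigD1 v)//= -!addnA leq_addr. Qed.

Lemma loops_le : (g' ord_max ord_max <= m)%N.
Proof. by rewrite -links_sum leq_addl. Qed.

Lemma linked_sum : (\sum_v (0 < links g' v) <= m)%N.
Proof.
rewrite -[leqRHS]links_sum (leq_trans _ (leq_addr _ _))// leq_sum// => v _.
by case: (links g' v).
Qed.

Lemma deg_old v : deg g' (old_vertex v) = (deg g v + links g' v)%N.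
Proof.
rewrite /deg big_ord_recr/=; case: gg' => _ old _.
rewrite old [g' (old_vertex v) ord_max]sym -/(links g' v) addnAC; congr (_ + _ + _)%N.
by apply: eq_bigr => j _; exact: old.
Qed.

Lemma deg_new : deg g' ord_max = (m + g' ord_max ord_max)%N.
Proof. by rewrite /deg; case: gg' => _ _ ->. Qed.

Lemma adjacent_old v w :
  adjacent g' (old_vertex v) (old_vertex w) = adjacent g v w.
Proof. by case: gg' => _ old _; rewrite /adjacent old (inj_eq old_inj). Qed.

Let old_neq_max v : (old_vertex v == ord_max) = false.
Proof. by apply/eqP => /(congr1 val)/= e; have := ltn_ord v; rewrite e ltnn. Qed.

Lemma adjacent_new v : adjacent g' ord_max (old_vertex v) = (0 < links g' v)%N.
Proof. by rewrite /adjacent eq_sym old_neq_max. Qed.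

Lemma adjacent_new_sym v : adjacent g' (old_vertex v) ord_max = (0 < links g' v)%N.
Proof. by rewrite /adjacent sym old_neq_max. Qed.

Lemma triangles_at_old v :
  triangles_at g' (old_vertex v) = (triangles_at g v + new_triangles g g' v)%N.
Proof.
rewrite !triangles_atE big_ord_recr/= [X in (_ + X)%N]big1 ?addn0; last first.
  by move=> j _; rewrite ltnNge -ltnS ltn_ord.
rewrite (eq_bigr (fun i : 'I_n => (\sum_(j < n)
    [&& (i < j)%N, adjacent g v i, adjacent g v j & adjacent g i j] +
    [&& adjacent g v i, 0 < links g' v & 0 < links g' i])%N)).
  rewrite big_split/=; congr (_ + _)%N; rewrite /new_triangles; case: ifP => _.
    by apply: eq_bigr => i _.
  by rewrite big1// => i _; rewrite andbF.
move=> i _; rewrite big_ord_recr/=; congr (_ + _)%N.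
  by apply: eq_bigr => j _; rewrite !adjacent_old.
by rewrite ltn_ord/= !adjacent_old !adjacent_new_sym.
Qed.

Lemma triangles_at_new : triangles_at g' ord_max = birth_triangles g g'.
Proof.
rewrite triangles_atE big_ord_recr/= [X in (_ + X)%N]big1 ?addn0; last first.
  by move=> j _; rewrite ltnNge -ltnS ltn_ord.
apply: eq_bigr => i _; rewrite big_ord_recr/= /adjacent eqxx/= !andbF addn0.
apply: eq_bigr => j _; rewrite -!/(adjacent _ _ _) adjacent_old !adjacent_new.
by congr (nat_of_bool (_ && _)); case: (adjacent g i j); rewrite ?andbT ?andbF.
Qed.

Lemma new_triangles_le v : (new_triangles g g' v <= m)%N.
Proof.
rewrite /new_triangles; case: ifP => // _; apply: leq_trans linked_sum.
by apply: leq_sum => w _; case: (adjacent g v w).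
Qed.

Lemma birth_triangles_le : (birth_triangles g g' <= m * m)%N.
Proof.
apply: leq_trans (leq_mul linked_sum linked_sum); rewrite big_distrl/=.
apply: leq_sum => v _; rewrite big_distrr/=; apply: leq_sum => w _.
by case: (v < w)%N; case: (adjacent g v w); case: (0 < links g' v)%N;
  case: (0 < links g' w)%N.
Qed.

Lemma deg_sum_extends : (\sum_v deg g' v = \sum_v deg g v + 2 * m)%N.
Proof.
rewrite big_ord_recr/= deg_new (eq_bigr _ (fun i _ => deg_old i)) big_split/=.
by rewrite -addnA; congr addn; rewrite addnCA links_sum mul2n addnn.
Qed.

(** The new vertex carries at most [m^2] triangles and adds at most [m] to each of the at most [m]
    vertices it is linked to. The total number of triangles is therefore linear in [n], along every
    path. *)
Lemma triangles_sum_extends :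
  (\sum_v triangles_at g' v <= \sum_v triangles_at g v + 2 * (m * m))%N.
Proof.
rewrite big_ord_recr/= triangles_at_new (eq_bigr _ (fun i _ => triangles_at_old i)).
rewrite big_split/= -addnA leq_add2l mul2n -addnn leq_add ?birth_triangles_le//.
apply: leq_trans (leq_mul linked_sum (leqnn m)); rewrite big_distrl/=.
apply: leq_sum => v _; have := new_triangles_le v.
by rewrite /new_triangles; case: ifP => //= _; rewrite mul1n.
Qed.

Lemma loops_extends :
  (\sum_v g' v v = \sum_v g v v + g' ord_max ord_max)%N.
Proof.
rewrite big_ord_recr/=; congr (_ + _)%N.
by case: gg' => _ old _; apply: eq_bigr => v _; exact: old.
Qed.

(** New vertices have degree at least [m] and degrees never decrease, so only initial vertices can
    have degree below [m]. This bounds by [n0] the classes in which [deg_density] is [0]. *)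
Lemma low_extends :
  (\sum_v (deg g' v < m) <= \sum_v (deg g v < m))%N.
Proof.
rewrite big_ord_recr/= deg_new [(_ + _ < m)%N]ltnNge leq_addr addn0 leq_sum// => v _.
by rewrite deg_old; lia.
Qed.

Lemma nb_vertices_degE d :
  nb_vertices_deg g' d =
  (\sum_v (deg g v + links g' v == d) + (m + g' ord_max ord_max == d))%N.
Proof.
rewrite /nb_vertices_deg -sum1_card big_mkcond/= big_ord_recr/= !inE deg_new.
by congr (_ + _)%N; apply: eq_bigr => v _; rewrite inE deg_old.
Qed.

Lemma nb_triangles_degE d :
  nb_triangles_deg g' d =
  (\sum_v (deg g v + links g' v == d) * (triangles_at g v + new_triangles g g' v)
   + (m + g' ord_max ord_max == d) * birth_triangles g g')%N.
Proof.
rewrite /nb_triangles_deg big_mkcond/= big_ord_recr/= deg_new triangles_at_new.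
congr (_ + _)%N; last by case: ifP; rewrite ?mul1n.
by apply: eq_bigr => v _; rewrite deg_old triangles_at_old; case: ifP; rewrite ?mul1n.
Qed.

End Step.

Lemma adjacent_sum g v : (\sum_w adjacent g v w + 2 * g v v <= deg g v)%N.
Proof.
rewrite /deg mul2n -addnn addnA leq_add2r (bigD1 v)//= [leqRHS](bigD1 v)//=.
rewrite /adjacent eqxx/= add0n addnC leq_add2l.
by apply: leq_sum => w wv; case: (g v w) => [|k]; rewrite ?andbF// andbT; case: (v != w).
Qed.

Lemma triangles_at_le g v : (triangles_at g v <= deg g v ^ 2)%N.
Proof.
have h : (\sum_w adjacent g v w <= deg g v)%N.
  by apply: leq_trans (adjacent_sum g v); rewrite leq_addr.
rewrite triangles_atE; apply: leq_trans (leq_mul h h); rewrite big_distrl/=.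
apply: leq_sum => i _; rewrite big_distrr/=; apply: leq_sum => j _.
by case: (i < j)%N; case: (adjacent g v i); case: (adjacent g v j); case: adjacent.
Qed.

(** Handshake identity: the sums over [i <= j] and over [j <= i] both count the edges, and together
    they count each loop twice, as [deg] does. *)
Lemma deg_sumE g : multigraph g -> (\sum_v deg g v = 2 * nb_edges g)%N.
Proof.
move=> sg; have sym i j : g i j = g j i by rewrite -{1}sg mxE.
have e1 : (nb_edges g = \sum_(i < n) \sum_(j < n) (if (i <= j)%N then g i j else 0))%N.
  by apply: eq_bigr => i _; rewrite big_mkcond.
have e2 : (nb_edges g = \sum_(i < n) \sum_(j < n) (if (j <= i)%N then g i j else 0))%N.
  rewrite e1 exchange_big/=; apply: eq_bigr => i _; apply: eq_bigr => j _.
  by rewrite sym.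
rewrite mul2n -addnn {1}e1 e2 -big_split/=; apply: eq_bigr => i _.
rewrite -big_split/= /deg (bigD1 i)//= [RHS](bigD1 i)//= leqnn addnAC; congr (_ + _)%N.
apply: eq_bigr => j ji; have : (i : nat) != j by rewrite eq_sym.
by case: ltngtP => //=; rewrite ?addn0.
Qed.

End Extension.

(** * Expectations as finite sums *)

Section WeightedMean.
Context {R : realType}.

Definition wmean (I : finType) (U : Type) (dec : I -> U) (q : I -> R)
  (f : U -> R) : R := \sum_i q i * f (dec i).

Context {I : finType} {U : Type} {dec : I -> U} {q : I -> R}.
Implicit Types f h : U -> R.

Lemma eq_wmean f h : f =1 h -> wmean dec q f = wmean dec q h.
Proof. by move=> fh; apply: eq_bigr => i _; rewrite fh. Qed.

Lemma wmeanD f h :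
  wmean dec q (fun u => f u + h u) = wmean dec q f + wmean dec q h.
Proof. by rewrite -big_split; apply: eq_bigr => i _; rewrite mulrDr. Qed.

Lemma wmeanZ c f : wmean dec q (fun u => c * f u) = c * wmean dec q f.
Proof. by rewrite /wmean mulr_sumr; apply: eq_bigr => i _; rewrite mulrCA. Qed.

Lemma wmeanB f h :
  wmean dec q (fun u => f u - h u) = wmean dec q f - wmean dec q h.
Proof.
by rewrite -sumrB; apply: eq_bigr => i _; rewrite mulrBr.
Qed.

Lemma wmean_sum (J : finType) (P : pred J) (F : J -> U -> R) :
  wmean dec q (fun u => \sum_(j | P j) F j u) = \sum_(j | P j) wmean dec q (F j).
Proof.
by rewrite exchange_big; apply: eq_bigr => i _; rewrite mulr_sumr.
Qed.

Hypothesis q_ge0 : forall i, 0 <= q i.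

Lemma wmean_le f h : (forall i, q i != 0 -> f (dec i) <= h (dec i)) ->
  wmean dec q f <= wmean dec q h.
Proof.
move=> fh; apply: ler_sum => i _.
have [->|qi] := eqVneq (q i) 0; first by rewrite !mul0r.
by rewrite ler_wpM2l ?fh.
Qed.

Lemma wmean_ge0 f : (forall i, q i != 0 -> 0 <= f (dec i)) -> 0 <= wmean dec q f.
Proof.
move=> f0; apply: sumr_ge0 => i _.
by have [->|qi] := eqVneq (q i) 0; rewrite ?mul0r// mulr_ge0// f0.
Qed.

Lemma ler_norm_wmean f : `|wmean dec q f| <= wmean dec q (fun u => `|f u|).
Proof.
apply: le_trans (ler_norm_sum _ _ _) _; apply: ler_sum => i _.
by rewrite normrM ger0_norm.
Qed.

Hypothesis q_sum : \sum_i q i = 1.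

Lemma wmean_cst c : wmean dec q (fun=> c) = c.
Proof. by rewrite /wmean -mulr_suml q_sum mul1r. Qed.

(** The variance is at most the mean square distance to any constant, so the centre [c] may be
    chosen for convenience. *)
Lemma wmean_variance f c :
  wmean dec q (fun u => f u ^+ 2) <=
  wmean dec q f ^+ 2 + wmean dec q (fun u => (f u - c) ^+ 2).
Proof.
set M := wmean dec q f.
have -> : wmean dec q (fun u => (f u - c) ^+ 2) =
    wmean dec q (fun u => f u ^+ 2) - 2 * c * M + c ^+ 2.
  rewrite -(wmean_cst (c ^+ 2)) -wmeanZ -wmeanB -wmeanD; apply: eq_wmean => u.
  by ring.
have := sqr_ge0 (M - c); rewrite sqrrB -mulr_natl.
lra.
Qed.

Lemma wmean_sqr f : wmean dec q f ^+ 2 <= wmean dec q (fun u => f u ^+ 2).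
Proof.
set M := wmean dec q f.
have : 0 <= wmean dec q (fun u => (f u - M) ^+ 2).
  by apply: wmean_ge0 => i _; exact: sqr_ge0.
have -> : wmean dec q (fun u => (f u - M) ^+ 2) =
    wmean dec q (fun u => f u ^+ 2) - 2 * M * M + M ^+ 2.
  rewrite -[in RHS](wmean_cst (M ^+ 2)) -wmeanZ -wmeanB -wmeanD; apply: eq_wmean => u.
  by ring.
lra.
Qed.

End WeightedMean.

(** Cauchy-Schwarz, obtained from the convexity of the square for the weights [a i / s]. *)
Lemma sqr_wsum_le (R : realType) (I : finType) (a y : I -> R) :
  (forall i, 0 <= a i) ->
  (\sum_i a i * y i) ^+ 2 <= (\sum_i a i) * \sum_i a i * y i ^+ 2.
Proof.
move=> a0; set s := \sum_i a i.
have s0 : 0 <= s by exact: sumr_ge0.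
have [s_eq|s_neq] := eqVneq s 0.
  have z i : a i = 0.
    exact: (psumr_eq0P (fun j _ => a0 j) s_eq).
  by rewrite s_eq mul0r big1 ?expr0n// => i _; rewrite z mul0r.
have sp : 0 < s by rewrite lt_def s_neq.
have := @wmean_sqr R I I id (fun i => a i / s) _ _ y; rewrite /wmean.
have q1 : \sum_i a i / s = 1 by rewrite -mulr_suml mulfV.
move=> /(_ (fun i => divr_ge0 (a0 i) s0) q1).
have e z : \sum_i a i / s * z i = (\sum_i a i * z i) / s.
  by rewrite mulr_suml; apply: eq_bigr => i _; rewrite mulrAC.
rewrite !e => h; have s2 : 0 < s ^+ 2 by rewrite exprn_gt0.
move: h; rewrite expr_div_n ler_pdivrMr// => /le_trans; apply.
by rewrite le_eqVlt; apply/orP; left; apply/eqP; field.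
Qed.

(** * Expectations and one-step expectations along the process *)

Section Chain.
Context {R : realType} {dT : measure_display} {T : measurableType dT}.
Variables (P : probability T R) (m n0 b : nat) (G : forall n : nat, T -> 'M[nat]_n).
Hypotheses (m_gt0 : (0 < m)%N) (n0_gt0 : (0 < n0)%N).
Hypothesis process : graph_process m n0 G.
Hypothesis bounded : forall n w i j, (n0 <= n)%N -> (G n w i j <= b)%N.

(* Multiplicities are bounded by [b] along the process, so each [G n] takes its
   values in the image of this finite type and expectations are finite sums. *)
Definition decode n (h : 'M['I_b.+1]_n) : 'M[nat]_n := map_mx (@nat_of_ord _) h.

Definition mass n (g : 'M[nat]_n) : R := fine (P [set w | G n w = g]).

Definition mean n : ('M[nat]_n -> R) -> R :=
  wmean (@decode n) (fun h => mass (decode h)).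

Definition cmean n (g : 'M[nat]_n) : ('M[nat]_n.+1 -> R) -> R :=
  wmean (@decode n.+1)
    (fun h => fine (P [set w | G n w = g /\ G n.+1 w = decode h]) / mass g).

Lemma meanD n (f h : 'M[nat]_n -> R) : mean (fun g => f g + h g) = mean f + mean h.
Proof. exact: wmeanD. Qed.

Lemma meanZ n c (f : 'M[nat]_n -> R) : mean (fun g => c * f g) = c * mean f.
Proof. exact: wmeanZ. Qed.

Lemma mean_sum n (J : finType) (Q : pred J) (F : J -> 'M[nat]_n -> R) :
  mean (fun g => \sum_(j | Q j) F j g) = \sum_(j | Q j) mean (F j).
Proof. exact: wmean_sum. Qed.

Lemma cmeanD n (g : 'M[nat]_n) f h :
  cmean g (fun g' => f g' + h g') = cmean g f + cmean g h.
Proof. exact: wmeanD. Qed.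

Lemma cmeanB n (g : 'M[nat]_n) f h :
  cmean g (fun g' => f g' - h g') = cmean g f - cmean g h.
Proof. exact: wmeanB. Qed.

Lemma cmeanZ n (g : 'M[nat]_n) c f : cmean g (fun g' => c * f g') = c * cmean g f.
Proof. exact: wmeanZ. Qed.

Lemma cmean_sum n (g : 'M[nat]_n) (J : finType) (Q : pred J) F :
  cmean g (fun g' => \sum_(j | Q j) F j g') = \sum_(j | Q j) cmean g (F j).
Proof. exact: wmean_sum. Qed.

Lemma eq_cmean n (g : 'M[nat]_n) f h : f =1 h -> cmean g f = cmean g h.
Proof. exact: eq_wmean. Qed.

Lemma decode_inj n : injective (@decode n).
Proof.
by move=> h h' /matrixP e; apply/matrixP => i j; have := e i j; rewrite !mxE => /val_inj.
Qed.

Lemma decode_surj n w : (n0 <= n)%N -> exists h, G n w = decode h.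
Proof.
move=> hn; exists (\matrix_(i, j) inord (G n w i j)); apply/matrixP => i j.
by rewrite !mxE inordK// ltnS bounded.
Qed.

Lemma fine_prob_ge0 (E : set T) : 0 <= fine (P E).
Proof. exact: fine_ge0. Qed.

Lemma prob_partition n (E : set T) : (n0 <= n)%N -> measurable E ->
  fine (P E) = \sum_h fine (P (E `&` [set w | G n w = decode h])).
Proof.
move=> hn mE.
have mG (g : 'M[nat]_n) : measurable (E `&` [set w | G n w = g]).
  by apply: measurableI => //; exact: (process_measurable process).
have EE : E = \bigcup_(h in [set` index_enum 'M['I_b.+1]_n]) (E `&` [set w | G n w = decode h]).
  apply/seteqP; split=> w; last by case=> h _ [].
  move=> Ew; have [h e] := decode_surj w hn; exists h => //=.
  exact: mem_index_enum.
rewrite [in LHS]EE measure_fin_bigcup//=; last 1 first.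
- move=> h h' _ _ [w [[_ e1] [_ e2]]]; apply: decode_inj.
  by rewrite -e1 -e2.
rewrite -fsbig_seq ?index_enum_uniq// sum_fine// => h _.
by rewrite fin_num_measure.
Qed.

Lemma prob_zero (E F : set T) : measurable E -> measurable F -> E `<=` F ->
  fine (P F) = 0 -> fine (P E) = 0.
Proof.
move=> mE mF EF F0; apply/eqP; rewrite eq_le fine_prob_ge0 andbT -F0.
by rewrite fine_le ?fin_num_measure// le_measure// inE.
Qed.

Lemma measurable_state n (g : 'M[nat]_n) : (n0 <= n)%N ->
  measurable [set w | G n w = g].
Proof. exact: (process_measurable process). Qed.

Lemma measurable_event n (Q : 'M[nat]_n -> bool) : (n0 <= n)%N ->
  measurable [set w | Q (G n w)].
Proof.
move=> hn.
have -> : [set w | Q (G n w)] =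
    \bigcup_(h in [set h : 'M['I_b.+1]_n | Q (decode h)]) [set w | G n w = decode h].
  apply/seteqP; split=> w /=; last by case=> h /= Qh ->.
  by move=> Qw; have [h e] := decode_surj w hn; exists h => //=; rewrite -e.
by apply: fin_bigcup_measurable => // h _; exact: measurable_state.
Qed.

Lemma mean_event n (Q : 'M[nat]_n -> bool) : (n0 <= n)%N ->
  fine (P [set w | Q (G n w)]) = mean (fun g => (Q g)%:R).
Proof.
move=> hn; rewrite (prob_partition hn (measurable_event Q hn)).
apply: eq_bigr => h _; have [Qh|Qh] := boolP (Q (decode h)).
  rewrite mulr1; congr (fine (P _)); apply/seteqP; split=> w /=; first by case.
  by move=> e; split=> //; rewrite e.
rewrite mulr0 [X in P X](_ : _ = set0) ?measure0//.
by apply/seteqP; split=> w //= -[Qw e]; move: Qh; rewrite -e Qw.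
Qed.

Lemma mass_ge0 n (g : 'M[nat]_n) : 0 <= mass g.
Proof. exact: fine_prob_ge0. Qed.

Lemma mass_sum n : (n0 <= n)%N -> \sum_(h : 'M['I_b.+1]_n) mass (decode h) = 1.
Proof.
move=> hn; have := prob_partition hn measurableT; rewrite probability_setT/= => ->.
by apply: eq_bigr => h _; rewrite setTI.
Qed.

Lemma mass_neq0 n (g : 'M[nat]_n) : mass g != 0 -> exists w, G n w = g.
Proof.
apply: contraNP => /forallNP h.
by rewrite /mass [X in P X](_ : _ = set0) ?measure0//; apply/seteqP; split.
Qed.

Lemma mass_neq0P n (g : 'M[nat]_n) : mass g != 0 -> P [set w | G n w = g] != 0%E.
Proof. by apply: contraNneq => e; rewrite /mass e. Qed.

Lemma cmass_ge0 n (g : 'M[nat]_n) (h : 'M['I_b.+1]_n.+1) :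
  0 <= fine (P [set w | G n w = g /\ G n.+1 w = decode h]) / mass g.
Proof. by rewrite divr_ge0 ?fine_prob_ge0. Qed.

Lemma cmass_sum n (g : 'M[nat]_n) : (n0 <= n)%N -> mass g != 0 ->
  \sum_(h : 'M['I_b.+1]_n.+1)
    fine (P [set w | G n w = g /\ G n.+1 w = decode h]) / mass g = 1.
Proof.
move=> hn g0; rewrite -mulr_suml -(prob_partition (leqW hn) (measurable_state g hn)).
by rewrite mulfV.
Qed.

(** Tower property. *)
Lemma mean_step n f : (n0 <= n)%N ->
  mean f = mean (fun g : 'M[nat]_n => cmean g f).
Proof.
move=> hn; rewrite /mean /cmean /wmean.
under [RHS]eq_bigr do rewrite mulr_sumr.
rewrite exchange_big; apply: eq_bigr => h _; rewrite -[mass (decode h)]/(fine _).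
rewrite (prob_partition hn (measurable_state _ (leqW hn))) mulr_suml.
apply: eq_bigr => h' _; rewrite mulrA; congr (_ * _).
have -> : [set w | G n.+1 w = decode h] `&` [set w | G n w = decode h'] =
    [set w | G n w = decode h' /\ G n.+1 w = decode h].
  by apply/seteqP; split=> w [].
(* For a state of mass zero the conditional weights are [0] by the convention on division, and the
   joint probability is [0] as well. *)
have [e|ne] := eqVneq (mass (decode h')) 0; last by rewrite mulrCA mulfV// mulr1.
rewrite e mul0r; apply: (prob_zero _ _ _ e) => [||w []//]; last exact: measurable_state.
exact: (measurableI _ _ (measurable_state _ hn) (measurable_state _ (leqW hn))).
Qed.

Lemma cmean_event n (g : 'M[nat]_n) (Q : 'M[nat]_n.+1 -> bool) : (n0 <= n)%N ->
  mass g != 0 ->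
  cmean g (fun g' => (Q g')%:R) = cond_prob P [set w | Q (G n.+1 w)] [set w | G n w = g].
Proof.
move=> hn g0; rewrite /cond_prob -/(mass g).
rewrite (prob_partition (leqW hn)); last first.
  by apply: measurableI; [exact: measurable_event (leqW hn)|exact: measurable_state].
rewrite mulr_suml; apply: eq_bigr => h _; rewrite mulrAC; congr (_ / _).
have [Qh|Qh] := boolP (Q (decode h)).
  rewrite mulr1; congr (fine (P _)); apply/seteqP; split=> w /=.
    by case=> -> e; rewrite e Qh.
  by case=> -[].
rewrite mulr0 [X in P X](_ : _ = set0) ?measure0//.
by apply/seteqP; split=> w //= -[[Qw _] e]; move: Qh; rewrite -e Qw.
Qed.

Lemma extends_process n w : (n0 <= n)%N -> extends m (G n w) (G n.+1 w).
Proof. by move=> hn; have [] := process_step process w hn. Qed.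

Lemma mean_le n f h : (forall g : 'M[nat]_n, mass g != 0 -> f g <= h g) ->
  mean f <= mean h.
Proof. by move=> fh; apply: wmean_le => // [i|i /fh//]; exact: mass_ge0. Qed.

Lemma mean_ge0 n f : (forall g : 'M[nat]_n, mass g != 0 -> 0 <= f g) -> 0 <= mean f.
Proof. by move=> fh; apply: wmean_ge0 => // [i|i /fh//]; exact: mass_ge0. Qed.

Lemma mean_cst n c : (n0 <= n)%N -> mean (fun _ : 'M[nat]_n => c) = c.
Proof. by move=> hn; apply: wmean_cst; exact: mass_sum. Qed.

Let cmass_neq0 n (g : 'M[nat]_n) h :
  fine (P [set w | G n w = g /\ G n.+1 w = decode h]) / mass g != 0 ->
  exists2 w, G n w = g & G n.+1 w = decode h.
Proof.
apply: contraNP => /forall2NP e; rewrite [X in P X](_ : _ = set0) ?measure0 ?mul0r//.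
by apply/seteqP; split=> w //= -[e1 e2]; case: (e w).
Qed.

(** Only graphs that extend [g] carry conditional weight, so deterministic inequalities about a
    single step pass to [cmean]. *)
Lemma cmean_le n (g : 'M[nat]_n) f h : (n0 <= n)%N ->
  (forall g', extends m g g' -> f g' <= h g') -> cmean g f <= cmean g h.
Proof.
move=> hn fh; apply: wmean_le => [i|i /cmass_neq0[w e <-]]; first exact: cmass_ge0.
by apply: fh; rewrite -e; exact: extends_process.
Qed.

Lemma cmean_ge0 n (g : 'M[nat]_n) f : (n0 <= n)%N ->
  (forall g', extends m g g' -> 0 <= f g') -> 0 <= cmean g f.
Proof.
move=> hn fh; apply: wmean_ge0 => [i|i /cmass_neq0[w e <-]]; first exact: cmass_ge0.
by apply: fh; rewrite -e; exact: extends_process.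
Qed.

Lemma cmean_ext n (g : 'M[nat]_n) f h : (n0 <= n)%N ->
  (forall g', extends m g g' -> f g' = h g') -> cmean g f = cmean g h.
Proof.
by move=> hn fh; apply/eqP; rewrite eq_le !cmean_le// => g' /fh ->.
Qed.

Lemma cmean_cst n (g : 'M[nat]_n) c : (n0 <= n)%N -> mass g != 0 ->
  cmean g (fun=> c) = c.
Proof. by move=> hn g0; apply: wmean_cst; exact: cmass_sum. Qed.

End Chain.

(** * One-step drift of class sums *)

Section Law.
Context {R : realType} {dT : measure_display} {T : measurableType dT}.
Variables (P : probability T R) (m n0 b : nat) (A B D : R).
Variable G : forall n : nat, T -> 'M[nat]_n.

(* The T-subclass with [0 < A < 1], the error constants merged into [C] and the
   degree increment of [v] read off as [links g' v]. *)
Record attachment_law (C : R) : Prop := AttachmentLaw {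
  law_A_gt0 : 0 < A;
  law_A_lt1 : A < 1;
  law_D_gt0 : 0 < D;
  law_AB : 2 * m%:R * A + B = m%:R;
  law_m_gt0 : (0 < m)%N;
  law_n0_gt0 : (0 < n0)%N;
  law_process : graph_process m n0 G;
  law_bounded : forall n w i j, (n0 <= n)%N -> (G n w i j <= b)%N;
  law_C_ge0 : 0 <= C;
  law_no_link : forall n (g : 'M[nat]_n) v, (n0 <= n)%N -> mass P G g != 0 ->
    `|cmean P b G g (fun g' => (links g' v == 0)%:R)
      - (1 - rate A B (deg g v) / n%:R)| <= C * ((deg g v)%:R ^+ 2 / n%:R ^+ 2);
  law_one_link : forall n (g : 'M[nat]_n) v, (n0 <= n)%N -> mass P G g != 0 ->
    `|cmean P b G g (fun g' => (links g' v == 1)%:R) - rate A B (deg g v) / n%:R|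
    <= C * ((deg g v)%:R ^+ 2 / n%:R ^+ 2);
  law_many_links : forall n (g : 'M[nat]_n) v k, (n0 <= n)%N -> mass P G g != 0 ->
    (1 < k)%N ->
    cmean P b G g (fun g' => (links g' v == k)%:R)
    <= C * ((deg g v)%:R ^+ 2 / n%:R ^+ 2);
  law_pair : forall n (g : 'M[nat]_n) v w, (n0 <= n)%N -> mass P G g != 0 ->
    v != w ->
    `|cmean P b G g (fun g' => ((links g' v == 1) && (links g' w == 1))%:R)
      - (g v w)%:R * (D / (m%:R * n%:R))|
    <= C * ((deg g v)%:R * (deg g w)%:R / n%:R ^+ 2);
  law_loop : forall n, (n0 <= n)%N ->
    mean P b G (fun g : 'M[nat]_n.+1 => (0 < g ord_max ord_max)%N%:R) <= C / n%:R;
  law_sym : forall n (g : 'M[nat]_n), (n0 <= n)%N -> mass P G g != 0 -> multigraph g;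
  law_deg : forall n (g : 'M[nat]_n), (n0 <= n)%N -> mass P G g != 0 ->
    (\sum_v deg g v = 2 * (m * n))%N;
  law_low : forall n (g : 'M[nat]_n), (n0 <= n)%N -> mass P G g != 0 ->
    (\sum_v (deg g v < m) <= n0)%N;
  law_triangles : forall n (g : 'M[nat]_n), (n0 <= n)%N -> mass P G g != 0 ->
    (\sum_v triangles_at g v)%:R <= C * n%:R
}.

End Law.

Section OneStep.
Context {R : realType} {dT : measure_display} {T : measurableType dT}.
Variables (P : probability T R) (m n0 b : nat) (A B D C : R).
Variable G : forall n : nat, T -> 'M[nat]_n.
Hypothesis law : attachment_law P m n0 b A B D G C.

Let A_gt0 : 0 < A := law_A_gt0 law.
Let A_lt1 : A < 1 := law_A_lt1 law.
Let D_gt0 : 0 < D := law_D_gt0 law.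
Let AB : 2 * m%:R * A + B = m%:R := law_AB law.
Let m_gt0 : (0 < m)%N := law_m_gt0 law.
Let n0_gt0 : (0 < n0)%N := law_n0_gt0 law.
Let process : graph_process m n0 G := law_process law.
Let bounded : forall n w i j, (n0 <= n)%N -> (G n w i j <= b)%N := law_bounded law.
Let C_ge0 : 0 <= C := law_C_ge0 law.

Variables (n : nat) (g : 'M[nat]_n).
Hypotheses (hn : (n0 <= n)%N) (hg : mass P G g != 0).

Local Notation CE := (cmean P b G g).
Local Notation x v := ((deg g v)%:R : R).
Local Notation N := (n%:R : R).

Let CE_le f h := @cmean_le _ _ _ P m n0 b G process n g f h hn.
Let CE_ge0 f := @cmean_ge0 _ _ _ P m n0 b G process n g f hn.
Let CE_cst c := @cmean_cst _ _ _ P m n0 b G process bounded n g c hn hg.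

Let N_gt0 : 0 < N. Proof. by rewrite ltr0n (leq_trans n0_gt0). Qed.

Lemma deg_le_total v : (deg g v <= 2 * (m * n))%N.
Proof. by rewrite -(law_deg law hn hg) (bigD1 v)//= leq_addr. Qed.

Lemma deg_total : \sum_v x v = 2 * m%:R * N.
Proof. by rewrite -natr_sum (law_deg law hn hg) !natrM mulrA. Qed.

(** The quadratic error [C x^2 / N^2] is at most [2 m C x / N], because no degree exceeds the total
    degree [2 m N]. *)
Lemma linked_prob v :
  CE (fun g' => (0 < links g' v)%N%:R) <= (1 + m%:R + 2 * m%:R * C) * ((x v + 1) / N).
Proof.
have -> : CE (fun g' => (0 < links g' v)%N%:R) =
    1 - CE (fun g' => (links g' v == 0)%:R).
  rewrite (_ : 1 - _ = CE (fun=> 1) - CE (fun g' => (links g' v == 0)%:R)); last first.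
    by rewrite CE_cst.
  rewrite -cmeanB; apply: eq_cmean => g'.
  by case: (links g' v) => [|k]; rewrite ?subrr ?subr0.
have := law_no_link law v hn hg; rewrite ler_norml => /andP[h _].
apply: (@le_trans _ _ (rate A B (deg g v) / N + C * (x v ^+ 2 / N ^+ 2))).
  by rewrite lerBlDr -lerBlDl; move: h; lra.
have xN : x v <= 2 * m%:R * N by rewrite -mulrA -!natrM ler_nat deg_le_total.
have x0 : 0 <= x v by exact: ler0n.
rewrite [leRHS]mulrA ler_pdivlMr// mulrDl divfK ?gt_eqF//.
have -> : C * (x v ^+ 2 / N ^+ 2) * N = C * x v * (x v / N) by field; rewrite gt_eqF.
have xN' : x v / N <= 2 * m%:R by rewrite ler_pdivrMr.
have rx : rate A B (deg g v) <= x v + m%:R.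
  rewrite /rate; have m0 : 0 <= m%:R :> R := ler0n _ _.
  have : 0 <= A * m%:R by rewrite mulr_ge0// ltW.
  have : A * x v <= x v by rewrite ler_piMl// ltW.
  by move: AB => /=; lra.
have : C * x v * (x v / N) <= C * x v * (2 * m%:R) by rewrite ler_wpM2l// mulr_ge0.
have m0 : 0 <= m%:R :> R := ler0n _ _.
have mx : 0 <= m%:R * x v by rewrite mulr_ge0.
have mC : 0 <= m%:R * C by rewrite mulr_ge0.
lra.
Qed.

Lemma many_links_prob v :
  CE (fun g' => (1 < links g' v)%N%:R) <= m%:R * C * (x v ^+ 2 / N ^+ 2).
Proof.
rewrite -mulrA.
apply: (@le_trans _ _ (CE (fun g' => \sum_(k < m) (links g' v == k.+2)%:R))).
  apply: CE_le => g' gg'; have := links_le gg' v.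
  case e : (links g' v) => [|[|k]] km; rewrite ?sumr_ge0//.
  by rewrite (bigD1 (Ordinal (ltnW km)))//= eqxx lerDl sumr_ge0.
rewrite cmean_sum mulr_natl -[X in _ *+ X](card_ord m) -sumr_const.
by apply: ler_sum => k _; exact: (law_many_links law).
Qed.

Section Weights.
Variables (y : 'I_n -> R) (t : 'M[nat]_n.+1 -> 'I_n -> R) (z : 'M[nat]_n.+1 -> R).
Hypothesis y_ge0 : forall v, 0 <= y v.
Hypothesis t_bound : forall g' v, extends m g g' -> 0 <= t g' v <= m%:R.
Hypothesis t_zero : forall g' v, links g' v = 0%N -> t g' v = 0.
Hypothesis z_bound : forall g', extends m g g' -> 0 <= z g' <= m%:R ^+ 2.

(** Vertex and triangle counts are treated together. With [y = 1], [t = 0], [z = 1] the class sum is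
    the number of vertices of degree [d]; with [triangles_at], [new_triangles] and [birth_triangles]
    it is the number of triangles on them. *)
Definition class_sum (d : nat) : R := \sum_v (deg g v == d)%:R * y v.

Definition next_class_sum (d : nat) g' : R :=
  \sum_v (deg g v + links g' v == d)%N%:R * (y v + t g' v)
  + (m + g' ord_max ord_max == d)%N%:R * z g'.

(** To first order only two vertices matter: one of degree [d + 1] that gains nothing and one of
    degree [d] that gains one link. From a lower degree at least two links are needed, an event
    whose probability belongs to the error; from a higher degree class [d + 1] is out of reach. *)
Lemma vertex_drift d v :
  `|CE (fun g' => (deg g v + links g' v == d.+1)%N%:R * (y v + t g' v))
    - ((deg g v == d.+1)%:R * ((1 - rate A B d.+1 / N) * y v)
       + (deg g v == d)%:R * (rate A B d / N * y v
            + CE (fun g' => (links g' v == 1)%:R * t g' v)))|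
  <= C / N ^+ 2 * ((deg g v <= d.+1)%N%:R * (x v ^+ 2 * (y v + m%:R))).
Proof.
have w0 : 0 <= x v ^+ 2 * (y v + m%:R).
  by rewrite mulr_ge0 ?sqr_ge0// addr_ge0.
have cw0 : 0 <= C / N ^+ 2 * (x v ^+ 2 * (y v + m%:R)).
  by rewrite mulr_ge0// divr_ge0// sqr_ge0.
have [hd|hd] := ltnP d.+1 (deg g v).
  rewrite !gtn_eqF ?(ltnW hd)//= !mul0r addr0 subr0 mulr0.
  rewrite (_ : CE _ = 0) ?normr0// -[RHS](CE_cst 0); apply: eq_cmean => g'.
  by rewrite gtn_eqF ?mul0r// (leq_trans hd)// leq_addr.
rewrite mul1r; move: hd; rewrite leq_eqVlt => /orP[/eqP e|].
  rewrite e eqxx gtn_eqF// mul0r addr0 mul1r.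
  have -> : CE (fun g' => (d.+1 + links g' v == d.+1)%N%:R * (y v + t g' v)) =
      y v * CE (fun g' => (links g' v == 0)%:R).
    rewrite -cmeanZ; apply: eq_cmean => g'.
    rewrite -[X in _ == X]addn0 eqn_add2l mulrC.
    by have [/t_zero ->|] := eqVneq (links g' v) 0%N; rewrite ?addr0// !mulr0.
  rewrite [_ * y v]mulrC -mulrBr normrM (ger0_norm (y_ge0 v)) -e.
  apply: (@le_trans _ _ (y v * (C * (x v ^+ 2 / N ^+ 2)))).
    by rewrite ler_wpM2l// (law_no_link law).
  rewrite (_ : _ * _ = C / N ^+ 2 * (x v ^+ 2 * y v)); last by ring.
  by rewrite ler_wpM2l ?divr_ge0 ?sqr_ge0// ler_wpM2l ?sqr_ge0// lerDl.
rewrite ltnS leq_eqVlt => /orP[/eqP e|dv].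
  rewrite e eqxx ltn_eqF// mul0r add0r mul1r.
  have -> : CE (fun g' => (d + links g' v == d.+1)%N%:R * (y v + t g' v)) =
      y v * CE (fun g' => (links g' v == 1)%:R)
      + CE (fun g' => (links g' v == 1)%:R * t g' v).
    rewrite -cmeanZ -cmeanD; apply: eq_cmean => g'.
    by rewrite -addn1 eqn_add2l mulrDr [y v * _]mulrC.
  rewrite opprD addrACA subrr addr0 [_ * y v]mulrC -mulrBr normrM.
  rewrite (ger0_norm (y_ge0 v)) -e.
  apply: (@le_trans _ _ (y v * (C * (x v ^+ 2 / N ^+ 2)))).
    by rewrite ler_wpM2l// (law_one_link law).
  rewrite (_ : _ * _ = C / N ^+ 2 * (x v ^+ 2 * y v)); last by ring.
  by rewrite ler_wpM2l ?divr_ge0 ?sqr_ge0// ler_wpM2l ?sqr_ge0// lerDl.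
rewrite !ltn_eqF ?leqW// !mul0r addr0 subr0 ger0_norm; last first.
  apply: CE_ge0 => g' gg'; have /andP[t0 _] := t_bound v gg'.
  by rewrite mulr_ge0// addr_ge0.
apply: (@le_trans _ _ ((y v + m%:R) *
    CE (fun g' => (links g' v == (d.+1 - deg g v)%N)%:R))).
  rewrite -cmeanZ; apply: CE_le => g' gg'; have /andP[_ tm] := t_bound v gg'.
  have -> : (deg g v + links g' v == d.+1)%N = (links g' v == (d.+1 - deg g v)%N).
    by rewrite -[in RHS](eqn_add2l (deg g v)) subnKC// leqW// ltnW.
  by rewrite mulrC ler_wpM2r// lerD2l.
apply: (@le_trans _ _ ((y v + m%:R) * (C * (x v ^+ 2 / N ^+ 2)))).
  by rewrite ler_wpM2l ?addr_ge0// (law_many_links law)//; lia.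
by rewrite le_eqVlt; apply/orP; left; apply/eqP; ring.
Qed.

Lemma class_drift d :
  `|CE (next_class_sum d.+1)
    - ((1 - rate A B d.+1 / N) * class_sum d.+1 + rate A B d / N * class_sum d
       + \sum_v (deg g v == d)%:R * CE (fun g' => (links g' v == 1)%:R * t g' v)
       + CE (fun g' => (m + g' ord_max ord_max == d.+1)%N%:R * z g'))|
  <= C / N ^+ 2 * \sum_v (deg g v <= d.+1)%N%:R * (x v ^+ 2 * (y v + m%:R)).
Proof.
rewrite [CE _]cmeanD cmean_sum opprD addrACA subrr addr0.
rewrite [_ * class_sum d.+1]mulr_sumr [_ * class_sum d]mulr_sumr -!big_split/= -sumrB.
rewrite mulr_sumr; apply: le_trans (ler_norm_sum _ _ _) _; apply: ler_sum => v _.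
apply: le_trans (vertex_drift d v); rewrite le_eqVlt; apply/orP; left; apply/eqP.
by congr (`|_ - _|); ring.
Qed.

(** Apart from the birth, a class sum changes only through the at most [m] linked vertices.
    Cauchy-Schwarz with the link indicators as weights therefore costs a factor [m] and not the
    number of vertices; [linked_prob] then bounds the mean of each indicator. *)
Lemma class_noise d :
  CE (fun g' => (next_class_sum d g' - class_sum d) ^+ 2) <=
  2 * m%:R * (1 + m%:R + 2 * m%:R * C) *
    (\sum_v (deg g v <= d)%N%:R * ((x v + 1) / N * (y v + m%:R) ^+ 2))
  + 2 * m%:R ^+ 4.
Proof.
apply: (@le_trans _ _ (CE (fun g' => 2 * m%:R * (\sum_v (deg g v <= d)%N%:R *
    ((y v + m%:R) ^+ 2 * (0 < links g' v)%N%:R)) + 2 * m%:R ^+ 4))).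
  apply: CE_le => g' gg'; pose a v : R := (0 < links g' v)%N%:R.
  pose q v : R := (deg g v + links g' v == d)%N%:R * (y v + t g' v)
    - (deg g v == d)%:R * y v.
  have -> : next_class_sum d g' - class_sum d =
      \sum_v a v * q v + (m + g' ord_max ord_max == d)%N%:R * z g'.
    rewrite /next_class_sum addrAC -sumrB; congr (_ + _); apply: eq_bigr => v _.
    rewrite /a /q; have [e|_] := posnP (links g' v); last by rewrite mul1r.
    by rewrite e addn0 (t_zero e) addr0 subrr mul0r.
  have q_le v : `|q v| <= (deg g v <= d)%N%:R * (y v + m%:R).
    have /andP[t0 tm] := t_bound v gg'; rewrite /q.
    have yv := y_ge0 v; have m0 : 0 <= m%:R :> R := ler0n _ _.
    have [hd|hd] := ltnP d (deg g v).
      rewrite !gtn_eqF ?(leq_trans hd) ?leq_addr//= !mul0r subrr normr0.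
      exact: lexx.
    rewrite mul1r ler_norml; apply/andP.
    by case: (_ == d); case: (_ == d); rewrite ?mul1r ?mul0r; split; lra.
  have s1 : (\sum_v a v * q v) ^+ 2 <= m%:R * (\sum_v (deg g v <= d)%N%:R *
      ((y v + m%:R) ^+ 2 * a v)).
    apply: le_trans (sqr_wsum_le _ _) _ => [v|]; first exact: ler0n.
    apply: ler_pM.
    - by apply: sumr_ge0 => v _; exact: ler0n.
    - by apply: sumr_ge0 => v _; rewrite mulr_ge0 ?sqr_ge0// ler0n.
    - by rewrite -natr_sum ler_nat; exact: linked_sum gg'.
    apply: ler_sum => v _; rewrite mulrA [leRHS]mulrC ler_wpM2l ?ler0n//.
    rewrite -[q v ^+ 2]ger0_norm ?sqr_ge0// normrX.
    apply: (@le_trans _ _ (((deg g v <= d)%N%:R * (y v + m%:R)) ^+ 2)).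
      by rewrite lerXn2r ?nnegrE ?mulr_ge0 ?addr_ge0.
    by rewrite exprMn; case: (deg g v <= d)%N; rewrite ?expr1n ?mul1r// expr0n/= !mul0r.
  have /andP[z0 zm] := z_bound gg'.
  have s2 : ((m + g' ord_max ord_max == d)%N%:R * z g') ^+ 2 <= m%:R ^+ 4.
    rewrite (_ : m%:R ^+ 4 = (m%:R ^+ 2) ^+ 2); last by rewrite -exprM.
    rewrite lerXn2r ?nnegrE ?mulr_ge0 ?sqr_ge0//.
    by case: (_ == d); rewrite ?mul1r// mul0r sqr_ge0.
  rewrite -/a; set S := \sum_v a v * q v in s1 *; set Z := _ * z g' in s2 *.
  have := sqr_ge0 (S - Z); rewrite sqrrB sqrrD -mulr_natl => h.
  move: s1 s2; rewrite /a; lra.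
rewrite cmeanD (CE_cst (2 * m%:R ^+ 4)) lerD2r cmeanZ -[leRHS]mulrA.
rewrite ler_wpM2l ?mulr_ge0// cmean_sum mulr_sumr; apply: ler_sum => v _.
rewrite cmeanZ cmeanZ [leRHS]mulrCA ler_wpM2l ?ler0n//.
have := linked_prob v; have := sqr_ge0 (y v + m%:R) => h1 h2.
by rewrite mulrA [leRHS]mulrC ler_wpM2l.
Qed.

End Weights.

(** * Pairs of links that close triangles *)

Definition deg_sq : R := \sum_v x v ^+ 2.

(** Loops enter the triangle drift because the multiplicities from [v] to other vertices add up to
    [deg g v - 2 * g v v], not to the degree. *)
Definition nb_loops : R := (\sum_v g v v)%:R.

Local Notation adjacent := Defs.adjacent.

Let adj_sym v w : adjacent g v w = adjacent g w v.
Proof.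
rewrite /adjacent eq_sym; congr (_ && (0 < _)%N).
by have /matrixP/(_ w v) := law_sym law hn hg; rewrite mxE.
Qed.

Let adj_sum v : \sum_w (adjacent g v w)%:R <= x v.
Proof.
rewrite -natr_sum ler_nat; apply: leq_trans (adjacent_sum g v).
exact: leq_addr.
Qed.

Let adj_mult_sum v :
  \sum_w (adjacent g v w)%:R * (g v w)%:R = x v - 2 * (g v v)%:R.
Proof.
apply/eqP; rewrite eq_sym subr_eq; apply/eqP.
rewrite /deg (bigD1 v)//= [in RHS](bigD1 v)//= /adjacent eqxx/= mul0r add0r.
rewrite (_ : \sum_(w < n | w != v) _ * _ = \sum_(w < n | w != v) (g v w)%:R).
  by rewrite !natrD natr_sum; ring.
apply: eq_bigr => w wv; rewrite eq_sym wv/=.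
by case: (g v w) => [|k]; rewrite ?mulr0// mul1r.
Qed.

Let deg_sq_ge0 : 0 <= deg_sq.
Proof. by apply: sumr_ge0 => v _; exact: sqr_ge0. Qed.

Let many_links_sum :
  \sum_w CE (fun g' => (1 < links g' w)%N%:R) <= m%:R * C * (deg_sq / N ^+ 2).
Proof.
rewrite /deg_sq mulr_suml mulr_sumr; apply: ler_sum => w _.
exact: many_links_prob.
Qed.

Let many_pairs_sum :
  \sum_v \sum_w CE (fun g' => ((0 < links g' v)%N && (1 < links g' w)%N)%:R) <=
  m%:R ^+ 2 * C * (deg_sq / N ^+ 2).
Proof.
rewrite exchange_big/= (_ : m%:R ^+ 2 * C * _ = m%:R * (m%:R * C * (deg_sq / N ^+ 2))); last by ring.
apply: le_trans (ler_wpM2l (ler0n R m) many_links_sum); rewrite mulr_sumr.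
apply: ler_sum => w _; rewrite -cmean_sum -cmeanZ; apply: CE_le => g' gg'.
case: (1 < links g' w)%N; last first.
  by rewrite mulr0 big1// => v _; rewrite andbF.
rewrite mulr1 -natr_sum ler_nat; apply: leq_trans (linked_sum gg').
by apply: leq_sum => v _; rewrite andbT.
Qed.

Let nb_vertices_deg_sum d :
  (nb_vertices_deg g d)%:R = \sum_v (deg g v == d)%:R :> R.
Proof.
rewrite /nb_vertices_deg -sum1_card big_mkcond natr_sum; apply: eq_bigr => v _.
by rewrite inE; case: (_ == _).
Qed.

(** A crude bound by a constant: at most [m] vertices gain at most [m] triangles each, and [d] times
    the number of vertices of degree [d] is at most the total degree. Multiplied by the finer bound
    [old_triangles_drift], it controls the square of the error by first moments only. *)
Lemma old_triangles_bound (d : nat) :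
  `|\sum_v (deg g v == d)%:R *
      CE (fun g' => (links g' v == 1)%:R * (new_triangles g g' v)%:R)
    - D / (m%:R * N) * (d%:R * (nb_vertices_deg g d)%:R)| <=
  m%:R ^+ 2 + 2 * D.
Proof.
have m0 : 0 < m%:R :> R by rewrite ltr0n.
apply: le_trans (ler_normB _ _) _; apply: lerD.
  rewrite ger0_norm; last first.
    apply: sumr_ge0 => v _; rewrite mulr_ge0 ?ler0n//; apply: CE_ge0 => g' _.
    by rewrite mulr_ge0 ?ler0n.
  under eq_bigr do rewrite -cmeanZ.
  rewrite -cmean_sum -[leRHS]CE_cst; apply: CE_le => g' gg'.
  apply: (@le_trans _ _ (\sum_v (0 < links g' v)%N%:R * m%:R)).
    apply: ler_sum => v _; have := new_triangles_le gg' v; rewrite -(ler_nat R) => h.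
    case: (_ == d); rewrite ?mul0r ?mulr_ge0 ?ler0n// mul1r.
    by case: (links g' v) => [|[|k]]; rewrite ?mul0r ?mul1r// ?mulr_ge0 ?ler0n.
  rewrite -mulr_suml expr2 ler_wpM2r ?ler0n// -natr_sum ler_nat.
  exact: linked_sum gg'.
have e : d%:R * (nb_vertices_deg g d)%:R <= 2 * m%:R * N.
  rewrite -deg_total nb_vertices_deg_sum mulr_sumr; apply: ler_sum => v _.
  by have [->|_] := eqVneq (deg g v) d; rewrite ?mulr1// mulr0 ler0n.
rewrite ger0_norm ?mulr_ge0 ?divr_ge0 ?mulr_ge0 ?(ltW D_gt0)//.
rewrite mulrAC ler_pdivrMr ?mulr_gt0// -mulrA.
by rewrite [leRHS](_ : _ = D * (2 * m%:R * N)) ?ler_pM2l//; ring.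
Qed.

(** A vertex [v] gains a triangle for each neighbour [w] linked in the same step. The pair errors
    [d x_w / N^2] add up to [d * deg_sq / N^2], as [w] has at most [x_w] neighbours; pairs in which
    [w] receives several links contribute [deg_sq / N^2]; the loops correct the sum of the main
    terms. *)
Lemma old_triangles_drift (d : nat) :
  `|\sum_v (deg g v == d)%:R *
      CE (fun g' => (links g' v == 1)%:R * (new_triangles g g' v)%:R)
    - D / (m%:R * N) * (d%:R * (nb_vertices_deg g d)%:R)| <=
  (C * (1 + m%:R ^+ 2) + 2 * D) * (d.+1%:R * (deg_sq / N ^+ 2) + nb_loops / N).
Proof.
have m0 : 0 < m%:R :> R by rewrite ltr0n.
pose err v w := CE (fun g' => ((links g' v == 1) && (0 < links g' w)%N)%:R)
  - (g v w)%:R * (D / (m%:R * N)).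
have -> : \sum_v (deg g v == d)%:R *
      CE (fun g' => (links g' v == 1)%:R * (new_triangles g g' v)%:R)
    - D / (m%:R * N) * (d%:R * (nb_vertices_deg g d)%:R) =
    \sum_v \sum_w (deg g v == d)%:R * (adjacent g v w)%:R * err v w
    - \sum_v (deg g v == d)%:R * (2 * D / (m%:R * N) * (g v v)%:R).
  rewrite nb_vertices_deg_sum [d%:R * _]mulr_sumr [D / _ * _]mulr_sumr -!sumrB; apply: eq_bigr => v _.
  have -> : CE (fun g' => (links g' v == 1)%:R * (new_triangles g g' v)%:R) =
      \sum_w (adjacent g v w)%:R *
        CE (fun g' => ((links g' v == 1) && (0 < links g' w)%N)%:R).
    under eq_bigr do rewrite -cmeanZ.
    rewrite -cmean_sum; apply: eq_cmean => g'; rewrite /new_triangles.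
    have [e|_] := eqVneq (links g' v) 1%N; last first.
      by rewrite mul0r big1// => w _; rewrite mulr0.
    rewrite e mul1r natr_sum; apply: eq_bigr => w _.
    by rewrite -natrM mulnb.
  have [e|_] := eqVneq (deg g v) d; last first.
    by rewrite !mul0r !mulr0 big1 ?subr0// => w _; rewrite !mul0r.
  rewrite !mul1r mulr1 /err.
  under [in RHS]eq_bigr do rewrite mul1r mulrBr.
  rewrite sumrB (_ : \sum_w _ * (_ * (D / _)) = (d%:R - 2 * (g v v)%:R) * (D / (m%:R * N))).
    by field; rewrite !gt_eqF.
  by rewrite -e -adj_mult_sum mulr_suml; apply: eq_bigr => w _; rewrite mulrA.

apply: le_trans (ler_normB _ _) _.
pose Q := deg_sq / N ^+ 2; have Q0 : 0 <= Q by rewrite divr_ge0// sqr_ge0.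
have L0 : 0 <= nb_loops / N by rewrite divr_ge0.
have part1 : `|\sum_v \sum_w (deg g v == d)%:R * (adjacent g v w)%:R * err v w| <=
    C * d%:R * Q + m%:R ^+ 2 * C * Q.
  apply: (@le_trans _ _ (\sum_v \sum_w (C * d%:R / N ^+ 2 * ((adjacent g w v)%:R * x w)
      + CE (fun g' => ((0 < links g' v)%N && (1 < links g' w)%N)%:R)))).
    apply: le_trans (ler_norm_sum _ _ _) _; apply: ler_sum => v _.
    apply: le_trans (ler_norm_sum _ _ _) _; apply: ler_sum => w _.
    have c0 : 0 <= CE (fun g' => ((0 < links g' v)%N && (1 < links g' w)%N)%:R).
      by apply: CE_ge0 => g' _; exact: ler0n.
    have r0 : 0 <= C * d%:R / N ^+ 2 * ((adjacent g w v)%:R * x w).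
      by rewrite mulr_ge0 ?mulr_ge0 ?divr_ge0 ?mulr_ge0 ?sqr_ge0.
    rewrite [adjacent g w v]adj_sym in r0 *.
    have [e|_] := eqVneq (deg g v) d; last by rewrite !mul0r normr0 addr_ge0.
    have [vw|_] := boolP (adjacent g v w); last by rewrite mulr0 mul0r normr0 addr_ge0 ?mulr0 ?mul0r ?mulr0.
    rewrite !mul1r; have vNw : v != w by case/andP: vw.
    rewrite /err (_ : CE _ = CE (fun g' => ((links g' v == 1) && (links g' w == 1))%:R)
      + CE (fun g' => ((links g' v == 1) && (1 < links g' w)%N)%:R)); last first.
      rewrite -cmeanD; apply: eq_cmean => g'; case: (links g' v == 1)%N => /=; last by rewrite addr0.
      by case: (links g' w) => [|[|k]]; rewrite ?addr0 ?add0r.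
    rewrite addrAC; apply: le_trans (ler_normD _ _) _; apply: lerD.
      apply: le_trans (law_pair law hn hg vNw) _; rewrite e.
      by rewrite le_eqVlt; apply/orP; left; apply/eqP; ring.
    rewrite ger0_norm; last by apply: CE_ge0 => g' _; exact: ler0n.
    apply: CE_le => g' _; rewrite ler_nat.
    by case: (links g' v) => [|[|k]].
  under eq_bigr do rewrite big_split/=.
  rewrite big_split/=; apply: lerD; last exact: many_pairs_sum.
  under eq_bigr do rewrite -mulr_sumr.
  rewrite -mulr_sumr exchange_big/= [leRHS](_ : _ = C * d%:R / N ^+ 2 * deg_sq); last first.
    by rewrite /Q; ring.
  rewrite ler_wpM2l ?divr_ge0 ?mulr_ge0 ?sqr_ge0//; apply: ler_sum => w _.
  by rewrite -mulr_suml expr2 ler_wpM2r ?ler0n.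
have part2 : `|\sum_v (deg g v == d)%:R * (2 * D / (m%:R * N) * (g v v)%:R)| <=
    2 * D * (nb_loops / N).
  rewrite ger0_norm; last first.
    by apply: sumr_ge0 => v _; rewrite !mulr_ge0 ?invr_ge0 ?mulr_ge0 ?(ltW D_gt0).
  rewrite /nb_loops natr_sum mulr_suml mulr_sumr; apply: ler_sum => v _.
  apply: (@le_trans _ _ (2 * D / (m%:R * N) * (g v v)%:R)).
    by case: (_ == d); rewrite ?mul1r// mul0r !mulr_ge0 ?invr_ge0 ?mulr_ge0 ?(ltW D_gt0).
  rewrite -mulrA ler_pM2l ?mulr_gt0// mulrC ler_wpM2l ?ler0n//.
  by rewrite lef_pV2 ?posrE ?mulr_gt0// ler_peMl ?ler1n.
apply: le_trans (lerD part1 part2) _; rewrite -natr1 -/Q.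
set L := nb_loops / N in L0 *.
have d0 : 0 <= d%:R :> R := ler0n _ _.
have D0 := ltW D_gt0.
have h1 : 0 <= C * m%:R ^+ 2 * d%:R * Q by rewrite !mulr_ge0 ?sqr_ge0.
have h2 : 0 <= C * Q by rewrite mulr_ge0.
have h3 : 0 <= D * (d%:R + 1) * Q by rewrite !mulr_ge0 ?addr_ge0.
have h4 : 0 <= C * (1 + m%:R ^+ 2) * L by rewrite !mulr_ge0 ?addr_ge0 ?sqr_ge0.
lra.
Qed.

Let pair_error v w : R := `|CE (fun g' => ((links g' v == 1) && (links g' w == 1))%:R)
  - (g v w)%:R * (D / (m%:R * N))|.

Definition birth_const : R :=
  C + m%:R * (2 * (1 + m%:R + 2 * m%:R * C)) + D.

(* The left side is at most the minimum of [C (x v)^3 / N^2] and a multiple of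
   [x v / N]; the right side dominates their geometric mean. *)
Lemma pair_error_sum v :
  \sum_w ((adjacent g v w) && (deg g w <= deg g v)%N)%:R * pair_error v w <=
  birth_const * (x v ^+ 2 / (N * Num.sqrt N)).
Proof.
have m0 : 0 < m%:R :> R by rewrite ltr0n.
pose K := 1 + m%:R + 2 * m%:R * C; have K0 : 0 <= K.
  by rewrite !addr_ge0 ?mulr_ge0.
have [bc1 bc2] : C <= birth_const /\ m%:R * (2 * K) + D <= birth_const.
  have := ltW D_gt0; have : 0 <= m%:R * (2 * K) by rewrite !mulr_ge0.
  by rewrite /birth_const -/K; move: C_ge0; split; lra.
have bc0 : 0 <= birth_const := le_trans C_ge0 bc1.
have q0 : 0 < Num.sqrt N by rewrite sqrtr_gt0.
have qq : Num.sqrt N * Num.sqrt N = N by rewrite -expr2 sqr_sqrtr ?(ltW N_gt0).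
have x0 : 0 <= x v := ler0n _ _.
have bound1 : \sum_w ((adjacent g v w) && (deg g w <= deg g v)%N)%:R * pair_error v w
    <= C * (x v ^+ 3 / N ^+ 2).
  apply: (@le_trans _ _ (\sum_w (adjacent g v w)%:R * (C * (x v ^+ 2 / N ^+ 2)))).
    apply: ler_sum => w _; have [vw|] := boolP (adjacent g v w); last by rewrite !mul0r.
    have vNw : v != w by case/andP: vw.
    rewrite mul1r; have [wv|_] := leqP (deg g w) (deg g v); last first.
      by rewrite mul0r mulr_ge0// divr_ge0// sqr_ge0.
    rewrite mul1r; apply: le_trans (law_pair law hn hg vNw) _.
    rewrite ler_wpM2l// ler_wpM2r ?invr_ge0 ?sqr_ge0// expr2 ler_wpM2l//.
    by rewrite ler_nat.
  rewrite -mulr_suml.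
  rewrite [leRHS](_ : _ = x v * (C * (x v ^+ 2 / N ^+ 2))); last by ring.
  by rewrite ler_wpM2r ?adj_sum// mulr_ge0// divr_ge0// sqr_ge0.
have bound2 : \sum_w ((adjacent g v w) && (deg g w <= deg g v)%N)%:R * pair_error v w
    <= (m%:R * (2 * K) + D) * (x v / N).
  have [v0|v_gt0] := posnP (deg g v).
    rewrite v0 mul0r mulr0 big1// => w _.
    have : ((adjacent g v w)%:R : R) <= 0.
      apply: le_trans (_ : \sum_w (adjacent g v w)%:R <= _).
        by rewrite (bigD1 w)//= lerDl sumr_ge0.
      by have := adj_sum v; rewrite v0.
    by case: (adjacent g v w); rewrite ?mul0r// lern0.
  have x1 : 1 <= x v by rewrite ler1n.
  apply: (@le_trans _ _ (\sum_w (CE (fun g' => ((0 < links g' v)%N && (0 < links g' w)%N)%:R)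
      + (adjacent g v w)%:R * (g v w)%:R * (D / (m%:R * N))))).
    apply: ler_sum => w _.
    have c0 : 0 <= CE (fun g' => ((0 < links g' v)%N && (0 < links g' w)%N)%:R).
      by apply: CE_ge0 => g' _; exact: ler0n.
    have d0 : 0 <= D / (m%:R * N) by rewrite divr_ge0 ?mulr_ge0 ?(ltW D_gt0).
    case: (adjacent g v w) => /=; last by rewrite !mul0r addr0.
    have r0 : 0 <= (g v w)%:R * (D / (m%:R * N)) by rewrite mulr_ge0.
    case: (_ <= _)%N; rewrite ?mul0r !mul1r; last exact: addr_ge0.
    apply: le_trans (ler_normB _ _) _; rewrite [X in _ + X]ger0_norm//.
    rewrite lerD2r ger0_norm; last by apply: CE_ge0 => g' _; exact: ler0n.
    apply: CE_le => g' _; rewrite ler_nat.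
    by case: (links g' v) => [|[|k]]//=; case: (links g' w) => [|[|l]].
  rewrite big_split/= -mulr_suml adj_mult_sum [leRHS]mulrDl; apply: lerD.
    apply: (@le_trans _ _ (m%:R * CE (fun g' => (0 < links g' v)%N%:R))).
      rewrite -cmean_sum -cmeanZ; apply: CE_le => g' gg'.
      case: (0 < links g' v)%N => /=; last by rewrite mulr0 big1.
      by rewrite mulr1 -natr_sum ler_nat; exact: linked_sum gg'.
    rewrite -mulrA ler_pM2l//; apply: le_trans (linked_prob v) _; rewrite -/K.
    rewrite (_ : 2 * K * _ = K * ((2 * x v) / N)); last by ring.
    rewrite ler_wpM2l// ler_pM2r ?invr_gt0//; lra.
  rewrite [leLHS](_ : _ = D * ((x v - 2 * (g v v)%:R) / m%:R / N)); last first.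
    by field; rewrite !gt_eqF.
  rewrite ler_pM2l// ler_pM2r ?invr_gt0// ler_pdivrMr//.
  have : x v <= x v * m%:R by rewrite ler_peMr ?ler1n.
  by have : 0 <= (g v v)%:R :> R := ler0n _ _; lra.
have [h|h] := leP (x v) (Num.sqrt N).
  apply: le_trans bound1 _; apply: ler_pM => //.
  rewrite ler_pdivlMr ?mulr_gt0// mulrAC ler_pdivrMr ?exprn_gt0//.
  rewrite (_ : x v ^+ 3 * _ = (x v ^+ 2 * N) * (x v * Num.sqrt N)); last by ring.
  rewrite (_ : x v ^+ 2 * N ^+ 2 = (x v ^+ 2 * N) * (Num.sqrt N * Num.sqrt N)); last first.
    by rewrite qq; ring.
  by rewrite ler_wpM2l ?mulr_ge0 ?sqr_ge0// ler_pM2r.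
apply: le_trans bound2 _; apply: ler_pM => //.
  by rewrite addr_ge0 ?(ltW D_gt0)// !mulr_ge0.
rewrite ler_pdivlMr ?mulr_gt0// mulrA mulrVK ?unitfE ?gt_eqF// expr2.
by rewrite ler_wpM2l// ltW.
Qed.

Let sqrtN_le : Num.sqrt N <= N.
Proof.
have N1 : 1 <= N by rewrite ler1n (leq_trans n0_gt0).
have q0 : 0 <= Num.sqrt N := sqrtr_ge0 _.
rewrite -[leRHS]sqr_sqrtr ?(ltW N_gt0)// expr2 ler_peMr//.
by have := ler_wsqrtr N1; rewrite sqrtr1.
Qed.

Let pair_error_sym v w : pair_error v w = pair_error w v.
Proof.
rewrite /pair_error; congr `|_ - _|.
  by apply: eq_cmean => g'; rewrite andbC.
have /matrixP/(_ w v) := law_sym law hn hg.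
by rewrite mxE => ->.
Qed.

Let birth_trianglesE g' :
  2 * (birth_triangles g g')%:R = \sum_v \sum_w
    (adjacent g v w)%:R * ((0 < links g' v)%N && (0 < links g' w)%N)%:R :> R.
Proof.
have e : (birth_triangles g g')%:R = \sum_(v < n) \sum_(w < n) [&& (v < w)%N,
    adjacent g v w, (0 < links g' v)%N & (0 < links g' w)%N]%:R :> R.
  by rewrite natr_sum; apply: eq_bigr => v _; rewrite natr_sum.
have e' := e; rewrite exchange_big/= in e'.
rewrite mulr_natl mulr2n {1}e e' -big_split/=; apply: eq_bigr => v _.
rewrite -big_split/=; apply: eq_bigr => w _.
rewrite [adjacent g w v]adj_sym.
have [vw|wv|/val_inj ->] := ltngtP v w; rewrite /= ?addr0 ?add0r -?natrM ?mulnb//.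
  by rewrite [X in _ && X]andbC.
by rewrite /adjacent eqxx.
Qed.

(** No degree is fixed here, so the pair errors would naturally add up to cubes of degrees.
    [pair_error_sum] replaces the cubes over [N^2] by squares over [N^(3/2)], which is the origin of
    the exponent [3/2 + g]. The main terms give [D], since the multiplicities sum to [2 m N] up to
    loops. *)
Lemma birth_drift :
  `|CE (fun g' => (m + g' ord_max ord_max == m)%N%:R * (birth_triangles g g')%:R) - D| <=
  (birth_const + m%:R ^+ 2 * C + D) *
    (deg_sq / (N * Num.sqrt N) + nb_loops / N)
  + m%:R ^+ 2 * CE (fun g' => (0 < g' ord_max ord_max)%N%:R).
Proof.
have m0 : 0 < m%:R :> R by rewrite ltr0n.
have q0 : 0 < Num.sqrt N by rewrite sqrtr_gt0.
pose Q := deg_sq / (N * Num.sqrt N); pose L := nb_loops / N.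
have Q0 : 0 <= Q by rewrite divr_ge0// mulr_ge0// ltW.
have L0 : 0 <= L by rewrite divr_ge0.
have bc0 : 0 <= birth_const by rewrite !addr_ge0 ?(ltW D_gt0)// !mulr_ge0// !addr_ge0 ?mulr_ge0.
have QQ : deg_sq / N ^+ 2 <= Q.
  rewrite ler_wpM2l// lef_pV2 ?posrE ?exprn_gt0 ?mulr_gt0// expr2.
  by rewrite ler_pM2l// sqrtN_le.
(* A newborn vertex with a loop misses class [m]; its triangles, at most [m^2], are paid by the loop
   probability. *)
have -> : CE (fun g' => (m + g' ord_max ord_max == m)%N%:R * (birth_triangles g g')%:R) =
    CE (fun g' => (birth_triangles g g')%:R)
    - CE (fun g' => (0 < g' ord_max ord_max)%N%:R * (birth_triangles g g')%:R).
  rewrite -cmeanB; apply: eq_cmean => g'.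
  rewrite -[X in (_ == X)%N]addn0 eqn_add2l.
  by case: (g' ord_max ord_max) => [|k]; rewrite ?mul0r ?mul1r ?subr0 ?subrr.
rewrite addrAC; apply: le_trans (ler_normB _ _) _; apply: lerD; last first.
  rewrite ger0_norm; last by apply: CE_ge0 => g' _; rewrite mulr_ge0.
  rewrite -cmeanZ; apply: CE_le => g' gg'; rewrite mulrC ler_wpM2r ?ler0n//.
  by rewrite -natrX ler_nat -mulnn birth_triangles_le.
(* Doubling turns the unordered pairs of [birth_triangles] into ordered ones, to which the row sums
   of multiplicities apply. *)
rewrite -(ler_pM2l (ltr0n R 2)) -[X in X * `|_|]ger0_norm ?ler0n// -normrM mulrBr.
pose err v w := CE (fun g' => ((0 < links g' v)%N && (0 < links g' w)%N)%:R)
  - (g v w)%:R * (D / (m%:R * N)).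
have -> : 2 * CE (fun g' => (birth_triangles g g')%:R) - 2 * D =
    \sum_v \sum_w (adjacent g v w)%:R * err v w - 2 * D / m%:R * L.
  have -> : 2 * CE (fun g' => (birth_triangles g g')%:R) = \sum_v \sum_w
      (adjacent g v w)%:R * CE (fun g' => ((0 < links g' v)%N && (0 < links g' w)%N)%:R).
    rewrite -cmeanZ (_ : CE _ = CE (fun g' => \sum_v \sum_w (adjacent g v w)%:R *
      ((0 < links g' v)%N && (0 < links g' w)%N)%:R)); last first.
      by apply: eq_cmean => g'; exact: birth_trianglesE.
    rewrite cmean_sum.
    apply: eq_bigr => v _; rewrite cmean_sum; apply: eq_bigr => w _.
    by rewrite cmeanZ.
  rewrite [X in _ - X = _](_ : 2 * D = \sum_v \sum_w (adjacent g v w)%:R *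
      ((g v w)%:R * (D / (m%:R * N))) + 2 * D / m%:R * L); last first.
    under eq_bigr do under eq_bigr do rewrite mulrA.
    under eq_bigr do rewrite -mulr_suml adj_mult_sum.
    rewrite -mulr_suml sumrB deg_total -mulr_sumr -natr_sum -/nb_loops /L.
    by field; rewrite !gt_eqF.
  rewrite opprD addrA; congr (_ - _); rewrite -sumrB; apply: eq_bigr => v _.
  by rewrite -sumrB; apply: eq_bigr => w _; rewrite -mulrBr.
apply: le_trans (ler_normB _ _) _.
have part2 : `|2 * D / m%:R * L| <= 2 * D * L.
  rewrite ger0_norm; last by rewrite !mulr_ge0 ?invr_ge0 ?(ltW D_gt0).
  rewrite ler_wpM2r// ler_pdivrMr// ler_peMr ?ler1n//.
  by rewrite mulr_ge0 ?(ltW D_gt0).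
have part1 : `|\sum_v \sum_w (adjacent g v w)%:R * err v w| <=
    2 * (birth_const * Q) + 2 * (m%:R ^+ 2 * C * Q).
  (* Each adjacent pair is charged to its endpoint of larger degree (to both when the degrees
     agree), as [pair_error_sum] requires; [mo] collects the pairs with a multiple link. *)
  pose hi v w := ((adjacent g v w) && (deg g w <= deg g v)%N)%:R * pair_error v w.
  pose mo v w := CE (fun g' => ((0 < links g' v)%N && (1 < links g' w)%N)%:R).
  apply: (@le_trans _ _ (\sum_v \sum_w ((hi v w + hi w v) + (mo v w + mo w v)))).
    apply: le_trans (ler_norm_sum _ _ _) _; apply: ler_sum => v _.
    apply: le_trans (ler_norm_sum _ _ _) _; apply: ler_sum => w _.
    have mo0 v' w' : 0 <= mo v' w' by apply: CE_ge0 => g' _; exact: ler0n.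
    have hi0 v' w' : 0 <= hi v' w' by apply: mulr_ge0; [exact: ler0n|exact: normr_ge0].
    have [vw|_] := boolP (adjacent g v w); last first.
      by rewrite mul0r normr0 !addr_ge0.
    rewrite mul1r (_ : err v w = (CE (fun g' => ((links g' v == 1) && (links g' w == 1))%:R)
        - (g v w)%:R * (D / (m%:R * N))) + (CE (fun g' => ((0 < links g' v)%N && (0 < links g' w)%N)%:R)
        - CE (fun g' => ((links g' v == 1) && (links g' w == 1))%:R))); last by rewrite /err; ring.
    apply: le_trans (ler_normD _ _) _; apply: lerD.
      rewrite /hi [adjacent g w v]adj_sym [pair_error w v]pair_error_sym vw/= -mulrDl.
      rewrite -/(pair_error v w); apply: ler_peMl; first exact: normr_ge0.
      by rewrite -natrD ler1n; case: (leqP (deg g w) (deg g v)) => //= /ltnW ->.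
    rewrite -cmeanB ger0_norm; last first.
      apply: CE_ge0 => g' _; rewrite subr_ge0 ler_nat.
      by case: (links g' v) => [|[|k]]; case: (links g' w) => [|[|l]].
    rewrite -cmeanD; apply: CE_le => g' _; rewrite lerBlDr -!natrD ler_nat.
    by case: (links g' v) => [|[|k]]; case: (links g' w) => [|[|l]].
  have sw (F : 'I_n -> 'I_n -> R) :
      \sum_v \sum_w (F v w + F w v) = 2 * \sum_v \sum_w F v w.
    under eq_bigr do rewrite big_split/=.
    by rewrite big_split/= [X in _ + X]exchange_big/= mulr_natl mulr2n.
  under eq_bigr do rewrite big_split/=.
  rewrite big_split/= !sw; apply: lerD; rewrite ler_pM2l//; last first.
    apply: le_trans many_pairs_sum _.
    by rewrite ler_wpM2l ?mulr_ge0 ?sqr_ge0.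
  rewrite /Q /deg_sq mulr_suml mulr_sumr; apply: ler_sum => v _.
  exact: pair_error_sum.
apply: le_trans (lerD part1 part2) _; rewrite -/Q -/L.
have D0 := ltW D_gt0.
have h1 : 0 <= birth_const * L by rewrite mulr_ge0.
have h2 : 0 <= m%:R ^+ 2 * C * L by rewrite !mulr_ge0 ?sqr_ge0.
have h3 : 0 <= D * Q by rewrite mulr_ge0.
lra.
Qed.

End OneStep.

(** * Second moments of the vertex counts *)

Section SecondMoment.
Context {R : realType} {dT : measure_display} {T : measurableType dT}.
Variables (P : probability T R) (m n0 b : nat) (A B D C : R).
Variable G : forall n : nat, T -> 'M[nat]_n.
Hypothesis law : attachment_law P m n0 b A B D G C.

Let A_gt0 : 0 < A := law_A_gt0 law.
Let A_lt1 : A < 1 := law_A_lt1 law.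
Let D_gt0 : 0 < D := law_D_gt0 law.
Let AB : 2 * m%:R * A + B = m%:R := law_AB law.
Let m_gt0 : (0 < m)%N := law_m_gt0 law.
Let n0_gt0 : (0 < n0)%N := law_n0_gt0 law.
Let process : graph_process m n0 G := law_process law.
Let bounded : forall n w i j, (n0 <= n)%N -> (G n w i j <= b)%N := law_bounded law.
Let C_ge0 : 0 <= C := law_C_ge0 law.

Local Notation mean := (mean P b G).
Local Notation CE := (cmean P b G).
Local Notation rate := (rate A B).

Let N_gt0 n : (n0 <= n)%N -> 0 < n%:R :> R.
Proof. by move=> hn; rewrite ltr0n (leq_trans n0_gt0). Qed.

Let mean_step n f := @mean_step R dT T P m n0 b G process bounded n f.
Let mean_cst n c := @mean_cst R dT T P m n0 b G process bounded n c.
Let cmass_sum n g := @cmass_sum R dT T P m n0 b G process bounded n g.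

(** Cut off at [m]: class [m - 1] holds at most [n0] vertices, so what it sends to class [m] is
    counted as an error. *)
Definition inflow (d : nat) (f : nat -> R) : R :=
  if (m < d)%N then rate d.-1 * f d.-1 else 0.

(* The weights of [V n d] and [V n d.-1] are nonnegative only for [2 d <= n],
   hence the first hypothesis on the remaining range. *)
Lemma supersolution (V U src : nat -> nat -> R) :
  (forall n d, (n0 <= n)%N -> (m <= d)%N -> (n <= 2 * d)%N || (n == n0) ->
    V n d <= U n d) ->
  (forall n d, (n0 <= n)%N -> (m <= d)%N -> (2 * d <= n)%N ->
    V n.+1 d <= (1 - rate d / n%:R) * V n d + inflow d (V n) / n%:R + src n d) ->
  (forall n d, (n0 <= n)%N -> (m <= d)%N -> (2 * d <= n)%N ->
    (1 - rate d / n%:R) * U n d + inflow d (U n) / n%:R + src n d <= U n.+1 d) ->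
  forall n d, (n0 <= n)%N -> (m <= d)%N -> V n d <= U n d.
Proof.
move=> init stepV stepU; elim=> [|n IH] d hn md.
  by rewrite init// orbC; move: hn n0_gt0; case: n0.
have [e|ne] := eqVneq n.+1 n0; first by rewrite init// e eqxx orbT.
have hn' : (n0 <= n)%N by rewrite -ltnS ltn_neqAle eq_sym ne.
have [nd|nd] := leqP n.+1 (2 * d); first by rewrite init// nd.
apply: le_trans (stepV n d hn' md nd) _; apply: le_trans (stepU n d hn' md nd).
have n_gt0 := N_gt0 hn'.
have rd : rate d <= n%:R.
  apply: le_trans (rate_le A_gt0 A_lt1 m_gt0 AB md) _.
  by rewrite -natrM ler_nat.
rewrite lerD2r; apply: lerD.
  by rewrite ler_wpM2l ?IH// subr_ge0 ler_pdivrMr// mul1r.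
rewrite ler_pM2r ?invr_gt0// /inflow; case: ifP => // md1.
have md1' : (m <= d.-1)%N by rewrite -ltnS prednK// (leq_trans m_gt0).
by rewrite ler_wpM2l ?IH// ltW// (rate_gt0 A_gt0 A_lt1 m_gt0 AB).
Qed.

(** The second moment splits into the squared drift and a conditional variance, bounded by [s].
    Convexity gives [W^2 <= (a + c) (a X^2 + c Y^2)]; the room left by the damping pays for the
    drift error [r] at the price of the factor [1 + n / k]. Drift errors thus count as [n * r^2] per
    step. *)
Lemma moment_step n (X Y r : 'M[nat]_n -> R) (X' : 'M[nat]_n.+1 -> R) (a c k s : R) :
  (n0 <= n)%N -> 0 <= a -> 0 <= c -> 0 < k -> a + c <= 1 - k / n%:R ->
  (forall g, mass P G g != 0 -> `|CE g X' - (a * X g + c * Y g)| <= r g) ->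
  (forall g, mass P G g != 0 ->
    exists x0, CE g (fun g' => (X' g' - x0) ^+ 2) <= s) ->
  mean (fun g' => X' g' ^+ 2) <= a * mean (fun g => X g ^+ 2)
    + c * mean (fun g => Y g ^+ 2) + (1 + n%:R / k) * mean (fun g => r g ^+ 2) + s.
Proof.
move=> hn a0 c0 k0 ac hr hs; rewrite (mean_step _ hn).
rewrite -!meanZ -(mean_cst s hn) -!meanD; apply: mean_le => g hg.
have [x0 hx0] := hs g hg.
pose q (h : 'M['I_b.+1]_n.+1) :=
  fine (P [set w | G n w = g /\ G n.+1 w = decode h]) / mass P G g.
have h : CE g (fun g' => X' g' ^+ 2) <=
    CE g X' ^+ 2 + CE g (fun g' => (X' g' - x0) ^+ 2).
  exact: (wmean_variance (cmass_sum hn hg) _ x0).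
apply: (le_trans h); apply: lerD => //.
have := hr g hg; set M := CE g X'; set W := a * X g + c * Y g => hM.
have n_gt0 := N_gt0 hn; have t0 : 0 < k / n%:R by rewrite divr_gt0.
have r0 : 0 <= r g by apply: le_trans hM; exact: normr_ge0.
have s0 : 0 <= a * X g ^+ 2 + c * Y g ^+ 2.
  by apply: addr_ge0; apply: mulr_ge0 => //; exact: sqr_ge0.
have W2 : (1 + k / n%:R) * W ^+ 2 <= a * X g ^+ 2 + c * Y g ^+ 2.
  have W2' : W ^+ 2 <= (a + c) * (a * X g ^+ 2 + c * Y g ^+ 2).
    have : 0 <= a * c * (X g - Y g) ^+ 2 by rewrite mulr_ge0 ?sqr_ge0// mulr_ge0.
    by rewrite /W; lra.
  apply: (@le_trans _ _ ((1 + k / n%:R) * ((1 - k / n%:R) * (a * X g ^+ 2 + c * Y g ^+ 2)))).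
    rewrite ler_pM2l ?addr_gt0//; apply: le_trans W2' _.
    by rewrite ler_wpM2r.
  rewrite mulrA ler_piMl//.
  have := sqr_ge0 (k / n%:R); lra.
(* Young's inequality; the damping [a + c <= 1 - k / n] absorbs the factor
   [1 + k / n]. *)
have M2 : M ^+ 2 <= (1 + k / n%:R) * W ^+ 2 + (1 + n%:R / k) * (r g) ^+ 2.
  have hM2 : (M - W) ^+ 2 <= r g ^+ 2.
    by rewrite -real_normK ?num_real// lerXn2r ?nnegrE.
  apply: (@le_trans _ _ ((1 + k / n%:R) * W ^+ 2 + (1 + n%:R / k) * (M - W) ^+ 2)).
    have : 0 <= (n%:R / k) * (k / n%:R * W - (M - W)) ^+ 2.
      by rewrite mulr_ge0 ?sqr_ge0// divr_ge0// ltW.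
    rewrite (_ : n%:R / k * _ = k / n%:R * W ^+ 2 - 2 * W * (M - W) + n%:R / k * (M - W) ^+ 2).
      by lra.
    by field; rewrite !gt_eqF.
  by rewrite lerD2l ler_wpM2l// addr_ge0// divr_ge0// ltW.
by apply: le_trans M2 _; rewrite lerD2r.
Qed.

Section Drift.
Variables (n : nat) (g : 'M[nat]_n).
Hypotheses (hn : (n0 <= n)%N) (hg : mass P G g != 0).
Variables (y : 'I_n -> R) (t : 'M[nat]_n.+1 -> 'I_n -> R) (z : 'M[nat]_n.+1 -> R).
Hypothesis y_ge0 : forall v, 0 <= y v.
Hypothesis t_bound : forall g' v, extends m g g' -> 0 <= t g' v <= m%:R.
Hypothesis t_zero : forall g' v, links g' v = 0%N -> t g' v = 0.
Hypothesis z_bound : forall g', extends m g g' -> 0 <= z g' <= m%:R ^+ 2.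
Variables (k phi : nat -> R) (beta : R).
Hypothesis k_min : k m * (1 + rate m) = beta.
Hypothesis kS : forall d, (m <= d)%N ->
  k d.+1 * (1 + rate d.+1) = rate d * k d + phi d.

Local Notation cs := (class_sum g y).

(** [k_min] and [kS] state that [k d * n] solves the first-order recurrence exactly, with source
    [phi] from links and [beta] from births. After centring only errors are left: the higher-order
    attachment terms, the two source errors, and the outflow of class [m - 1]. *)
Lemma centered_drift d : (m <= d)%N ->
  `|CE g (fun g' => next_class_sum m g y t z d g' - k d * n.+1%:R)
    - ((1 - rate d / n%:R) * (cs d - k d * n%:R)
       + inflow d (fun j => cs j - k j * n%:R) / n%:R)| <=
  C / n%:R ^+ 2 * \sum_v (deg g v <= d)%N%:R * ((deg g v)%:R ^+ 2 * (y v + m%:R))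
  + `|\sum_v (deg g v == d.-1)%:R * CE g (fun g' => (links g' v == 1)%:R * t g' v)
      - (if (m < d)%N then phi d.-1 else 0)|
  + `|CE g (fun g' => (m + g' ord_max ord_max == d)%N%:R * z g')
      - (if (m < d)%N then 0 else beta)|
  + (if (m < d)%N then 0 else `|rate d.-1| / n%:R * cs d.-1).
Proof.
move=> md; have d_gt0 : (0 < d)%N by rewrite (leq_trans m_gt0).
have n_gt0 := N_gt0 hn.
have := class_drift law hn hg z y_ge0 t_bound t_zero d.-1; rewrite prednK//.
set E1 := CE g _; set S0 := \sum_v _ * CE g _; set Z := CE g (fun g' => _ * z g').
set S2 := \sum_v _ => h.
have -> : CE g (fun g' => next_class_sum m g y t z d g' - k d * n.+1%:R) =
    E1 - k d * (n%:R + 1).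
  by rewrite cmeanB (cmean_cst process bounded _ hn hg) natr1.
rewrite /inflow; case: ifP => md1.
  have md' : (m <= d.-1)%N by rewrite -ltnS prednK.
  have := kS md'; rewrite prednK// => kd.
  rewrite addr0 subr0 [leRHS]addrAC.
  rewrite (_ : _ - _ = (E1 - ((1 - rate d / n%:R) * cs d + rate d.-1 / n%:R * cs d.-1
     + S0 + Z)) + (S0 - phi d.-1) + Z); last first.
    have -> : phi d.-1 = k d * (1 + rate d) - rate d.-1 * k d.-1 by rewrite kd; ring.
    by field; rewrite gt_eqF.
  rewrite [leRHS]addrAC; apply: le_trans (ler_normD _ _) _; apply: lerD => //.
  by apply: le_trans (ler_normD _ _) _; apply: lerD.
have dm : d = m by apply/eqP; rewrite eqn_leq md leqNgt md1.
rewrite mul0r addr0 subr0.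
rewrite (_ : _ - _ = (E1 - ((1 - rate d / n%:R) * cs d + rate d.-1 / n%:R * cs d.-1
   + S0 + Z)) + S0 + (Z - beta) + rate d.-1 / n%:R * cs d.-1); last first.
  by rewrite -k_min -dm; field; rewrite gt_eqF.
apply: le_trans (ler_normD _ _) _; apply: lerD; last first.
  rewrite normrM normf_div [`|n%:R|]ger0_norm//.
  by rewrite [`|cs _|]ger0_norm// sumr_ge0// => v _; rewrite mulr_ge0.
apply: le_trans (ler_normD _ _) _; apply: lerD => //.
by apply: le_trans (ler_normD _ _) _; apply: lerD.
Qed.

End Drift.

(** The weights add up to [1 - A / n] above class [m], and to [1 - rate m / n] in class [m], which
    has no inflow. *)
Definition damping : R := Num.min A (rate m).

Lemma damping_gt0 : 0 < damping.
Proof. by rewrite lt_min A_gt0 (rate_gt0 A_gt0 A_lt1 m_gt0 AB). Qed.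

Let rate_le_n n d : (m <= d)%N -> (2 * d <= n)%N -> rate d <= n%:R.
Proof.
move=> md nd; apply: le_trans (rate_le A_gt0 A_lt1 m_gt0 AB md) _.
by rewrite -natrM ler_nat.
Qed.

Lemma centered_step n d (X : forall n, nat -> 'M[nat]_n -> R) (r : 'M[nat]_n -> R) s :
  (n0 <= n)%N -> (m <= d)%N -> (2 * d <= n)%N ->
  (forall g, mass P G g != 0 ->
    `|CE g (X n.+1 d) - ((1 - rate d / n%:R) * X n d g
       + inflow d (fun j => X n j g) / n%:R)| <= r g) ->
  (forall g, mass P G g != 0 ->
    exists x0, CE g (fun g' => (X n.+1 d g' - x0) ^+ 2) <= s) ->
  mean (fun g => X n.+1 d g ^+ 2) <= (1 - rate d / n%:R) * mean (fun g => X n d g ^+ 2)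
    + inflow d (fun j => mean (fun g => X n j g ^+ 2)) / n%:R
    + ((1 + n%:R / damping) * mean (fun g => r g ^+ 2) + s).
Proof.
move=> hn md nd hr hs; have n_gt0 := N_gt0 hn.
have a0 : 0 <= 1 - rate d / n%:R.
  by rewrite subr_ge0 ler_pdivrMr// mul1r rate_le_n.
pose c := if (m < d)%N then rate d.-1 / n%:R else 0.
have inflowE f : inflow d f / n%:R = c * f d.-1.
  by rewrite /inflow /c; case: ifP; rewrite ?mul0r// mulrAC.
have c0 : 0 <= c.
  rewrite /c; case: ifP => // md1; rewrite divr_ge0// ltW//.
  by apply: (rate_gt0 A_gt0 A_lt1 m_gt0 AB); rewrite -ltnS prednK// (leq_trans m_gt0).
rewrite inflowE addrA; apply: moment_step => //.
- exact: damping_gt0.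
- rewrite /c /damping; case: ifP => md1.
    rewrite -addrA lerD2l -mulNr -mulrDl -[leRHS]mulNr ler_pM2r ?invr_gt0//.
    have := rateS A B d.-1; rewrite prednK ?(leq_trans m_gt0)// => ->.
    have : Num.min A (rate m) <= A by rewrite ge_min lexx.
    lra.
  have dm : d = m by apply/eqP; rewrite eqn_leq md leqNgt md1.
  rewrite addr0 dm lerD2l lerN2 ler_pM2r ?invr_gt0//.
  by rewrite ge_min lexx orbT.
- by move=> g hg; have := hr g hg; rewrite inflowE.
Qed.

Let nb_vertices_class n (g : 'M[nat]_n) d :
  (nb_vertices_deg g d)%:R = class_sum g (fun=> 1) d :> R.
Proof.
rewrite /nb_vertices_deg -sum1_card big_mkcond natr_sum; apply: eq_bigr => v _.
by rewrite inE mulr1; case: (_ == _).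
Qed.

Let nb_vertices_next n (g : 'M[nat]_n) g' d : extends m g g' ->
  (nb_vertices_deg g' d)%:R =
  next_class_sum m g (fun=> 1) (fun _ _ => 0) (fun=> 1) d g' :> R.
Proof.
move=> gg'; rewrite (nb_vertices_degE gg') natrD natr_sum /next_class_sum mulr1.
by congr (_ + _); apply: eq_bigr => v _; rewrite addr0 mulr1.
Qed.

Lemma nb_vertices_deg_low n (g : 'M[nat]_n) d : (n0 <= n)%N -> mass P G g != 0 ->
  (d < m)%N -> (nb_vertices_deg g d <= n0)%N.
Proof.
move=> hn hg dm; apply: leq_trans (law_low law hn hg).
rewrite /nb_vertices_deg -sum1_card big_mkcond/=; apply: leq_sum => v _.
by rewrite inE; case: eqP => // ->; rewrite dm.
Qed.

Lemma nb_vertices_deg_le n (g : 'M[nat]_n) d : (nb_vertices_deg g d <= n)%N.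
Proof. by rewrite /nb_vertices_deg (leq_trans (max_card _))// card_ord. Qed.

Lemma rate_pred_le : `|rate m.-1| <= 2 * m%:R.
Proof.
have m0 : 1 <= m%:R :> R by rewrite ler1n.
have e : m.-1%:R = m%:R - 1 :> R by rewrite -{2}(prednK m_gt0) -natr1 addrK.
have h1 : 0 <= A * m%:R := mulr_ge0 (ltW A_gt0) (ler0n _ _).
have h2 : A * m%:R <= m%:R by rewrite ler_piMl ?ler0n// (ltW A_lt1).
have h3 : A * (m%:R - 1) = A * m%:R - A by ring.
rewrite ler_norml /rate e h3; move: (A_gt0) (A_lt1) (AB) => ? ? ?.
by apply/andP; split; lra.
Qed.

(** Loop probabilities are bounded only on average over [g]; since they are at most [1], their
    squares have no larger mean. *)
Lemma loop_prob_sqr n : (n0 <= n)%N ->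
  mean (fun g : 'M[nat]_n => CE g (fun g' : 'M[nat]_n.+1 => (0 < g' ord_max ord_max)%N%:R) ^+ 2) <= C / n%:R.
Proof.
move=> hn; apply: le_trans (law_loop law hn); rewrite (mean_step _ hn).
apply: mean_le => g hg; rewrite expr2.
apply: ler_piMl.
  by apply: (cmean_ge0 P b process hn) => g' _; exact: ler0n.
rewrite -[leRHS](cmean_cst process bounded 1 hn hg).
by apply: (cmean_le P b process hn) => g' _; rewrite lern1 leq_b1.
Qed.

Lemma class_deg_sq n (g : 'M[nat]_n) d : (n0 <= n)%N -> mass P G g != 0 ->
  \sum_v (deg g v <= d)%N%:R * (deg g v)%:R ^+ 2 <= d%:R * (2 * m%:R * n%:R) :> R.
Proof.
move=> hn hg; rewrite -(deg_total law hn hg) mulr_sumr; apply: ler_sum => v _.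
have [vd|_] := leqP (deg g v) d; last by rewrite mul0r mulr_ge0.
by rewrite mul1r expr2 ler_wpM2r// ler_nat.
Qed.

(** The noise per step is [O(d)]. The drift error is [O(d / n)] plus the loop probability, and [n]
    times its mean square is again [O(d)] for [2 d <= n]. Then [M d n] is a supersolution because
    [rate d * d] increases with [d]: each class loses at least what it receives, and the source
    [M d] is the growth of [M d n] in one step. *)
Theorem degree_variance : exists2 M : R, 0 <= M & forall n d, (n0 <= n)%N -> (m <= d)%N ->
  mean (fun g : 'M[nat]_n => ((nb_vertices_deg g d)%:R - deg_density A B m d * n%:R) ^+ 2)
  <= M * d%:R * n%:R.
Proof.
set k := deg_density A B m; have k0 := damping_gt0.
pose K1 := C * (1 + m%:R) * (2 * m%:R) + 2 * m%:R * n0%:R.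
pose K2 := 2 * m%:R * (1 + m%:R + 2 * m%:R * C) * (2 * (1 + m%:R) ^+ 2) + 2 * m%:R ^+ 4.
have K10 : 0 <= K1 by rewrite !(addr_ge0, mulr_ge0).
have K20 : 0 <= K2 by rewrite !(addr_ge0, mulr_ge0, exprn_ge0).
(* The first summand pays for the drift error, [K2] for the noise, and [n0 + 2] for the initial
   range, where [n <= 2 d] or [n = n0] gives [n^2 <= (n0 + 2) d n]. *)
pose M := (1 + damping^-1) * (K1 ^+ 2 + 2 * C) + K2 + (n0 + 2)%:R.
have id0 : 0 <= damping^-1 by rewrite invr_ge0 ltW.
have M1 : 0 <= (1 + damping^-1) * (K1 ^+ 2 + 2 * C).
  by rewrite mulr_ge0 ?addr_ge0 ?sqr_ge0// mulr_ge0.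
have M0 : 0 <= M by apply: addr_ge0; [exact: addr_ge0|exact: ler0n].
exists M => //.
pose X n d (g : 'M[nat]_n) : R := (nb_vertices_deg g d)%:R - k d * n%:R.
apply: (@supersolution (fun n d => mean (fun g : 'M[nat]_n => X n d g ^+ 2))
  (fun n d => M * d%:R * n%:R) (fun n d => M * d%:R)) => n d hn md.
- move=> nd; have d1 : 1 <= d%:R :> R by rewrite ler1n (leq_trans m_gt0).
  have n_gt0 := N_gt0 hn.
  apply: (@le_trans _ _ (n%:R * n%:R)).
    rewrite -[leRHS](mean_cst _ hn); apply: mean_le => g hg.
    rewrite -expr2 -real_normK ?num_real// lerXn2r ?nnegrE// /X ler_norml.
    have h1 : (nb_vertices_deg g d)%:R <= n%:R :> R by rewrite ler_nat nb_vertices_deg_le.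
    have h2 : 0 <= (nb_vertices_deg g d)%:R :> R := ler0n _ _.
    have h3 : k d * n%:R <= n%:R.
      by rewrite ler_piMl ?(deg_density_le1 A_gt0 A_lt1 m_gt0 AB)// ltW.
    have h4 : 0 <= k d * n%:R.
      by rewrite mulr_ge0 ?(deg_density_ge0 A_gt0 A_lt1 m_gt0 AB)// ltW.
    by apply/andP; split; lra.
  rewrite ler_pM2r//; apply: (@le_trans _ _ ((n0 + 2)%:R * d%:R)).
    rewrite -natrM ler_nat; case/orP: nd => [nd|/eqP ->].
      by rewrite (leq_trans nd)// leq_mul2r leq_addl orbT.
    by rewrite (leq_trans (leq_addr 2 n0))// leq_pmulr// (leq_trans m_gt0).
  by rewrite ler_wpM2r// /M lerDr addr_ge0.
- move=> nd; have n_gt0 := N_gt0 hn.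
  have d1 : 1 <= d%:R :> R by rewrite ler1n (leq_trans m_gt0).
  have d0 : 0 <= d%:R :> R := ler0n _ _.
  pose l (g : 'M[nat]_n) := CE g (fun g' => (0 < g' ord_max ord_max)%N%:R).
  pose r g := K1 * (d%:R / n%:R) + l g.
  apply: le_trans (@centered_step n d X r (K2 * d%:R) hn md nd _ _) _.
  + move=> g hg.
    have l_ge : 0 <= l g by apply: (cmean_ge0 P b process hn) => g' _; exact: ler0n.
    have eX j : X n j g = class_sum g (fun=> 1) j - k j * n%:R.
      by rewrite /X nb_vertices_class.
    have -> : CE g (X n.+1 d) = CE g (fun g' =>
        next_class_sum m g (fun=> 1) (fun _ _ => 0) (fun=> 1) d g' - k d * n.+1%:R).
      by apply: (cmean_ext P b process hn) => g' gg'; rewrite /X (nb_vertices_next _ gg').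
    rewrite /inflow !eX -/(inflow d (fun j => class_sum g (fun=> 1) j - k j * n%:R)).
    (* The only source of vertices is one birth per step in class [m]: [phi = 0] and [beta = 1]. *)
    apply: le_trans (centered_drift hn hg (fun=> 1) _ _ _ (phi := fun=> 0) (beta := 1) _ _ md) _.
    * by move=> v; exact: ler01.
    * by move=> g' v _; rewrite lexx/=.
    * by [].
    * exact: deg_density_min.
    * by move=> j mj; rewrite addr0 deg_densityS.
    rewrite [X in _ + X + _ + _ <= _](_ : _ = 0); last first.
      rewrite if_same subr0 big1 ?normr0// => v _.
      rewrite (_ : CE g _ = 0) ?mulr0// -[RHS](cmean_cst process bounded 0 hn hg).
      by apply: eq_cmean => g'; rewrite mulr0.
    rewrite addr0 addrAC /r /K1 mulrDl; apply: lerD; first apply: lerD.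
    * rewrite (_ : \sum_v _ = (1 + m%:R) * \sum_v (deg g v <= d)%N%:R * (deg g v)%:R ^+ 2).
        apply: (@le_trans _ _ (C / n%:R ^+ 2 * ((1 + m%:R) * (d%:R * (2 * m%:R * n%:R))))).
          rewrite ler_wpM2l ?divr_ge0 ?sqr_ge0// ler_wpM2l ?addr_ge0//.
          exact: class_deg_sq.
        by rewrite le_eqVlt; apply/orP; left; apply/eqP; field; rewrite gt_eqF.
      by rewrite mulr_sumr; apply: eq_bigr => v _; ring.
    * case: ifP => md1; first by rewrite mulr_ge0 ?divr_ge0// !mulr_ge0.
      rewrite -nb_vertices_class; have dm : d = m by apply/eqP; rewrite eqn_leq md leqNgt md1.
      apply: (@le_trans _ _ (2 * m%:R / n%:R * n0%:R)).
        apply: ler_pM => //.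
          by rewrite dm ler_pM2r ?invr_gt0// rate_pred_le.
        by rewrite ler_nat nb_vertices_deg_low// dm ltn_predL.
      rewrite [leLHS](_ : _ = 2 * m%:R * n0%:R * (1 / n%:R)); last by ring.
      by rewrite ler_wpM2l ?mulr_ge0// ler_pM2r ?invr_gt0.
    rewrite /l; case: ifP => md1.
      rewrite subr0 ger0_norm; last first.
        by apply: (cmean_ge0 P b process hn) => g' _; rewrite mulr1.
      apply: (cmean_le P b process hn) => g' _; rewrite mulr1 ler_nat.
      by case: (g' ord_max ord_max) => [|j]; rewrite ?addn0 ?(ltn_eqF md1)// leq_b1.
    have dm : d = m by apply/eqP; rewrite eqn_leq md leqNgt md1.
    rewrite -[X in _ - X](cmean_cst process bounded 1 hn hg) -cmeanB.
    apply: le_trans (ler_norm_wmean _ _) _; first exact: cmass_ge0.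
    rewrite -/(CE g _); apply: (cmean_le P b process hn) => g' _.
    rewrite dm mulr1 -[X in (_ == X)%N]addn0 eqn_add2l.
    by case: (g' ord_max ord_max) => [|j]; rewrite ?subrr ?normr0// sub0r normrN normr1.
  (* With this centre the deviation becomes the increment of the uncentred count, to which
     [class_noise] applies. *)
  + move=> g hg; exists (X n d g - k d).
    rewrite (_ : CE g _ = CE g (fun g' => (next_class_sum m g (fun=> 1) (fun _ _ => 0)
      (fun=> 1) d g' - class_sum g (fun=> 1) d) ^+ 2)); last first.
      apply: (cmean_ext P b process hn) => g' gg'.
      by rewrite /X (nb_vertices_next _ gg') nb_vertices_class -natr1; congr (_ ^+ 2); ring.
    apply: le_trans (class_noise law hn hg _ _ _ _ d) _ => //.
    * by move=> g' v _; rewrite lexx/=.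
    * by move=> g' _; rewrite ler01 -natrX ler1n expn_gt0 m_gt0.
    rewrite /K2 [leRHS]mulrDl; apply: lerD; last by rewrite ler_peMr ?mulr_ge0 ?exprn_ge0.
    rewrite -[leRHS]mulrA ler_wpM2l//; first by rewrite !(addr_ge0, mulr_ge0).
    apply: (@le_trans _ _ (\sum_(v < n) (d%:R + 1) / n%:R * (1 + m%:R) ^+ 2)).
      apply: ler_sum => v _; have [vd|_] := leqP (deg g v) d.
        by rewrite mul1r ler_wpM2r ?sqr_ge0// ler_pM2r ?invr_gt0// lerD2r ler_nat.
      by rewrite mul0r mulr_ge0 ?sqr_ge0// divr_ge0 ?addr_ge0.
    rewrite sumr_const card_ord -mulr_natr.
    rewrite [leLHS](_ : _ = (d%:R + 1) * (1 + m%:R) ^+ 2); last by field; rewrite gt_eqF.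
    rewrite [leRHS](_ : _ = (2 * d%:R) * (1 + m%:R) ^+ 2); last by ring.
    by rewrite ler_wpM2r ?sqr_ge0//; lra.
  rewrite lerD2l.
  have hr : mean (fun g => r g ^+ 2) <= 2 * (K1 * (d%:R / n%:R)) ^+ 2 + 2 * (C / n%:R).
    apply: le_trans (lerD (lexx _) (ler_wpM2l (ler0n R 2) (loop_prob_sqr hn))).
    rewrite -meanZ -[X in _ <= X + _](mean_cst _ hn) -meanD; apply: mean_le => g hg.
    rewrite -/(l g) /r; have := sqr_ge0 (K1 * (d%:R / n%:R) - l g).
    by lra.
  have n1 : 1 <= n%:R :> R by rewrite ler1n -(ltr0n R).
  have dn : 2 * d%:R <= n%:R :> R by rewrite -natrM ler_nat.
  have t1 : (1 + n%:R / damping) * mean (fun g => r g ^+ 2) <=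
      (1 + damping^-1) * n%:R * (2 * (K1 * (d%:R / n%:R)) ^+ 2 + 2 * (C / n%:R)).
    apply: ler_pM => //.
    - by apply: addr_ge0 => //; apply: mulr_ge0.
    - by apply: mean_ge0 => g _; exact: sqr_ge0.
    - by rewrite mulrDl mul1r [_^-1 * _]mulrC lerD2r.
  have t2 : (1 + damping^-1) * n%:R * (2 * (K1 * (d%:R / n%:R)) ^+ 2 + 2 * (C / n%:R)) <=
      (1 + damping^-1) * (K1 ^+ 2 + 2 * C) * d%:R.
    rewrite -!mulrA ler_wpM2l ?addr_ge0//.
    rewrite (_ : _ * (_ + _) = K1 ^+ 2 * (2 * d%:R * d%:R / n%:R) + 2 * C); last first.
      by field; rewrite gt_eqF.
    rewrite [leRHS]mulrDl; apply: lerD; last by rewrite ler_peMr// mulr_ge0.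
    by rewrite ler_wpM2l ?sqr_ge0// ler_pdivrMr// [leRHS]mulrC ler_wpM2r.
  have t3 : 0 <= (n0 + 2)%:R * d%:R :> R by rewrite mulr_ge0.
  by rewrite /M; move: t1 t2 t3; lra.
- move=> nd; have n_gt0 := N_gt0 hn.
  have d0 : 0 <= d%:R :> R := ler0n _ _.
  have lam := rate_gt0 A_gt0 A_lt1 m_gt0 AB md.
  rewrite (_ : inflow d _ / n%:R = inflow d (fun j => M * j%:R)); last first.
    by rewrite /inflow; case: ifP; rewrite ?mul0r// => _; field; rewrite gt_eqF.
  rewrite -natr1 [leRHS]mulrDr mulr1 lerD2r.
  rewrite (_ : (1 - rate d / n%:R) * _ = M * d%:R * n%:R - rate d * (M * d%:R)); last first.
    by field; rewrite gt_eqF.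
  rewrite -addrA gerDl addrC subr_le0 /inflow; case: ifP => md1; last first.
    by rewrite !mulr_ge0// ltW.
  apply: ler_pM => //.
  - apply/ltW/(rate_gt0 A_gt0 A_lt1 m_gt0 AB).
    by rewrite -ltnS prednK// (leq_trans m_gt0).
  - by rewrite mulr_ge0.
  - by have := rateS A B d.-1; rewrite prednK ?(leq_trans m_gt0)// => ->; rewrite lerDr ltW.
  - by rewrite ler_wpM2l// ler_nat leq_pred.
Qed.

End SecondMoment.

(** * Squared degrees and loops *)

Lemma powR_succ_ge (R : realType) (n : nat) (p : R) : (0 < n)%N -> 1 <= p ->
  n%:R `^ p + p * n%:R `^ (p - 1) <= n.+1%:R `^ p.
Proof.
move=> n_gt0 p1; have n0 : 0 < n%:R :> R by rewrite ltr0n.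
have x0 : 0 < 1 + n%:R^-1 :> R by rewrite addr_gt0 ?invr_gt0.
have -> : n.+1%:R = n%:R * (1 + n%:R^-1) :> R.
  by rewrite -natr1; field; rewrite gt_eqF.
rewrite (powRM _ (ltW n0) (ltW x0)).
apply: le_trans (ler_wpM2l (powR_ge0 _ _) (powR_bernoulli p1 x0)).
rewrite mulrDr mulr1 lerD2l powRB ?(gt_eqF n0) ?implybT// powRr1 ?(ltW n0)//.
by rewrite le_eqVlt; apply/orP; left; apply/eqP; field; rewrite gt_eqF.
Qed.

(** Exponents below [1] are allowed here: [1 + 1/n >= expR (1/(n + 1))] takes the place of
    Bernoulli's inequality, the factor [n^s >= 1] is dropped from the increment, and
    [n + 1 <= 2 n]. *)
Lemma powR_succ_diff (R : realType) (n : nat) (s : R) : (0 < n)%N -> 0 <= s ->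
  n%:R `^ s + s / (2 * n%:R) <= n.+1%:R `^ s.
Proof.
move=> n_gt0 s0; have n0 : 0 < n%:R :> R by rewrite ltr0n.
have n1 : 1 <= n%:R :> R by rewrite ler1n.
have N0 : 0 < n.+1%:R :> R by [].
have x0 : 0 < 1 + n%:R^-1 :> R by rewrite addr_gt0 ?invr_gt0.
have e1 : expR (n.+1%:R^-1) <= 1 + n%:R^-1 :> R.
  rewrite -[leLHS]invrK -expRN -[leRHS]invrK lef_pV2 ?posrE ?expR_gt0 ?invr_gt0//.
  apply: le_trans (expR_ge1Dx _); rewrite le_eqVlt; apply/orP; left; apply/eqP.
  by rewrite -natr1; field; rewrite !gt_eqF ?addr_gt0.
have e2 : 1 + s / n.+1%:R <= (1 + n%:R^-1) `^ s.
  apply: (@le_trans _ _ (expR (n.+1%:R^-1) `^ s)).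
    by rewrite -expRM mulrC expR_ge1Dx.
  by apply: ge0_ler_powR; rewrite ?nnegrE ?expR_ge0 ?(ltW x0).
have -> : n.+1%:R `^ s = n%:R `^ s * (1 + n%:R^-1) `^ s :> R.
  rewrite -powRM ?(ltW n0) ?(ltW x0)//; congr (_ `^ _).
  by rewrite -natr1; field; rewrite gt_eqF.
have w1 : 1 <= n%:R `^ s :> R by rewrite -[leLHS](powRr0 n%:R) ler_powR.
apply: le_trans (ler_wpM2l (powR_ge0 _ _) e2).
rewrite mulrDr mulr1 lerD2l.
apply: (@le_trans _ _ (1 * (s / n.+1%:R))).
  rewrite mul1r ler_wpM2l// lef_pV2 ?posrE ?mulr_gt0//.
  by rewrite -natr1; lra.
by rewrite ler_wpM2r ?divr_ge0.
Qed.

Section Moments.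
Context {R : realType} {dT : measure_display} {T : measurableType dT}.
Variables (P : probability T R) (m n0 b : nat) (A B D C : R).
Variable G : forall n : nat, T -> 'M[nat]_n.
Hypothesis law : attachment_law P m n0 b A B D G C.

Let A_gt0 : 0 < A := law_A_gt0 law.
Let A_lt1 : A < 1 := law_A_lt1 law.
Let D_gt0 : 0 < D := law_D_gt0 law.
Let AB : 2 * m%:R * A + B = m%:R := law_AB law.
Let m_gt0 : (0 < m)%N := law_m_gt0 law.
Let n0_gt0 : (0 < n0)%N := law_n0_gt0 law.
Let process : graph_process m n0 G := law_process law.
Let bounded : forall n w i j, (n0 <= n)%N -> (G n w i j <= b)%N := law_bounded law.
Let C_ge0 : 0 <= C := law_C_ge0 law.

Local Notation mean := (mean P b G).
Local Notation CE := (cmean P b G).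
Local Notation rate := (rate A B).

Let N_gt0 n : (n0 <= n)%N -> 0 < n%:R :> R.
Proof. by move=> hn; rewrite ltr0n (leq_trans n0_gt0). Qed.

Let mean_step n f := @mean_step R dT T P m n0 b G process bounded n f.
Let mean_cst n c := @mean_cst R dT T P m n0 b G process bounded n c.

Definition hub (eta : R) n (g : 'M[nat]_n) : bool :=
  [exists v, eta * n%:R <= (deg g v)%:R].

(* All but [eta / 2] of the mass [2 m] of [k |-> k * deg_density k] sits below
   some [L], so that a vertex of degree [eta n] forces the number of vertices of
   some degree below [L] to deviate linearly in [n]. *)
Lemma hub_prob (eta : R) : 0 < eta -> exists2 K : R, 0 <= K &
  forall n, (n0 <= n)%N -> mean (fun g : 'M[nat]_n => (hub eta g)%:R) <= K / n%:R.
Proof.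
move=> eta0; have [M M0 hM] := degree_variance law.
have eta2 : 0 < eta / 2 by rewrite divr_gt0.
have [L hL] := deg_density_tail A_gt0 A_lt1 m_gt0 AB eta2.
set c := deg_density A B m in hM hL.
pose X n k (g : 'M[nat]_n) : R := (nb_vertices_deg g k)%:R - c k * n%:R.
pose S : R := \sum_(k < L) k%:R.
pose K1 : R := S * \sum_(k < L) k%:R * (M * k%:R + n0%:R ^+ 2).
have S0 : 0 <= S by apply: sumr_ge0.
have K10 : 0 <= K1.
  by rewrite mulr_ge0// sumr_ge0// => k _; rewrite mulr_ge0// addr_ge0 ?sqr_ge0// mulr_ge0.
exists (4 * K1 / eta ^+ 2 + L%:R / eta) => [|n hn].
  by apply: addr_ge0; apply: divr_ge0; rewrite ?sqr_ge0 ?ler0n ?(ltW eta0)// mulr_ge0.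
have n_gt0 := N_gt0 hn.
(* While [eta * n <= L], the bound [L / (eta * n)] is at least [1]. Beyond that, a hub lies outside
   the classes below [L]. *)
have [nL|nL] := leP (eta * n%:R) L%:R.
  apply: (@le_trans _ _ 1).
    by rewrite -[leRHS](mean_cst 1 hn); apply: mean_le => g _; rewrite lern1 leq_b1.
  rewrite ler_pdivlMr// mul1r -lerBlDl.
  apply: (@le_trans _ _ n%:R); last by rewrite ler_pdivlMr// mulrC.
  by rewrite gerBl; apply: divr_ge0; [exact: mulr_ge0|exact: sqr_ge0].
pose Y n (g : 'M[nat]_n) : R := \sum_(k < L) k%:R * X n k g.
have hub_le (g : 'M[nat]_n) : mass P G g != 0 ->
    (hub eta g)%:R <= 4 / (eta * n%:R) ^+ 2 * Y n g ^+ 2.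
  move=> hg; have [/existsP[v hv]|_] := boolP (hub eta g); last first.
    by rewrite mulr_ge0 ?sqr_ge0// divr_ge0 ?sqr_ge0.
  have Lv : (L <= deg g v)%N by rewrite -(ler_nat R) (le_trans (ltW nL)).
  have : \sum_(k < L) k%:R * (nb_vertices_deg g k)%:R + (deg g v)%:R <= 2 * m%:R * n%:R :> R.
    rewrite -(deg_total law hn hg) [X in _ <= X](bigD1 v)//= [leLHS]addrC lerD2l.
    rewrite -natr_sum; under eq_bigr do rewrite -natrM.
    rewrite -natr_sum ler_nat.
    apply: (@leq_trans (\sum_(w | w != v) \sum_(k < L) (deg g w == k) * k)%N).
      rewrite exchange_big/=; apply: leq_sum => k _; rewrite -big_distrl/= mulnC leq_mul2r.
      rewrite /nb_vertices_deg -sum1_card big_mkcond/= (bigD1 v)//= inE.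
      have -> : (deg g v == k) = false by rewrite gtn_eqF// (leq_trans (ltn_ord k)).
      rewrite add0n.
      by apply/orP; right; apply: leq_sum => w _; rewrite inE; case: (_ == _).
    apply: leq_sum => w _; have [wL|wL] := ltnP (deg g w) L.
      rewrite (bigD1 (Ordinal wL))//= eqxx mul1n big1 ?addn0// => k kw.
      by rewrite [deg g w == k]eq_sym -[deg g w]/(val (Ordinal wL)) (inj_eq val_inj) (negbTE kw).
    rewrite big1// => k _; rewrite gtn_eqF// (leq_trans (ltn_ord k))//.
  have YE : Y n g = \sum_(k < L) k%:R * (nb_vertices_deg g k)%:R
      - n%:R * \sum_(k < L) k%:R * c k.
    by rewrite mulr_sumr -sumrB; apply: eq_bigr => k _; rewrite /X; ring.
  have cn : n%:R * (2 * m%:R - eta / 2) <= n%:R * \sum_(k < L) k%:R * c k.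
    by rewrite ler_pM2l.
  (* The classes below [L] miss the degree of the hub, at least [eta * n], while their limits miss
     at most [eta * n / 2] of the total [2 m n]. *)
  move=> h; have Y1 : eta * n%:R / 2 <= - Y n g by rewrite YE; lra.
  have e0 : 0 < eta * n%:R by rewrite mulr_gt0.
  rewrite mulrAC ler_pdivlMr ?exprn_gt0// mul1r -sqrrN.
  have : (eta * n%:R / 2) ^+ 2 <= (- Y n g) ^+ 2.
    by rewrite lerXn2r ?nnegrE ?(le_trans _ Y1)// divr_ge0// ltW.
  by rewrite expr_div_n; lra.
have X_le k : mean (fun g : 'M[nat]_n => X n k g ^+ 2) <= (M * k%:R + n0%:R ^+ 2) * n%:R.
  have [km|mk] := ltnP k m; last first.
    apply: le_trans (hM _ _ hn mk) _.
    by rewrite ler_pM2r// lerDl sqr_ge0.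
  rewrite -[leRHS](mean_cst _ hn); apply: mean_le => g hg.
  rewrite /X /c deg_density_lt// mul0r subr0.
  apply: (@le_trans _ _ (n0%:R ^+ 2)).
    by rewrite lerXn2r ?nnegrE// ler_nat (nb_vertices_deg_low law hn hg).
  rewrite mulrDl; apply: (@le_trans _ _ (n0%:R ^+ 2 * n%:R)).
    by rewrite ler_peMr ?sqr_ge0// ler1n -(ltr0n R).
  by rewrite lerDr !mulr_ge0// ltW.
apply: (@le_trans _ _ (mean (fun g => 4 / (eta * n%:R) ^+ 2 * Y n g ^+ 2))).
  exact: mean_le.
rewrite meanZ.
have Y_le : mean (fun g => Y n g ^+ 2) <= K1 * n%:R.
  apply: (@le_trans _ _ (mean (fun g => S * \sum_(k < L) k%:R * X n k g ^+ 2))).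
    by apply: mean_le => g _; apply: sqr_wsum_le.
  rewrite meanZ mean_sum /K1 -mulrA ler_wpM2l// mulr_suml; apply: ler_sum => k _.
  by rewrite meanZ -mulrA ler_wpM2l// X_le.
apply: (@le_trans _ _ (4 / (eta * n%:R) ^+ 2 * (K1 * n%:R))).
  by rewrite ler_wpM2l// divr_ge0// sqr_ge0.
rewrite [leLHS](_ : _ = 4 * K1 / eta ^+ 2 / n%:R); last by field; rewrite !gt_eqF.
by rewrite ler_pM2r ?invr_gt0// lerDl divr_ge0// ltW.
Qed.

Let deg_sq_le n (g : 'M[nat]_n) : (n0 <= n)%N -> mass P G g != 0 ->
  deg_sq g <= (2 * m%:R * n%:R) ^+ 2 :> R.
Proof.
move=> hn hg; rewrite expr2 -{1}(deg_total law hn hg) mulr_suml.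
apply: ler_sum => v _; rewrite expr2 ler_wpM2l// -mulrA -!natrM ler_nat.
exact: (deg_le_total law).
Qed.

Lemma link_mean n (g : 'M[nat]_n) v : (n0 <= n)%N -> mass P G g != 0 ->
  CE g (fun g' => (links g' v)%:R) <= rate (deg g v) / n%:R
    + C * (1 + m%:R ^+ 2) * ((deg g v)%:R ^+ 2 / n%:R ^+ 2).
Proof.
move=> hn hg; have := law_one_link law v hn hg; rewrite ler_norml => /andP[_ h1].
have h2 := many_links_prob law hn hg v.
apply: (@le_trans _ _ (CE g (fun g' => (links g' v == 1)%:R)
    + m%:R * CE g (fun g' => (1 < links g' v)%N%:R))).
  rewrite -cmeanZ -cmeanD; apply: (cmean_le P b process hn) => g' gg'.
  have := links_le gg' v; case: (links g' v) => [|[|k]] km /=.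
  - by rewrite mulr0 addr0.
  - by rewrite mulr0 addr0.
  - by rewrite mulr1 add0r ler_nat.
have h3 := ler_wpM2l (ler0n R m) h2.
rewrite (_ : C * (1 + _) * _ = C * ((deg g v)%:R ^+ 2 / n%:R ^+ 2)
  + m%:R * (m%:R * C * ((deg g v)%:R ^+ 2 / n%:R ^+ 2))); last by ring.
by rewrite addrA; apply: lerD => //; move: h1; lra.
Qed.

(** The expected number [rate (deg g v) / n] of links yields the growth [2 A / n]. Its quadratic
    error produces the sum of [deg^3 / n^2]: without a hub this is at most [eta / n] times [deg_sq],
    and with a hub the crude bound [8 m^3 n] is used. *)
Lemma deg_sq_step n (g : 'M[nat]_n) (eta : R) : (n0 <= n)%N -> mass P G g != 0 ->
  0 < eta ->
  CE g (@deg_sq R n.+1) <=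
    (1 + (2 * A + 2 * C * (1 + m%:R ^+ 2) * eta) / n%:R) * deg_sq g + 9 * m%:R ^+ 2
    + 16 * C * (1 + m%:R ^+ 2) * m%:R ^+ 3 * (n%:R * (hub eta g)%:R).
Proof.
move=> hn hg eta0; have n_gt0 := N_gt0 hn.
have m1 : 1 <= m%:R :> R by rewrite ler1n.
have step1 : CE g (@deg_sq R n.+1) <=
    deg_sq g + 2 * (\sum_v (deg g v)%:R * CE g (fun g' => (links g' v)%:R)) + 5 * m%:R ^+ 2.
  rewrite mulr_sumr; under [X in _ + X + _]eq_bigr do rewrite mulrA -cmeanZ.
  rewrite -cmean_sum -[X in _ <= X + _ + _](cmean_cst process bounded _ hn hg).
  rewrite -[X in _ <= _ + X](cmean_cst process bounded _ hn hg) -!cmeanD.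
  apply: (cmean_le P b process hn) => g' gg'.
  rewrite /deg_sq big_ord_recr/= (deg_new gg').
  have -> : 5 * m%:R ^+ 2 = m%:R ^+ 2 + (2 * m%:R) ^+ 2 :> R by ring.
  rewrite addrA; apply: lerD; last first.
    rewrite lerXn2r ?nnegrE// natrD.
    have : (g' ord_max ord_max)%:R <= m%:R :> R by rewrite ler_nat (loops_le gg').
    by lra.
  apply: (@le_trans _ _ (\sum_v (((deg g v)%:R ^+ 2 + 2 * (deg g v)%:R * (links g' v)%:R)
      + m%:R * (links g' v)%:R))).
    apply: ler_sum => v _; rewrite (deg_old gg') natrD sqrrD -[_ *+ 2]mulr_natl mulrA.
    by rewrite lerD2l expr2 ler_wpM2r// ler_nat (links_le gg').
  rewrite big_split/= big_split/= lerD2l -mulr_sumr expr2 ler_wpM2l//.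
  rewrite -natr_sum ler_nat; apply: leq_trans (leq_addr (g' ord_max ord_max) _) _.
  by rewrite (links_sum gg').
apply: le_trans step1 _.
set K := C * (1 + m%:R ^+ 2); have K0 : 0 <= K by rewrite mulr_ge0// addr_ge0 ?sqr_ge0.
have B_le : B <= m%:R.
  have : 0 <= A * m%:R by rewrite mulr_ge0// ltW.
  by move: (AB) => ?; lra.
have cube : \sum_v (deg g v)%:R ^+ 3 / n%:R ^+ 2 <=
    eta / n%:R * deg_sq g + 8 * m%:R ^+ 3 * (n%:R * (hub eta g)%:R).
  rewrite -mulr_suml.
  have [hb|/existsPn nohub] := boolP (hub eta g).
    apply: (@le_trans _ _ (8 * m%:R ^+ 3 * (n%:R * 1))); last first.
      rewrite lerDr mulr_ge0 ?divr_ge0 ?(ltW eta0) ?(ltW n_gt0)//.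
      by apply: sumr_ge0 => v _; exact: sqr_ge0.
    rewrite ler_pdivrMr ?exprn_gt0//.
    apply: (@le_trans _ _ (\sum_v (deg g v)%:R ^+ 2 * (2 * m%:R * n%:R))).
      apply: ler_sum => v _; rewrite exprSr ler_wpM2l ?sqr_ge0//.
      by rewrite -mulrA -!natrM ler_nat (deg_le_total law).
    rewrite -mulr_suml; apply: le_trans (ler_wpM2r _ (deg_sq_le hn hg)) _.
      by rewrite !mulr_ge0.
    by rewrite le_eqVlt; apply/orP; left; apply/eqP; ring.
  rewrite !mulr0 addr0 ler_pdivrMr ?exprn_gt0//.
  rewrite (_ : eta / n%:R * _ * _ = deg_sq g * (eta * n%:R)); last by field; rewrite gt_eqF.
  rewrite mulr_suml; apply: ler_sum => v _; rewrite exprSr ler_wpM2l ?sqr_ge0//.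
  by have := nohub v; rewrite -ltNge => /ltW.
have lin : \sum_v (deg g v)%:R * CE g (fun g' => (links g' v)%:R) <=
    A / n%:R * deg_sq g + 2 * m%:R ^+ 2 + K * \sum_v (deg g v)%:R ^+ 3 / n%:R ^+ 2.
  apply: (@le_trans _ _ (\sum_v (A / n%:R * (deg g v)%:R ^+ 2 + m%:R / n%:R * (deg g v)%:R
      + K * ((deg g v)%:R ^+ 3 / n%:R ^+ 2)))).
    apply: ler_sum => v _; apply: le_trans (ler_wpM2l (ler0n _ _) (link_mean v hn hg)) _.
    rewrite -/K mulrDr; apply: lerD; last first.
      by rewrite le_eqVlt; apply/orP; left; apply/eqP; ring.
    rewrite /rate.
    have : (deg g v)%:R / n%:R * B <= (deg g v)%:R / n%:R * m%:R.
      by rewrite ler_wpM2l// divr_ge0.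
    rewrite (_ : _ * ((A * _ + B) / _) = A / n%:R * (deg g v)%:R ^+ 2
      + (deg g v)%:R / n%:R * B); last by ring.
    by move=> h; rewrite lerD2l (le_trans h)// [leRHS]mulrAC [leLHS]mulrC mulrA.
  rewrite big_split/= big_split/= -!mulr_sumr (deg_total law hn hg) lerD2r lerD2l.
  by rewrite le_eqVlt; apply/orP; left; apply/eqP; field; rewrite gt_eqF.
have := ler_wpM2l K0 cube; move: lin.
rewrite (_ : (1 + _ / n%:R) * deg_sq g = deg_sq g + 2 * (A / n%:R * deg_sq g)
   + 2 * (K * (eta / n%:R * deg_sq g))); last by rewrite /K; ring.
rewrite (_ : 16 * C * (1 + m%:R ^+ 2) * m%:R ^+ 3 * (n%:R * (hub eta g)%:R) =
  2 * (K * (8 * m%:R ^+ 3 * (n%:R * (hub eta g)%:R)))); last by rewrite /K; ring.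
by rewrite mulrDr; lra.
Qed.

(** The factor [n] of the hub term meets a probability [O(1 / n)], so the mean obeys
    [u' <= (1 + be / n) u + K2] with [be + eps <= 1 + gam]. The slack [eps] absorbs the constant
    [K2] into the growth of [n^(1 + gam)]. *)
Theorem deg_sq_mean (gam : R) : 0 <= gam -> 2 * A < 1 + gam ->
  exists2 K : R, 0 <= K & forall n, (n0 <= n)%N ->
    mean (@deg_sq R n) <= K * n%:R `^ (1 + gam).
Proof.
move=> gam0 Agam; pose Q := C * (1 + m%:R ^+ 2).
have Q0 : 0 <= Q by rewrite mulr_ge0// addr_ge0 ?sqr_ge0.
pose eps := (1 + gam - 2 * A) / 2; have eps0 : 0 < eps by rewrite divr_gt0// subr_gt0.
have Q1 : 0 < 1 + 2 * Q by rewrite ltr_pwDl// mulr_ge0.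
(* Chosen so that the no-hub error [2 Q eta] uses at most half of [1 + gam - 2 A = 2 eps]. *)
pose eta := eps / (1 + 2 * Q); have eta0 : 0 < eta by rewrite divr_gt0.
have Qeta : 2 * Q * eta <= eps.
  rewrite /eta mulrA ler_pdivrMr// [leRHS]mulrC ler_wpM2r ?(ltW eps0)//; lra.
have [H H0 hH] := hub_prob eta0.
pose K2 := 9 * m%:R ^+ 2 + 16 * C * (1 + m%:R ^+ 2) * m%:R ^+ 3 * H.
have K20 : 0 <= K2 by rewrite !(addr_ge0, mulr_ge0, exprn_ge0).
pose K := (2 * m%:R * n0%:R) ^+ 2 + K2 / eps.
have Ke0 : 0 <= K2 / eps by apply: divr_ge0 => //; exact: ltW.
have K0 : 0 <= K by apply: addr_ge0 => //; exact: sqr_ge0.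
have pow1 n : (n0 <= n)%N -> 1 <= n%:R `^ gam :> R.
  move=> hn; rewrite -[leLHS](powRr0 n%:R) ler_powR// ler1n.
  exact: leq_trans n0_gt0 hn.
have powS n : (n0 <= n)%N -> n%:R `^ (1 + gam) = n%:R * n%:R `^ gam :> R.
  move=> hn; rewrite powRD ?(gt_eqF (N_gt0 hn)) ?implybT//.
  by rewrite (powRr1 (ltW (N_gt0 hn))).
exists K => //; elim=> [|n IH] hn.
  by move: hn n0_gt0; case: n0.
have [e|ne] := eqVneq n.+1 n0.
  have n1 : 1 <= n.+1%:R :> R by rewrite ler1n.
  apply: (@le_trans _ _ ((2 * m%:R * n0%:R) ^+ 2)).
    rewrite -[leRHS](mean_cst _ hn); apply: mean_le => g hg.
    have -> : n0%:R = n.+1%:R :> R by rewrite e.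
    exact: deg_sq_le.
  apply: (@le_trans _ _ K); first by rewrite /K lerDl.
  by rewrite ler_peMr// -[leLHS](powRr0 n.+1%:R) ler_powR// addr_ge0.
have hn' : (n0 <= n)%N by rewrite -ltnS ltn_neqAle eq_sym ne.
have n_gt0 := N_gt0 hn'.
pose be := 2 * A + 2 * C * (1 + m%:R ^+ 2) * eta.
have beE : be = 2 * A + 2 * Q * eta by rewrite /be /Q; ring.
have be_le : be + eps <= 1 + gam.
  rewrite beE.
  by have : 2 * eps = 1 + gam - 2 * A; [rewrite /eps; field|lra].
have be0 : 0 <= be.
  rewrite beE; apply: addr_ge0; apply: mulr_ge0 => //; [exact: ltW|exact: mulr_ge0|].
  exact: ltW.
apply: (@le_trans _ _ ((1 + be / n%:R) * mean (@deg_sq R n) + K2)).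
  rewrite (mean_step _ hn') /K2 addrA.
  apply: (@le_trans _ _ (mean (fun g => (1 + be / n%:R) * deg_sq g + 9 * m%:R ^+ 2
    + 16 * C * (1 + m%:R ^+ 2) * m%:R ^+ 3 * (n%:R * (hub eta g)%:R)))).
    by apply: mean_le => g hg; exact: deg_sq_step.
  rewrite !meanD !meanZ (mean_cst _ hn') lerD2l ler_wpM2l ?mulr_ge0 ?addr_ge0 ?sqr_ge0 ?exprn_ge0//.
  by rewrite mulrC -ler_pdivlMr// hH.
apply: (@le_trans _ _ ((1 + be / n%:R) * (K * n%:R `^ (1 + gam)) + K2)).
  by rewrite lerD2r ler_wpM2l ?IH// addr_ge0// divr_ge0// ltW.
have n1 : (0 < n)%N by rewrite -(ltr0n R).
have g1 : 1 <= 1 + gam by rewrite lerDl.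
apply: le_trans (ler_wpM2l K0 (powR_succ_ge n1 g1)).
have -> : 1 + gam - 1 = gam by ring.
rewrite mulrDl mul1r mulrDr -addrA lerD2l powS//.
rewrite (_ : be / n%:R * _ = be * (K * n%:R `^ gam)); last by field; rewrite gt_eqF.
have w1 := pow1 _ hn'; set w := n%:R `^ gam in w1 *.
apply: (@le_trans _ _ (be * (K * w) + eps * (K * w))).
  rewrite lerD2l -ler_pdivrMl// mulrC; apply: (@le_trans _ _ K).
    by rewrite /K lerDr sqr_ge0.
  by rewrite ler_peMr.
rewrite -mulrDl [leRHS]mulrCA; apply: ler_wpM2r => //.
by apply: mulr_ge0 => //; exact: le_trans ler01 w1.
Qed.

(** A step adds [O(1 / n)] loops in mean, hence [O(log n)] in all; [powR_succ_diff] replaces the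
    logarithm by an arbitrarily small power. *)
Theorem nb_loops_mean (gam : R) : 0 < gam ->
  exists2 K : R, 0 <= K & forall n, (n0 <= n)%N ->
    mean (@nb_loops R n) <= K * n%:R `^ gam.
Proof.
move=> gam0.
pose K : R := 2 * m%:R * n0%:R + 2 * (m%:R * C) / gam.
have K0 : 0 <= K by rewrite addr_ge0 ?divr_ge0 ?mulr_ge0// ?(ltW gam0)// mulr_ge0.
exists K => //; elim=> [|n IH] hn.
  by move: hn n0_gt0; case: n0.
have [e|ne] := eqVneq n.+1 n0.
  have n1 : 1 <= n.+1%:R :> R by rewrite ler1n.
  apply: (@le_trans _ _ (2 * m%:R * n0%:R)).
    rewrite -[leRHS](mean_cst _ hn); apply: mean_le => g hg.
    have -> : n0%:R = n.+1%:R :> R by rewrite e.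
    rewrite -(deg_total law hn hg) /nb_loops natr_sum; apply: ler_sum => v _.
    by rewrite ler_nat leq_addl.
  apply: (@le_trans _ _ K); first by rewrite /K lerDl divr_ge0 ?(ltW gam0)// !mulr_ge0.
  by rewrite ler_peMr// -[leLHS](powRr0 n.+1%:R) ler_powR// ltW.
have hn' : (n0 <= n)%N by rewrite -ltnS ltn_neqAle eq_sym ne.
have n_gt0 := N_gt0 hn'.
apply: (@le_trans _ _ (mean (@nb_loops R n) + m%:R * (C / n%:R))).
  apply: le_trans (lerD (lexx _) (ler_wpM2l (ler0n R m) (law_loop law hn'))).
  rewrite !(mean_step _ hn') -meanZ -meanD; apply: mean_le => g hg.
  rewrite -cmeanZ -[X in _ <= X + _](cmean_cst process bounded _ hn' hg) -cmeanD.
  apply: (cmean_le P b process hn') => g' gg'.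
  rewrite /nb_loops (loops_extends gg') natrD lerD2l.
  have := loops_le gg'; case: (g' ord_max ord_max) => [|k] hk; first by rewrite mulr0.
  by rewrite mulr1 ler_nat.
apply: le_trans (lerD (IH hn') (lexx _)) _.
have n1 : (0 < n)%N by rewrite -(ltr0n R).
apply: le_trans (ler_wpM2l K0 (powR_succ_diff n1 (ltW gam0))).
rewrite mulrDr lerD2l.
apply: (@le_trans _ _ (2 * (m%:R * C) / gam * (gam / (2 * n%:R)))).
  by rewrite le_eqVlt; apply/orP; left; apply/eqP; field; rewrite !gt_eqF.
rewrite ler_wpM2r ?divr_ge0 ?(ltW gam0) ?mulr_ge0//.
by rewrite /K lerDr !mulr_ge0.
Qed.

End Moments.

(** * Second moments of the triangle counts *)

Section Triangles.
Context {R : realType} {dT : measure_display} {T : measurableType dT}.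
Variables (P : probability T R) (m n0 b : nat) (A B D C : R).
Variable G : forall n : nat, T -> 'M[nat]_n.
Hypothesis law : attachment_law P m n0 b A B D G C.

Let A_gt0 : 0 < A := law_A_gt0 law.
Let A_lt1 : A < 1 := law_A_lt1 law.
Let D_gt0 : 0 < D := law_D_gt0 law.
Let AB : 2 * m%:R * A + B = m%:R := law_AB law.
Let m_gt0 : (0 < m)%N := law_m_gt0 law.
Let n0_gt0 : (0 < n0)%N := law_n0_gt0 law.
Let process : graph_process m n0 G := law_process law.
Let bounded : forall n w i j, (n0 <= n)%N -> (G n w i j <= b)%N := law_bounded law.
Let C_ge0 : 0 <= C := law_C_ge0 law.

Local Notation mean := (mean P b G).
Local Notation CE := (cmean P b G).
Local Notation rate := (rate A B).
Local Notation c := (deg_density A B m).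
Local Notation k := (tri_density A B D m).

Let N_gt0 n : (n0 <= n)%N -> 0 < n%:R :> R.
Proof. by move=> hn; rewrite ltr0n (leq_trans n0_gt0). Qed.

Let mean_step n f := @mean_step R dT T P m n0 b G process bounded n f.
Let mean_cst n c := @mean_cst R dT T P m n0 b G process bounded n c.

Let tri n (g : 'M[nat]_n) (v : 'I_n) : R := (triangles_at g v)%:R.
Let new_tri n (g : 'M[nat]_n) (g' : 'M[nat]_n.+1) v : R := (new_triangles g g' v)%:R.
Let birth n (g : 'M[nat]_n) (g' : 'M[nat]_n.+1) : R := (birth_triangles g g')%:R.

Let tri_ge0 n (g : 'M[nat]_n) v : 0 <= tri g v. Proof. exact: ler0n. Qed.

Let new_tri_bound n (g : 'M[nat]_n) g' v : extends m g g' ->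
  0 <= new_tri g g' v <= m%:R.
Proof. by move=> gg'; rewrite ler0n ler_nat (new_triangles_le gg'). Qed.

Let new_tri_zero n (g : 'M[nat]_n) g' v : links g' v = 0%N -> new_tri g g' v = 0.
Proof. by move=> e; rewrite /new_tri /new_triangles e. Qed.

Let birth_bound n (g : 'M[nat]_n) g' : extends m g g' -> 0 <= birth g g' <= m%:R ^+ 2.
Proof. by move=> gg'; rewrite ler0n -natrX ler_nat -mulnn (birth_triangles_le gg'). Qed.

Let nb_triangles_class n (g : 'M[nat]_n) d :
  (nb_triangles_deg g d)%:R = class_sum g (tri g) d.
Proof.
rewrite /nb_triangles_deg big_mkcond natr_sum; apply: eq_bigr => v _.
by case: (_ == _); rewrite ?mul1r// mul0r.
Qed.

Let nb_triangles_next n (g : 'M[nat]_n) g' d : extends m g g' ->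
  (nb_triangles_deg g' d)%:R = next_class_sum m g (tri g) (new_tri g) (birth g) d g'.
Proof.
move=> gg'; rewrite (nb_triangles_degE gg') natrD natr_sum natrM.
by congr (_ + _); apply: eq_bigr => v _; rewrite natrM natrD.
Qed.

Let triangles_sum n (g : 'M[nat]_n) : (n0 <= n)%N -> mass P G g != 0 ->
  \sum_v (tri g v + m%:R) <= (C + m%:R) * n%:R.
Proof.
move=> hn hg; rewrite big_split/= sumr_const card_ord -[m%:R *+ n]mulr_natr.
rewrite [leRHS]mulrDl lerD2r.
by rewrite -natr_sum (law_triangles law).
Qed.

Let triangles_at_deg n (g : 'M[nat]_n) v d : (deg g v <= d)%N ->
  tri g v <= d%:R ^+ 2.
Proof.
move=> vd; rewrite -natrX ler_nat; apply: leq_trans (triangles_at_le g v) _.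
by rewrite leq_exp2r.
Qed.

(** In [class_noise] the link probability is [O(d / n)], one factor [tri g v + m] is at most
    [2 d^2], and the other sums to [O(n)] because the total number of triangles is linear in [n]. *)
Lemma triangles_noise : exists2 K : R, 0 <= K & forall n d (g : 'M[nat]_n),
  (n0 <= n)%N -> (m <= d)%N -> mass P G g != 0 ->
  CE g (fun g' => (next_class_sum m g (tri g) (new_tri g) (birth g) d g'
    - class_sum g (tri g) d) ^+ 2) <= K * d%:R ^+ 3.
Proof.
pose K1 := 2 * m%:R * (1 + m%:R + 2 * m%:R * C).
have K10 : 0 <= K1 by rewrite !(addr_ge0, mulr_ge0).
exists (K1 * (4 * (C + m%:R)) + 2 * m%:R ^+ 4) => [|n d g hn md hg].
  apply: addr_ge0; last by rewrite mulr_ge0 ?exprn_ge0.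
  by apply: mulr_ge0 => //; rewrite mulr_ge0 ?addr_ge0.
have n_gt0 := N_gt0 hn.
have d1 : 1 <= d%:R :> R by rewrite ler1n (leq_trans m_gt0).
have md' : m%:R <= d%:R :> R by rewrite ler_nat.
apply: le_trans (class_noise law hn hg (tri_ge0 g) (@new_tri_bound n g)
  (@new_tri_zero n g) (@birth_bound n g) d) _.
rewrite [leRHS]mulrDl; apply: lerD; last by rewrite ler_peMr ?mulr_ge0 ?exprn_ge0// exprn_ege1.
rewrite -/K1 -[leRHS]mulrA ler_wpM2l//.
apply: (@le_trans _ _ (\sum_v (2 * d%:R) / n%:R * (2 * d%:R ^+ 2) * (tri g v + m%:R))).
  apply: ler_sum => v _; have [vd|_] := leqP (deg g v) d; last first.
    rewrite mul0r; apply: mulr_ge0; last exact: addr_ge0.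
    by rewrite !mulr_ge0 ?invr_ge0 ?exprn_ge0 ?(ltW n_gt0).
  have vd' : (deg g v)%:R <= d%:R :> R by rewrite ler_nat.
  rewrite mul1r -[leRHS]mulrA; apply: ler_pM.
  - by rewrite divr_ge0// addr_ge0.
  - exact: sqr_ge0.
  - by rewrite ler_pM2r ?invr_gt0//; lra.
  rewrite expr2 ler_wpM2r ?addr_ge0//.
  have := triangles_at_deg vd; have : d%:R <= d%:R ^+ 2 :> R by rewrite expr2 ler_peMr.
  by lra.
rewrite -mulr_sumr; apply: le_trans (ler_wpM2l _ (triangles_sum hn hg)) _.
  by rewrite !mulr_ge0 ?invr_ge0 ?exprn_ge0 ?(ltW n_gt0).
by rewrite le_eqVlt; apply/orP; left; apply/eqP; field; rewrite gt_eqF.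
Qed.

Definition link_error n d (g : 'M[nat]_n) : R :=
  `|\sum_v (deg g v == d)%:R * CE g (fun g' => (links g' v == 1)%:R * new_tri g g' v)
    - D / (m%:R * n%:R) * (d%:R * (nb_vertices_deg g d)%:R)|.

Definition birth_error n d (g : 'M[nat]_n) : R :=
  `|CE g (fun g' => (m + g' ord_max ord_max == d)%N%:R * birth g g')
    - (if (m < d)%N then 0 else D)|.

Lemma birth_error_le n d (g : 'M[nat]_n) : (n0 <= n)%N -> mass P G g != 0 ->
  birth_error d g <= m%:R ^+ 2 + D.
Proof.
move=> hn hg; apply: le_trans (ler_normB _ _) _; apply: lerD; last first.
  by case: ifP; rewrite ?normr0 ?(ltW D_gt0)// ger0_norm// ltW.
rewrite ger0_norm; last by apply: (cmean_ge0 P b process hn) => g' _; rewrite mulr_ge0.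
rewrite -[leRHS](cmean_cst process bounded _ hn hg).
apply: (cmean_le P b process hn) => g' gg'; have /andP[_ h] := birth_bound gg'.
by case: (_ == d); rewrite ?mul1r// mul0r exprn_ge0.
Qed.

(** The source of triangles in class [d] is proportional to the actual number of vertices of degree
    [d - 1]. Replacing this number by its limit costs its deviation, with weight at most [D d / n];
    [degree_variance] is what makes this term small. *)
Lemma triangles_drift : exists2 K : R, 0 <= K & forall n d (g : 'M[nat]_n),
  (n0 <= n)%N -> (m <= d)%N -> mass P G g != 0 ->
  `|CE g (fun g' => (nb_triangles_deg g' d)%:R - k d * n.+1%:R)
    - ((1 - rate d / n%:R) * ((nb_triangles_deg g d)%:R - k d * n%:R)
       + inflow m A B d (fun j => (nb_triangles_deg g j)%:R - k j * n%:R) / n%:R)| <=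
  K * (d%:R ^+ 2 / n%:R) + link_error d.-1 g
  + D * (d%:R / n%:R) * `|(nb_vertices_deg g d.-1)%:R - c d.-1 * n%:R|
  + birth_error d g.
Proof.
exists (C * (C + m%:R) + 2 * m%:R * (n0%:R * m%:R ^+ 2)) => [|n d g hn md hg].
  by rewrite addr_ge0 ?mulr_ge0 ?addr_ge0 ?exprn_ge0.
have n_gt0 := N_gt0 hn; have m0 : 0 < m%:R :> R by rewrite ltr0n.
have d1 : 1 <= d%:R :> R by rewrite ler1n (leq_trans m_gt0).
have -> : CE g (fun g' => (nb_triangles_deg g' d)%:R - k d * n.+1%:R) =
    CE g (fun g' => next_class_sum m g (tri g) (new_tri g) (birth g) d g'
      - k d * n.+1%:R).
  by apply: (cmean_ext P b process hn) => g' gg'; rewrite (nb_triangles_next _ gg').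
rewrite /inflow !nb_triangles_class.
rewrite -/(inflow m A B d (fun j => class_sum g (tri g) j - k j * n%:R)).
have hk : k m * (1 + rate m) = D := tri_density_min _ A_gt0 A_lt1 m_gt0 AB.
have hkS j : (m <= j)%N -> k j.+1 * (1 + rate j.+1) =
    rate j * k j + D / m%:R * (j%:R * c j).
  exact: tri_densityS.
apply: le_trans (centered_drift law hn hg (birth g) (tri_ge0 g) (@new_tri_bound n g)
  (@new_tri_zero n g) hk hkS md) _.
rewrite -/(birth_error d g) addrAC lerD2r.
rewrite -[leRHS]addrA [leLHS]addrAC [X in _ <= X + _]mulrDl; apply: lerD; last first.
  set S0 := \sum_v _; set Nd := (nb_vertices_deg g d.-1)%:R.
  (* At [d = m] the source vanishes of itself, as [deg_density] is [0] below [m]. *)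
  have e : (if (m < d)%N then D / m%:R * (d.-1%:R * c d.-1) else 0) =
      D / m%:R * (d.-1%:R * c d.-1).
    case: ifP => // md1; have dm : d = m by apply/eqP; rewrite eqn_leq md leqNgt md1.
    by rewrite dm deg_density_lt ?mulr0// ltn_predL.
  rewrite e (_ : S0 - _ = (S0 - D / (m%:R * n%:R) * (d.-1%:R * Nd))
     + D / (m%:R * n%:R) * d.-1%:R * (Nd - c d.-1 * n%:R)); last first.
    by field; rewrite !gt_eqF.
  apply: le_trans (ler_normD _ _) _; apply: lerD => //.
  rewrite normrM ler_wpM2r// ger0_norm; last first.
    by rewrite mulr_ge0 ?divr_ge0 ?mulr_ge0 ?(ltW D_gt0)// ltW.
  rewrite -!mulrA ler_pM2l// [leRHS]mulrC invfM -mulrA.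
  apply: (@le_trans _ _ (n%:R^-1 * d.-1%:R)).
    by rewrite ler_piMl ?mulr_ge0 ?invr_ge0 ?(ltW n_gt0)// invf_le1// ler1n.
  by rewrite ler_wpM2l ?invr_ge0 ?(ltW n_gt0)// ler_nat leq_pred.
apply: lerD.
  apply: (@le_trans _ _ (C / n%:R ^+ 2 * (d%:R ^+ 2 * ((C + m%:R) * n%:R)))).
    rewrite ler_wpM2l ?divr_ge0 ?sqr_ge0//.
    apply: le_trans (ler_wpM2l (sqr_ge0 _) (triangles_sum hn hg)).
    rewrite mulr_sumr; apply: ler_sum => v _.
    have [vd|_] := leqP (deg g v) d; last by rewrite mul0r mulr_ge0 ?sqr_ge0 ?addr_ge0.
    by rewrite mul1r ler_wpM2r ?addr_ge0// lerXn2r ?nnegrE// ler_nat.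
  by rewrite le_eqVlt; apply/orP; left; apply/eqP; field; rewrite gt_eqF.
case: ifP => md1; first by rewrite mulr_ge0 ?divr_ge0 ?mulr_ge0 ?sqr_ge0.
have dm : d = m by apply/eqP; rewrite eqn_leq md leqNgt md1.
apply: (@le_trans _ _ (2 * m%:R / n%:R * (n0%:R * m%:R ^+ 2))).
  apply: ler_pM => //.
  - by rewrite sumr_ge0// => v _; rewrite mulr_ge0.
  - by rewrite ler_pM2r ?invr_gt0// dm (rate_pred_le law).
  have m1m : (m.-1 < m)%N by rewrite ltn_predL.
  apply: (@le_trans _ _ (\sum_v (deg g v == d.-1)%:R * m%:R ^+ 2)).
    apply: ler_sum => v _; have [e|_] := eqVneq (deg g v) d.-1; last by rewrite !mul0r.
    by rewrite !mul1r triangles_at_deg// e dm leq_pred.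
  rewrite -mulr_suml ler_wpM2r ?sqr_ge0//.
  apply: le_trans (_ : (nb_vertices_deg g m.-1)%:R <= _); last first.
    by rewrite ler_nat (nb_vertices_deg_low law hn hg).
  rewrite -natr_sum ler_nat /nb_vertices_deg -sum1_card [leqRHS]big_mkcond/= dm.
  by apply: leq_sum => v _; rewrite inE; case: (_ == _).
rewrite (_ : 2 * m%:R / n%:R * _ = 2 * m%:R * (n0%:R * m%:R ^+ 2) * (1 / n%:R)); last by ring.
rewrite ler_wpM2l ?mulr_ge0 ?exprn_ge0// ler_pM2r ?invr_gt0//.
by rewrite exprn_ege1.
Qed.

(** The square is bounded by the product of the constant bound and the fine bound of the error, so
    no moments of [deg_sq] and [nb_loops] beyond the first are involved. *)
Lemma link_error_mean n d (gam Ks Kl : R) : (n0 <= n)%N -> (m <= d)%N ->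
  mean (@deg_sq R n) <= Ks * n%:R `^ (1 + gam) ->
  mean (@nb_loops R n) <= Kl * n%:R `^ gam ->
  n%:R * mean (fun g : 'M[nat]_n => link_error d.-1 g ^+ 2) <=
  (m%:R ^+ 2 + 2 * D) * (C * (1 + m%:R ^+ 2) + 2 * D) *
    (d%:R * (Ks * n%:R `^ gam) + Kl * n%:R `^ gam).
Proof.
move=> hn md hs hl; have n_gt0 := N_gt0 hn.
pose Q := C * (1 + m%:R ^+ 2) + 2 * D.
have Q0 : 0 <= Q by rewrite addr_ge0 ?mulr_ge0 ?addr_ge0 ?sqr_ge0 ?(ltW D_gt0).
have E0 : 0 <= m%:R ^+ 2 + 2 * D by rewrite addr_ge0 ?sqr_ge0 ?mulr_ge0 ?(ltW D_gt0).
have powS : n%:R `^ (1 + gam) = n%:R * n%:R `^ gam :> R.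
  rewrite powRD ?(gt_eqF n_gt0) ?implybT//.
  by rewrite (powRr1 (ltW n_gt0)).
have sq (g : 'M[nat]_n) : mass P G g != 0 -> link_error d.-1 g ^+ 2 <=
    (m%:R ^+ 2 + 2 * D) * (Q * (d%:R / n%:R ^+ 2 * deg_sq g + n%:R^-1 * nb_loops g)).
  move=> hg; rewrite expr2; apply: ler_pM; rewrite ?normr_ge0//.
    exact: (old_triangles_bound law hn hg d.-1).
  apply: le_trans (old_triangles_drift law hn hg d.-1) _; rewrite -/Q.
  rewrite prednK ?(leq_trans m_gt0)//; apply: ler_wpM2l => //.
  by rewrite le_eqVlt; apply/orP; left; apply/eqP; ring.
apply: (@le_trans _ _ (n%:R * ((m%:R ^+ 2 + 2 * D) *
    (Q * (d%:R / n%:R ^+ 2 * mean (@deg_sq R n) + n%:R^-1 * mean (@nb_loops R n)))))).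
  rewrite ler_pM2l// -!meanZ -meanD -!meanZ; exact: mean_le.
rewrite -/Q (_ : n%:R * _ = (m%:R ^+ 2 + 2 * D) * Q *
  (d%:R * (mean (@deg_sq R n) / n%:R) + mean (@nb_loops R n))); last first.
  by field; rewrite gt_eqF.
apply: ler_wpM2l; first exact: mulr_ge0.
by rewrite lerD// ler_wpM2l// ler_pdivrMr// -mulrA [_ * n%:R]mulrC -powS.
Qed.

(** The square is treated as in [link_error_mean]. A newborn vertex enters a class above [m] only
    with a loop, so the large term [n^(1/2 + gam)] is confined to class [m]. *)
Lemma birth_error_mean n d (gam Ks Kl : R) : (n0 <= n)%N -> (m <= d)%N ->
  mean (@deg_sq R n) <= Ks * n%:R `^ (1 + gam) ->
  mean (@nb_loops R n) <= Kl * n%:R `^ gam ->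
  n%:R * mean (fun g : 'M[nat]_n => birth_error d g ^+ 2) <=
  (m%:R ^+ 2 + D) * ((if (m < d)%N then 0 else
      (birth_const m D C + m%:R ^+ 2 * C + D) *
      (Ks * n%:R `^ (2^-1 + gam) + Kl * n%:R `^ gam)) + m%:R ^+ 2 * C).
Proof.
move=> hn md hs hl; have n_gt0 := N_gt0 hn.
pose Q := birth_const m D C + m%:R ^+ 2 * C + D.
have Q0 : 0 <= Q.
  by rewrite !(addr_ge0, mulr_ge0, exprn_ge0)// ?(ltW D_gt0).
have E0 : 0 <= m%:R ^+ 2 + D by rewrite addr_ge0 ?sqr_ge0 ?(ltW D_gt0).
have q0 : 0 < Num.sqrt n%:R :> R by rewrite sqrtr_gt0.
have powS : n%:R `^ (1 + gam) = Num.sqrt n%:R * n%:R `^ (2^-1 + gam) :> R.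
  rewrite -(powR12_sqrt (ltW n_gt0)) -powRD ?(gt_eqF n_gt0) ?implybT//.
  by congr (_ `^ _); field.
pose e : R := if (m < d)%N then 0 else 1.
have e0 : 0 <= e by rewrite /e; case: ifP.
pose l (g : 'M[nat]_n) := CE g (fun g' => (0 < g' ord_max ord_max)%N%:R).
have sq (g : 'M[nat]_n) : mass P G g != 0 -> birth_error d g ^+ 2 <=
    (m%:R ^+ 2 + D) * (e * Q * ((n%:R * Num.sqrt n%:R)^-1 * deg_sq g
      + n%:R^-1 * nb_loops g) + m%:R ^+ 2 * l g).
  move=> hg; rewrite expr2; apply: ler_pM; rewrite ?normr_ge0//.
    exact: birth_error_le.
  rewrite /birth_error /e; case: ifP => md1.
    rewrite !mul0r add0r subr0 ger0_norm; last first.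
      by apply: (cmean_ge0 P b process hn) => g' _; rewrite mulr_ge0.
    rewrite /l -cmeanZ; apply: (cmean_le P b process hn) => g' gg'.
    have /andP[b0 b1] := birth_bound gg'.
    case: (g' ord_max ord_max) => [|j]; last first.
      by rewrite mulr1; case: (_ == _); rewrite ?mul1r// mul0r (le_trans b0).
    by rewrite addn0 (ltn_eqF md1) mul0r mulr0.
  have dm : d = m by apply/eqP; rewrite eqn_leq md leqNgt md1.
  rewrite dm mul1r; apply: le_trans (birth_drift law hn hg) _; rewrite -/Q lerD2r.
  by rewrite mulrC [_ / n%:R]mulrC [deg_sq g / _]mulrC mulrC.
apply: (@le_trans _ _ (n%:R * ((m%:R ^+ 2 + D) * (e * Q * ((n%:R * Num.sqrt n%:R)^-1 *
    mean (@deg_sq R n) + n%:R^-1 * mean (@nb_loops R n)) + m%:R ^+ 2 * (C / n%:R))))).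
  rewrite ler_pM2l//; apply: le_trans (_ : (m%:R ^+ 2 + D) * (e * Q *
    ((n%:R * Num.sqrt n%:R)^-1 * mean (@deg_sq R n) + n%:R^-1 * mean (@nb_loops R n))
     + m%:R ^+ 2 * mean l) <= _).
    rewrite -!meanZ -meanD -!meanZ -meanD -meanZ; exact: mean_le.
  rewrite ler_wpM2l// lerD2l ler_wpM2l ?sqr_ge0//.
  by rewrite -mean_step// (law_loop law hn).
rewrite (_ : n%:R * _ = (m%:R ^+ 2 + D) * (e * (Q *
  (mean (@deg_sq R n) / Num.sqrt n%:R + mean (@nb_loops R n))) + m%:R ^+ 2 * C)); last first.
  by field; rewrite !gt_eqF.
apply: ler_wpM2l => //; rewrite lerD2r /e -/Q; case: ifP => _; rewrite ?mul0r// mul1r.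
apply: ler_wpM2l => //; rewrite lerD// ler_pdivrMr//.
by rewrite -mulrA [_ * Num.sqrt _]mulrC -powS.
Qed.

Lemma degree_variance_pred : exists2 M : R, 0 <= M & forall n d, (n0 <= n)%N -> (m <= d)%N ->
  mean (fun g : 'M[nat]_n =>
    ((nb_vertices_deg g d.-1)%:R - c d.-1 * n%:R) ^+ 2) <= M * d%:R * n%:R.
Proof.
have [M M0 hM] := degree_variance law.
exists (M + n0%:R ^+ 2) => [|n d hn md]; first by rewrite addr_ge0 ?sqr_ge0.
have n_gt0 := N_gt0 hn; have d_gt0 : (0 < d)%N by rewrite (leq_trans m_gt0).
have n1 : 1 <= n%:R :> R by rewrite ler1n -(ltr0n R).
have d1 : 1 <= d%:R :> R by rewrite ler1n.
rewrite -mulrA; have dn : 1 <= d%:R * n%:R :> R by rewrite mulr_ege1.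
have [md1|dm1] := leqP m d.-1.
  apply: le_trans (hM _ _ hn md1) _; rewrite -mulrA.
  apply: ler_pM => //; first by rewrite lerDl sqr_ge0.
  by rewrite ler_pM2r// ler_nat leq_pred.
rewrite -[leRHS](mean_cst _ hn); apply: mean_le => g hg.
rewrite deg_density_lt// mul0r subr0; apply: (@le_trans _ _ (n0%:R ^+ 2)).
  by rewrite lerXn2r ?nnegrE// ler_nat (nb_vertices_deg_low law hn hg).
apply: (@le_trans _ _ (M + n0%:R ^+ 2)); first by rewrite lerDr.
by rewrite ler_peMr ?addr_ge0 ?sqr_ge0.
Qed.

Let sqr4 (x y z t : R) : (x + y + z + t) ^+ 2 <=
  4 * (x ^+ 2 + y ^+ 2 + z ^+ 2 + t ^+ 2).
Proof.
have := sqr_ge0 (x - y); have := sqr_ge0 (x - z); have := sqr_ge0 (x - t).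
have := sqr_ge0 (y - z); have := sqr_ge0 (y - t); have := sqr_ge0 (z - t).
lra.
Qed.

(** Two supersolutions are added. [d^3 n^(1 + gam)] takes the noise and the errors present in every
    class. [c d n^(3/2 + gam)] takes the birth error: its source sits in class [m] alone, and the
    equations of the density, [c m (1 + rate m) = 1] and [c d (1 + rate d) = rate (d - 1) * c (d -
    1)], balance it exactly. *)
Theorem triangle_variance (gam : R) : 0 < gam -> 2 * A < 1 + gam ->
  exists2 M : R, 0 <= M & forall n d, (n0 <= n)%N -> (m <= d)%N ->
  mean (fun g : 'M[nat]_n => ((nb_triangles_deg g d)%:R - k d * n%:R) ^+ 2) <=
  M * (d%:R ^+ 3 * n%:R `^ (1 + gam) + c d * n%:R `^ (2^-1 + 1 + gam)).
Proof.
move=> gam0 Agam.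
have [Kt Kt0 ht] := triangles_noise; have [Kd Kd0 hd] := triangles_drift.
have [Mp Mp0 hp] := degree_variance_pred.
have [Ks Ks0 hs] := deg_sq_mean law (ltW gam0) Agam.
have [Kl Kl0 hl] := nb_loops_mean law gam0.
have [Ck hCk] := tri_density_le A_gt0 A_lt1 m_gt0 D_gt0 AB.
have Ck0 : 0 <= Ck by apply: le_trans (hCk m); rewrite ltW// tri_density_gt0.
have k0 := damping_gt0 law; set dmp := damping m A B in k0.
have id0 : 0 <= dmp^-1 by rewrite invr_ge0 ltW.
pose Q1 := (m%:R ^+ 2 + 2 * D) * (C * (1 + m%:R ^+ 2) + 2 * D).
pose Q3 := birth_const m D C + m%:R ^+ 2 * C + D.
have Q10 : 0 <= Q1.
  by rewrite !(mulr_ge0, addr_ge0) ?exprn_ge0// ltW.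
have Q20 : 0 <= m%:R ^+ 2 + D by rewrite addr_ge0 ?exprn_ge0// ltW.
have Q30 : 0 <= Q3.
  by rewrite !(addr_ge0, mulr_ge0, exprn_ge0)// ltW.
pose K3 := 4 * (Kd ^+ 2 + Q1 * (Ks + Kl) + D ^+ 2 * Mp + (m%:R ^+ 2 + D) * (m%:R ^+ 2 * C)).
pose K4 := 4 * ((m%:R ^+ 2 + D) * (Q3 * (Ks + Kl))).
have K30 : 0 <= K3.
  apply: mulr_ge0 => //; apply: addr_ge0; first apply: addr_ge0; first apply: addr_ge0.
  - exact: sqr_ge0.
  - by rewrite mulr_ge0 ?addr_ge0.
  - by rewrite mulr_ge0 ?sqr_ge0.
  - by rewrite mulr_ge0// mulr_ge0 ?sqr_ge0.
have K40 : 0 <= K4 by apply: mulr_ge0 => //; apply: mulr_ge0 => //; exact: (mulr_ge0 Q30 (addr_ge0 Ks0 Kl0)).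
pose M1 := (1 + dmp^-1) * (K3 + K4) + Kt.
have M10 : 0 <= M1.
  by apply: addr_ge0 => //; apply: mulr_ge0; apply: addr_ge0.
(* Covers the initial range, where the deviation is at most [(C + Ck) n] and [n <= (n0 + 2) d]. *)
pose K0 := (C + Ck) ^+ 2 * (n0 + 2)%:R.
have K00 : 0 <= K0 by rewrite mulr_ge0 ?sqr_ge0.
exists (M1 + K0) => [|n d hn md]; first exact: addr_ge0.
have a_ge1 j : (n0 <= j)%N -> 1 <= j%:R `^ gam :> R.
  move=> hj; rewrite -[leLHS](powRr0 (j%:R : R)) ler_powR ?(ltW gam0)//.
  by rewrite ler1n (leq_trans n0_gt0).
pose X n d (g : 'M[nat]_n) : R := (nb_triangles_deg g d)%:R - k d * n%:R.
(* On [d >= m], the indicator of class [m], where the birth error enters. *)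
pose e (d : nat) : R := if (m < d)%N then 0 else 1.
have e01 d' : 0 <= e d' by rewrite /e; case: ifP.
have mu_ge0 : 0 <= M1 + K0 by exact: addr_ge0.
have powS1 j : (n0 <= j)%N -> j%:R `^ (1 + gam) = j%:R * j%:R `^ gam :> R.
  move=> hj; have j0 := N_gt0 hj.
  by rewrite powRD ?(gt_eqF j0) ?implybT// (powRr1 (ltW j0)).
have powS2 j : (n0 <= j)%N ->
    j%:R `^ (2^-1 + 1 + gam) = j%:R * j%:R `^ (2^-1 + gam) :> R.
  move=> hj; have j0 := N_gt0 hj.
  rewrite (_ : 2^-1 + 1 + gam = 1 + (2^-1 + gam)); last by ring.
  by rewrite powRD ?(gt_eqF j0) ?implybT// (powRr1 (ltW j0)).
move: n d hn md.
apply: (@supersolution _ _ _ _ _ _ _ _ _ _ _ _ law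
  (fun n d => mean (fun g : 'M[nat]_n => X n d g ^+ 2))
  (fun n d => (M1 + K0) * (d%:R ^+ 3 * n%:R `^ (1 + gam) + c d * n%:R `^ (2^-1 + 1 + gam)))
  (fun n d => (M1 + K0) * (d%:R ^+ 3 * n%:R `^ gam + e d * n%:R `^ (2^-1 + gam))))
  => n d hn md nd.
- have d1 : 1 <= d%:R :> R by rewrite ler1n (leq_trans m_gt0).
  have n_gt0 := N_gt0 hn.
  apply: (@le_trans _ _ (K0 * (d%:R * n%:R))).
    apply: (@le_trans _ _ ((C + Ck) ^+ 2 * (n%:R * n%:R))).
      rewrite -[leRHS](mean_cst _ hn); apply: mean_le => g hg.
      rewrite -expr2 -exprMn -real_normK ?num_real//.
      have CCk : 0 <= (C + Ck) * n%:R by rewrite mulr_ge0 ?addr_ge0.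
      rewrite lerXn2r ?nnegrE// /X.
      have h1 : (nb_triangles_deg g d)%:R <= C * n%:R.
        apply: le_trans (law_triangles law hn hg); rewrite ler_nat /nb_triangles_deg.
        by rewrite [leqRHS](bigID (fun v => deg g v == d))/= leq_addr.
      have h2 : 0 <= (nb_triangles_deg g d)%:R :> R := ler0n _ _.
      have h3 : k d * n%:R <= Ck * n%:R by rewrite ler_wpM2r.
      have h4 : 0 <= k d * n%:R by rewrite mulr_ge0// ltW// tri_density_gt0.
      have h5 : 0 <= C * n%:R by rewrite mulr_ge0.
      by rewrite ler_norml mulrDl; apply/andP; split; lra.
    rewrite /K0 -mulrA ler_wpM2l ?sqr_ge0// mulrA ler_pM2r// -natrM ler_nat.
    case/orP: nd => [nd|/eqP ->]; first by rewrite (leq_trans nd)// leq_mul2r leq_addl orbT.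
    by rewrite (leq_trans (leq_addr 2 n0))// leq_pmulr// (leq_trans m_gt0).
  apply: ler_pM => //; rewrite ?mulr_ge0 ?lerDr//.
  apply: (@le_trans _ _ (d%:R ^+ 3 * n%:R `^ (1 + gam))); last first.
    by rewrite lerDl mulr_ge0 ?powR_ge0// (deg_density_ge0 A_gt0 A_lt1 m_gt0 AB).
  rewrite powS1//; apply: ler_pM => //.
    by rewrite exprS ler_peMr// exprn_ege1.
  by rewrite ler_peMr ?a_ge1// ltW.
- have n_gt0 := N_gt0 hn.
  have d1 : 1 <= d%:R :> R by rewrite ler1n (leq_trans m_gt0).
  pose r (g : 'M[nat]_n) := Kd * (d%:R ^+ 2 / n%:R) + link_error d.-1 g
    + D * (d%:R / n%:R) * `|(nb_vertices_deg g d.-1)%:R - c d.-1 * n%:R|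
    + birth_error d g.
  apply: le_trans (@centered_step _ _ _ _ _ _ _ _ _ _ _ _ law n d X r (Kt * d%:R ^+ 3) hn md nd _ _) _.
  + by move=> g hg; exact: hd.
  + move=> g hg; exists ((nb_triangles_deg g d)%:R - k d * n.+1%:R).
    apply: le_trans (ht n d g hn md hg).
    apply: (cmean_le P b process hn) => g' gg'.
    rewrite /X (nb_triangles_next _ gg') nb_triangles_class.
    by rewrite opprB addrA subrK.
  rewrite lerD2l -/dmp.
  have n1 : 1 <= n%:R :> R by rewrite ler1n -(ltr0n R).
  have dn : 2 * d%:R <= n%:R :> R by rewrite -natrM ler_nat.
  have a1 := a_ge1 _ hn; set a := n%:R `^ gam in a1 *.
  set a2 := n%:R `^ (2^-1 + gam).
  have aa2 : a <= a2 by rewrite ler_powR// lerDr.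
  have a0 : 0 <= a by rewrite (le_trans ler01).
  have a20 : 0 <= a2 by rewrite (le_trans a0).
  have L1 := link_error_mean hn md (hs _ hn) (hl _ hn).
  have L2 := birth_error_mean hn md (hs _ hn) (hl _ hn).
  have L3 := hp n d hn md.
  rewrite -/Q1 -/Q3 -/a -/a2 in L1 L2.
  have nr : n%:R * mean (fun g => r g ^+ 2) <= (K3 + K4) * (d%:R ^+ 3 * a + e d * a2).
    have r4 : mean (fun g => r g ^+ 2) <= 4 * ((Kd * (d%:R ^+ 2 / n%:R)) ^+ 2
        + mean (fun g : 'M[nat]_n => link_error d.-1 g ^+ 2)
        + (D * (d%:R / n%:R)) ^+ 2 * mean (fun g : 'M[nat]_n =>
            ((nb_vertices_deg g d.-1)%:R - c d.-1 * n%:R) ^+ 2)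
        + mean (fun g : 'M[nat]_n => birth_error d g ^+ 2)).
      rewrite -meanZ -[(Kd * (d%:R ^+ 2 / n%:R)) ^+ 2](mean_cst _ hn) -!meanD -meanZ.
      apply: mean_le => g hg; apply: le_trans (sqr4 _ _ _ _) _.
      by rewrite [(D * _ * `|_|) ^+ 2]exprMn [`|_ - c d.-1 * _| ^+ 2]real_normK// num_real.
    apply: le_trans (ler_wpM2l (ltW n_gt0) r4) _.
    rewrite mulrCA /K3 /K4 -[4 * _ + _]mulrDr -[leRHS]mulrA ler_pM2l// mulrDl mulrDr.
    rewrite 2![n%:R * (_ + _)]mulrDr.
    have d30 : 1 <= d%:R ^+ 3 :> R by rewrite exprn_ege1.
    have da1 : d%:R ^+ 3 <= d%:R ^+ 3 * a by rewrite ler_peMr// (le_trans ler01).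
    have b1 : n%:R * (Kd * (d%:R ^+ 2 / n%:R)) ^+ 2 <= Kd ^+ 2 * (d%:R ^+ 3 * a).
      rewrite (_ : n%:R * _ = Kd ^+ 2 * (d%:R ^+ 3 * (d%:R / n%:R))); last first.
        by field; rewrite gt_eqF.
      rewrite ler_wpM2l ?sqr_ge0// ler_wpM2l ?(le_trans ler01)// (le_trans _ a1)//.
      rewrite ler_pdivrMr// mul1r; have : 0 <= d%:R :> R by []; lra.
    have b2 : Q1 * (d%:R * (Ks * a) + Kl * a) <= Q1 * (Ks + Kl) * (d%:R ^+ 3 * a).
      rewrite -mulrA ler_wpM2l// mulrDl; apply: lerD.
        rewrite mulrCA ler_wpM2l// ler_wpM2r// exprS ler_peMr//.
        by rewrite exprn_ege1.
      by rewrite ler_wpM2l// ler_peMl.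
    have b3 : n%:R * ((D * (d%:R / n%:R)) ^+ 2 * mean (fun g : 'M[nat]_n =>
            ((nb_vertices_deg g d.-1)%:R - c d.-1 * n%:R) ^+ 2)) <=
        D ^+ 2 * Mp * (d%:R ^+ 3 * a).
      apply: (@le_trans _ _ (n%:R * ((D * (d%:R / n%:R)) ^+ 2 * (Mp * d%:R * n%:R)))).
        by rewrite ler_pM2l// ler_wpM2l// sqr_ge0.
      rewrite [leLHS](_ : _ = D ^+ 2 * Mp * d%:R ^+ 3); last by field; rewrite gt_eqF.
      by rewrite ler_wpM2l// mulr_ge0 ?sqr_ge0.
    have b4 : (m%:R ^+ 2 + D) * ((if (m < d)%N then 0 else Q3 * (Ks * a2 + Kl * a))
          + m%:R ^+ 2 * C) <=
        (m%:R ^+ 2 + D) * (m%:R ^+ 2 * C) * (d%:R ^+ 3 * a)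
        + (m%:R ^+ 2 + D) * (Q3 * (Ks + Kl)) * (e d * a2).
      rewrite -[_ * (m%:R ^+ 2 * C) * _]mulrA -[_ * (Q3 * _) * _]mulrA -mulrDr.
      rewrite ler_wpM2l// addrC; apply: lerD.
        by rewrite ler_peMr ?mulr_ge0 ?sqr_ge0// (le_trans d30).
      rewrite /e; case: ifP => _; first by rewrite mul0r !mulr0.
      by rewrite mul1r -mulrA ler_wpM2l// mulrDl lerD2l ler_wpM2l.
    have K40' := K40; rewrite /K4 pmulr_rge0// in K40'.
    have K30' := K30; rewrite /K3 pmulr_rge0// in K30'.
    have x1 := mulr_ge0 K30' (mulr_ge0 (e01 d) a20).
    have x2 := mulr_ge0 K40' (le_trans ler01 (le_trans d30 da1)).
    move: (le_trans L1 b2) (le_trans L2 b4) b1 b3 x1 x2; lra.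
  have t1 : (1 + n%:R / dmp) * mean (fun g => r g ^+ 2) <=
      (1 + dmp^-1) * ((K3 + K4) * (d%:R ^+ 3 * a + e d * a2)).
    apply: (@le_trans _ _ ((1 + dmp^-1) * n%:R * mean (fun g => r g ^+ 2))).
      rewrite ler_wpM2r//.
        by apply: mean_ge0 => g _; exact: sqr_ge0.
      by rewrite mulrDl mul1r [_^-1 * _]mulrC lerD2r.
    by rewrite -mulrA ler_wpM2l// addr_ge0.
  have d30 : 0 <= d%:R ^+ 3 :> R by rewrite exprn_ge0.
  have t2 : Kt * d%:R ^+ 3 <= Kt * (d%:R ^+ 3 * a + e d * a2).
    rewrite ler_wpM2l// (@le_trans _ _ (d%:R ^+ 3 * a))//; first by rewrite ler_peMr.
    by rewrite lerDl mulr_ge0.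
  apply: le_trans (lerD t1 t2) _; rewrite mulrA -mulrDl ler_wpM2r//.
    by rewrite addr_ge0// mulr_ge0.
  by rewrite /M1 lerDl.
- have n_gt0 := N_gt0 hn.
  have d0 : 0 <= d%:R :> R := ler0n _ _.
  have lam := rate_gt0 A_gt0 A_lt1 m_gt0 AB md.
  have [a0 a20] := (powR_ge0 (n%:R : R) gam, powR_ge0 (n%:R : R) (2^-1 + gam)).
  have nn0 : (0 < n)%N by rewrite (leq_trans n0_gt0).
  have p1 := @powR_succ_ge R n (1 + gam) nn0 _.
  have p2 := @powR_succ_ge R n (2^-1 + 1 + gam) nn0 _.
  have g1 : 1 <= 1 + gam by rewrite lerDl ltW.
  have g2 : 1 <= 2^-1 + 1 + gam by move: gam0; lra.
  move: p1 p2 => /(_ g1) p1 /(_ g2) p2.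
  rewrite (_ : 1 + gam - 1 = gam) in p1; last by ring.
  rewrite (_ : 2^-1 + 1 + gam - 1 = 2^-1 + gam) in p2; last by ring.
  have c0 := deg_density_ge0 A_gt0 A_lt1 m_gt0 AB.
  have U1 : n%:R `^ (1 + gam) + n%:R `^ gam <= n.+1%:R `^ (1 + gam).
    by apply: le_trans p1; rewrite lerD2l ler_peMl.
  have U2 : n%:R `^ (2^-1 + 1 + gam) + n%:R `^ (2^-1 + gam) <= n.+1%:R `^ (2^-1 + 1 + gam).
    by apply: le_trans p2; rewrite lerD2l ler_peMl.
  pose u1 := (if (m < d)%N then rate d.-1 * d.-1%:R ^+ 3 else 0) * n%:R `^ gam.
  pose u2 := (if (m < d)%N then rate d.-1 * c d.-1 else 0) * n%:R `^ (2^-1 + gam).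
  rewrite [leLHS](_ : _ = (M1 + K0) * ((d%:R ^+ 3 * (n%:R `^ (1 + gam) - rate d * n%:R `^ gam + n%:R `^ gam) + u1)
     + (c d * (n%:R `^ (2^-1 + 1 + gam) - rate d * n%:R `^ (2^-1 + gam)) + u2 + e d * n%:R `^ (2^-1 + gam)))); last first.
    have n_neq0 : n%:R != 0 :> R by rewrite gt_eqF.
    by rewrite /inflow /u1 /u2 powS1// powS2//; case: ifP => _; field.
  rewrite ler_wpM2l//; apply: lerD.
    apply: (@le_trans _ _ (d%:R ^+ 3 * (n%:R `^ (1 + gam) + n%:R `^ gam))); last first.
      by rewrite ler_wpM2l ?exprn_ge0.
    suff : u1 <= d%:R ^+ 3 * (rate d * n%:R `^ gam) by lra.
    rewrite mulrA /u1 ler_wpM2r//; case: ifP => md1; last first.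
      by rewrite mulr_ge0 ?exprn_ge0// ltW.
    rewrite mulrC; apply: ler_pM.
    - by rewrite exprn_ge0.
    - apply/ltW/(rate_gt0 A_gt0 A_lt1 m_gt0 AB).
      by rewrite -ltnS prednK// (leq_trans m_gt0).
    - by rewrite lerXn2r ?nnegrE// ler_nat leq_pred.
    - by have := rateS A B d.-1; rewrite prednK ?(leq_trans m_gt0)// => ->; rewrite lerDr ltW.
  apply: (@le_trans _ _ (c d * (n%:R `^ (2^-1 + 1 + gam) + n%:R `^ (2^-1 + gam)))); last first.
    by rewrite ler_wpM2l.
  rewrite /u2 /e; case: ifP => md1.
    have md' : (m <= d.-1)%N by rewrite -ltnS prednK// (leq_trans m_gt0).
    have := deg_densityS A_gt0 A_lt1 m_gt0 AB md'; rewrite prednK ?(leq_trans m_gt0)// => <-.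
    by rewrite le_eqVlt; apply/orP; left; apply/eqP; ring.
  have dm : d = m by apply/eqP; rewrite eqn_leq md leqNgt md1.
  have := deg_density_min A_gt0 A_lt1 m_gt0 AB; rewrite -dm => cm.
  rewrite le_eqVlt; apply/orP; left; apply/eqP.
  rewrite -[X in _ + X * _]cm; ring.
Qed.

End Triangles.

(** * The attachment law of the T-subclass *)

Section FromSubclass.
Context {R : realType} {dT : measure_display} {T : measurableType dT}.
Variables (P : probability T R) (m n0 : nat) (A B D : R).
Variable G : forall n : nat, T -> 'M[nat]_n.
Hypotheses (m_gt0 : (0 < m)%N) (n0_gt0 : (0 < n0)%N).
Hypotheses (A_gt0 : 0 < A) (A_lt1 : A < 1).
Hypothesis sub : T_subclass P m n0 A B D G.

Let process : graph_process m n0 G := PA_process (T_PA sub).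

Lemma process_ind (Q : forall n, 'M[nat]_n -> Prop) :
  (forall w, Q n0 (G n0 w)) ->
  (forall n g g', (n0 <= n)%N -> extends m g g' -> Q n g -> Q n.+1 g') ->
  forall n w, (n0 <= n)%N -> Q n (G n w).
Proof.
move=> init step; elim=> [|n IH] w hn.
  by move: hn n0_gt0; case: n0.
move: hn; rewrite leq_eqVlt => /predU1P[<-|hn]; first exact: init.
apply: step (IH w hn); first exact: hn.
exact: (extends_process process).
Qed.

Lemma ord_last_cases n (i : 'I_n.+1) :
  i = ord_max \/ exists j : 'I_n, i = old_vertex j.
Proof.
case: (unliftP ord_max i) => [j ->|->]; [right|by left].
by exists j; apply/val_inj; rewrite /= /bump leqNgt ltn_ord.
Qed.

(** Old entries never change and a new row sums to [m], so the sum of the initial entries plus [m]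
    bounds every multiplicity. *)
Lemma process_bounded : exists b, forall n w i j, (n0 <= n)%N -> (G n w i j <= b)%N.
Proof.
have [g0 [_ _ e0]] := process_init process.
exists (\sum_i \sum_j g0 i j + m)%N => n w i j hn.
move: i j; apply: (@process_ind (fun n g => forall i j, (g i j <= _)%N)) hn => {n w}.
  move=> w i j; rewrite e0 (bigD1 i)//= (bigD1 j)//= -!addnA; exact: leq_addr.
move=> n g g' hn [sym old row] IH i j.
have last (k : 'I_n.+1) : (g' ord_max k <= m)%N.
  by rewrite -row (bigD1 k)//= leq_addr.
have lastb k : (g' ord_max k <= \sum_i \sum_j g0 i j + m)%N.
  exact: leq_trans (last k) (leq_addl _ _).
have [->//|[i' ->]] := ord_last_cases i.
have [->|[j' ->]] := ord_last_cases j; last by rewrite old.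
by rewrite -[g']sym mxE.
Qed.

Lemma cond_prob_deg_incr (b : nat) n (g : 'M[nat]_n) v k :
  (forall n w i j, (n0 <= n)%N -> (G n w i j <= b)%N) ->
  (n0 <= n)%N -> mass P G g != 0 ->
  cond_prob P (deg_incr G v k) [set w | G n w = g] =
  cmean P b G g (fun g' => (links g' v == k)%:R).
Proof.
move=> bounded hn hg.
rewrite (@cmean_ext _ _ _ P m n0 b G process n g _
  (fun g' => (deg g' (old_vertex v) == deg g v + k)%N%:R) hn); last first.
  by move=> g' gg'; rewrite (deg_old gg') eqn_add2l.
rewrite (cmean_event process bounded (fun g' => deg g' (old_vertex v) == deg g v + k)%N hn hg).
rewrite /cond_prob; congr (fine (P _) / _).
apply/seteqP; split=> w [/= e1 e2]; split=> //=.
  by move: e1; rewrite /deg_incr /= e2 => /eqP.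
by rewrite /deg_incr/= e2; apply/eqP.
Qed.

Lemma cond_prob_deg_incr2 (b : nat) n (g : 'M[nat]_n) v u :
  (forall n w i j, (n0 <= n)%N -> (G n w i j <= b)%N) ->
  (n0 <= n)%N -> mass P G g != 0 ->
  cond_prob P (deg_incr G v 1 `&` deg_incr G u 1) [set w | G n w = g] =
  cmean P b G g (fun g' => ((links g' v == 1) && (links g' u == 1))%N%:R).
Proof.
move=> bounded hn hg.
pose Q (g' : 'M[nat]_n.+1) := ((deg g' (old_vertex v) == deg g v + 1) &&
  (deg g' (old_vertex u) == deg g u + 1))%N.
rewrite (@cmean_ext _ _ _ P m n0 b G process n g _ (fun g' => (Q g')%:R) hn); last first.
  by move=> g' gg'; rewrite /Q !(deg_old gg') !eqn_add2l.
rewrite (cmean_event process bounded Q hn hg) /cond_prob; congr (fine (P _) / _).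
apply/seteqP; split=> w [/=].
  by move=> [e1 e2] e; split=> //; rewrite /Q; move: e1 e2; rewrite /deg_incr/= e => -> ->; rewrite !eqxx.
by rewrite /Q => /andP[/eqP e1 /eqP e2] e; split=> //; rewrite /deg_incr/= e.
Qed.

Lemma attachment_law_subclass : exists b C, attachment_law P m n0 b A B D G C.
Proof.
have [b bounded] := process_bounded.
have [C1 h1] := PA_old (T_PA sub); have [C2 h2] := PA_new (T_PA sub).
have [C3 h3] := T_pair sub.
have [g0 [sym0 edges0 e0]] := process_init process.
pose t0 := (\sum_v triangles_at g0 v)%N.
(* [m * |C2|] arises because a loop at the new vertex is a union of [m] events, one for each excess
   of its degree; the last summand bounds the number of triangles per vertex. *)
pose C : R := `|C1| + m%:R * `|C2| + `|C3| + (t0 + 2 * (m * m))%:R.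
have p2 : 0 <= m%:R * `|C2| by rewrite mulr_ge0.
have [q1 q2 q3 q4] : [/\ C1 <= C, m%:R * C2 <= C, C3 <= C & (t0 + 2 * (m * m))%:R <= C].
  have p1 : 0 <= (t0 + 2 * (m * m))%:R :> R by [].
  have a1 := ler_norm C1; have a3 := ler_norm C3.
  have a2 : m%:R * C2 <= m%:R * `|C2| by rewrite ler_wpM2l// ler_norm.
  have [b1 b3] := (normr_ge0 C1, normr_ge0 C3).
  by rewrite /C; split; move: p1 p2 a1 a2 a3 b1 b3; lra.
have C0 : 0 <= C by apply: le_trans q4.
exists b, C; split=> //.
- exact: T_D_gt0 sub.
- exact: PA_sum (T_PA sub).
- move=> n g v hn hg; rewrite -(cond_prob_deg_incr v 0 bounded hn hg).
  have [h _ _] := h1 n g v hn (mass_neq0P hg).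
  rewrite (_ : 1 - rate A B (deg g v) / n%:R =
    1 - A * ((deg g v)%:R / n%:R) - B * n%:R^-1); last by rewrite /rate; ring.
  by apply: le_trans h _; rewrite ler_wpM2r// divr_ge0 ?sqr_ge0.
- move=> n g v hn hg; rewrite -(cond_prob_deg_incr v 1 bounded hn hg).
  have [_ h _] := h1 n g v hn (mass_neq0P hg).
  rewrite (_ : rate A B (deg g v) / n%:R =
    A * ((deg g v)%:R / n%:R) + B * n%:R^-1); last by rewrite /rate; ring.
  by apply: le_trans h _; rewrite ler_wpM2r// divr_ge0 ?sqr_ge0.
(* The subclass says nothing of gains above [m], but a vertex cannot receive more than [m] links. *)
- move=> n g v k hn hg k1; have [km|mk] := leqP k m.
    rewrite -(cond_prob_deg_incr v k bounded hn hg).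
    have [_ _ h] := h1 n g v hn (mass_neq0P hg).
    apply: le_trans (ler_norm _) _; apply: le_trans (h k _) _; first by rewrite k1.
    by rewrite ler_wpM2r// divr_ge0 ?sqr_ge0.
  apply: (@le_trans _ _ 0); last by rewrite mulr_ge0// divr_ge0 ?sqr_ge0.
  rewrite -[leRHS](cmean_cst process bounded 0 hn hg).
  apply: (cmean_le P b process hn) => g' gg'; rewrite (_ : _ == k = false)//.
  by apply/negbTE; rewrite neq_ltn (leq_ltn_trans (links_le gg' v) mk).
- move=> n g v w hn hg vw; rewrite -(cond_prob_deg_incr2 v w bounded hn hg).
  apply: le_trans (h3 n g v w hn (mass_neq0P hg) vw) _.
  by rewrite ler_wpM2r// divr_ge0 ?mulr_ge0 ?sqr_ge0.
- move=> n hn.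
  apply: (@le_trans _ _ (mean P b G (fun g : 'M[nat]_n.+1 =>
      \sum_(j < m) (deg g ord_max == m + j.+1)%N%:R))).
    apply: mean_le => g hg; have [w e] := mass_neq0 hg.
    have gg' : extends m (G n w) g by rewrite -e; exact: (extends_process process).
    have := loops_le gg'; have := deg_new gg'.
    case: (g ord_max ord_max) => [|j] dj jm; first by rewrite sumr_ge0.
    rewrite (bigD1 (Ordinal jm))//= dj eqxx lerDl sumr_ge0//.
  rewrite mean_sum; apply: (@le_trans _ _ (\sum_(j < m) C2 / n%:R)).
    apply: ler_sum => j _.
    rewrite -(mean_event P process bounded (fun g => deg g ord_max == m + j.+1)%N (leqW hn)).
    apply: le_trans (h2 n j.+1 hn _); last by rewrite ltn_ord.
    rewrite le_eqVlt; apply/orP; left; apply/eqP; congr (fine (P _)).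
    by apply/seteqP; split=> w /= /eqP.
  rewrite sumr_const card_ord -[leLHS]mulr_natr mulrAC ler_wpM2r ?invr_ge0//.
  by rewrite mulrC.
- move=> n g hn hg; have [w <-] := mass_neq0 hg.
  apply: (@process_ind (fun n g => multigraph g)) hn => [w'|k g1 g' _ []//].
  by rewrite e0.
- move=> n g hn hg; have [w <-] := mass_neq0 hg.
  apply: (@process_ind (fun n g => \sum_v deg g v = 2 * (m * n))%N) hn => [w'|k g1 g' _ gg' IH].
    by rewrite e0 deg_sumE// edges0.
  by rewrite (deg_sum_extends gg') IH mulnS mulnDr addnC.
- move=> n g hn hg; have [w <-] := mass_neq0 hg.
  apply: (@process_ind (fun n g => \sum_v (deg g v < m) <= n0)%N) hn => [w'|k g1 g' _ gg' IH].
    rewrite -[leqRHS](card_ord n0) -sum1_card; apply: leq_sum => v _; exact: leq_b1.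
  exact: leq_trans (low_extends gg') IH.
- move=> n g hn hg; have [w <-] := mass_neq0 hg.
  apply: (@le_trans _ _ ((t0 + 2 * (m * m))%:R * n%:R)); last by rewrite ler_wpM2r.
  rewrite -natrM ler_nat.
  apply: (@process_ind (fun n g => \sum_v triangles_at g v <= (t0 + 2 * (m * m)) * n)%N) hn
    => [w'|k g1 g' _ gg' IH].
    rewrite e0 -/t0; apply: leq_trans (leq_addr (2 * (m * m)) _) _.
    by rewrite leq_pmulr.
  apply: leq_trans (triangles_sum_extends gg') _; rewrite mulnS addnC leq_add//.
  exact: leq_addl.
Qed.

End FromSubclass.

(** * Positivity of Gamma *)

Lemma continuous_powR (R : realType) (r t : R) : 0 < t ->
  (fun u => u `^ r) u @[u --> t] --> t `^ r.
Proof.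
move=> t0; have h := is_derive1_powR r t0.
have d : derivable (fun u : R => u `^ r) t 1 by case: h.
by have /derivable1_diffP/differentiable_continuous := d.
Qed.

(** Raise [1 + t <= p (1 + t / p) <= p * expR (t / p)] to the power [p]. *)
Lemma powR_expR_le (R : realType) (p t : R) : 1 <= p -> 0 <= t ->
  (1 + t) `^ p <= p `^ p * expR t.
Proof.
move=> p1 t0; have p0 : 0 < p by apply: lt_le_trans p1.
have -> : expR t = expR (t / p) `^ p by rewrite -expRM divfK ?gt_eqF.
rewrite -powRM ?expR_ge0 ?(ltW p0)//.
have tp : 1 + t / p <= expR (t / p) by exact: expR_ge1Dx.
apply: ge0_ler_powR; rewrite ?nnegrE ?(ltW p0) ?addr_ge0//.
  by rewrite mulr_ge0 ?expR_ge0 ?(ltW p0).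
apply: (@le_trans _ _ (p * (1 + t / p))); last by rewrite ler_pM2l.
by rewrite mulrDr mulr1 mulrCA mulfV ?gt_eqF// mulr1 lerD2r.
Qed.

Section Gamma.
Context {R : realType}.
Variable x : R.
Hypothesis x_gt0 : 0 < x.
Local Notation mu := (@lebesgue_measure R).

(* The integrand [f] is dominated by a multiple of [h], the derivative of the
   bounded function [H], both near [0] and near infinity. *)
Let f (t : R) : R := t `^ (x - 1) * expR (- t).
Let h (t : R) : R := x * (t `^ (x - 1) * (1 + t) `^ (- (x + 1))).
Let H (t : R) : R := (t / (1 + t)) `^ x.

Let f_ge0 t : 0 <= f t. Proof. by rewrite mulr_ge0 ?powR_ge0 ?expR_ge0. Qed.

Let H_derive (t : R) : 0 < t -> is_derive t 1 H (h t).
Proof.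
move=> t0; have t1 : 0 < 1 + t by rewrite addr_gt0.
have y0 : 0 < t / (1 + t) by rewrite divr_gt0.
have d1 : is_derive t (1 : R) (fun u : R => u / (1 + u)) ((1 + t) ^- 2).
  have d2 : is_derive t (1 : R) (fun u : R => 1 + u) 1.
    by rewrite -[X in is_derive _ _ _ X]add0r; apply: is_deriveD.
  have t1' : 1 + t != 0 by rewrite gt_eqF.
  have d3 := is_deriveV t1' d2.
  have d4 := @is_deriveM R _ (fun u : R => u) (fun u : R => (1 + u)^-1) t 1 _ _ (is_derive_id _ _) d3.
  apply: is_derive_eq d4 _; rewrite /GRing.scale/=; field; exact: t1'.
have := @is_derive1_comp R (fun u => u `^ x) (fun u => u / (1 + u)) t _ _
  (is_derive1_powR x y0) d1.
move/is_derive_eq; apply; rewrite /h -mulrA; congr (_ * _).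
rewrite powRM ?invr_ge0 ?(ltW t0) ?(ltW t1)// -mulrA; congr (_ * _).
rewrite -(powR_inv1 (ltW t1)) -powRrM -[(1 + t) ^- 2]powR_invn ?(ltW t1)//.
rewrite -powRD ?(gt_eqF t1) ?implybT//; congr (_ `^ _); ring.
Qed.

Let h_cvg (t : R) : 0 < t -> h u @[u --> t] --> h t.
Proof.
move=> t0; apply: cvgM; first exact: cvg_cst.
apply: cvgM; first exact: continuous_powR.
apply: (@cvg_comp _ _ _ (fun u : R => 1 + u) (fun y : R => y `^ (- (x + 1))) _ (nbhs (1 + t))).
  by apply: cvgD; [exact: cvg_cst|exact: cvg_id].
by apply: continuous_powR; rewrite addr_gt0.
Qed.

Let f_le (t : R) : 0 < t -> f t <= (x + 1) `^ (x + 1) / x * h t.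
Proof.
move=> t0; rewrite /h mulrA divfK ?gt_eqF// mulrCA ler_wpM2l ?powR_ge0//.
have t1 : 0 < 1 + t by rewrite addr_gt0.
have := @powR_expR_le R (x + 1) t; rewrite lerDr => /(_ (ltW x_gt0) (ltW t0)) e.
rewrite expRN powRN ler_pdivlMr ?powR_gt0// mulrC ler_pdivrMr ?expR_gt0//.
Qed.

(** Compact intervals exhausting the half-line, away from the singularity of [h] at [0], so that the
    fundamental theorem of calculus applies to [H]. *)
Let I (n : nat) : set R := `[n.+2%:R^-1, n.+2%:R]%classic.

Let I_gt0 n t : I n t -> 0 < t.
Proof. by rewrite /I/= in_itv/= => /andP[+ _]; apply: lt_le_trans; rewrite invr_gt0. Qed.

Let I_lt n : n.+2%:R^-1 < n.+2%:R :> R.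
Proof.
apply: (@lt_trans _ _ 1); last by rewrite ltr1n.
by rewrite invf_lt1// ltr1n.
Qed.

Let I_bigcup : \bigcup_n I n = `]0, +oo[%classic.
Proof.
apply/seteqP; split=> t.
  by case=> n _ It; rewrite /= in_itv/= (I_gt0 It).
rewrite /= in_itv/= andbT => t0.
exists (Num.truncn (t + t^-1)) => //; rewrite /I/= in_itv/=.
have := @truncnS_gt _ (t + t^-1); set k := Num.truncn _ => hk.
have ti : 0 < t^-1 by rewrite invr_gt0.
have k1 : k.+1%:R <= k.+2%:R :> R by rewrite ler_nat.
apply/andP; split; last by move: hk k1 ti; lra.
by rewrite -[leRHS]invrK lef_pV2 ?posrE//; move: hk k1 t0; lra.
Qed.

Let mf : measurable_fun (`]0, +oo[%classic : set R) f.
Proof.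
apply: open_continuous_measurable_fun; first exact: interval_open.
move=> t; rewrite inE/= in_itv/= andbT => t0; apply: cvgM; first exact: continuous_powR.
apply: (@cvg_comp _ _ _ (fun u : R => - u) expR _ (nbhs (- t))).
  exact: opp_continuous.
exact: continuous_expR.
Qed.

Let int_h_le n : (\int[mu]_(t in I n) (h t)%:E <= 1)%E.
Proof.
have pos t : t \in `[n.+2%:R^-1 : R, n.+2%:R] -> 0 < t by move=> ht; apply: (@I_gt0 n).
have Hc (t : R) : 0 < t -> H u @[u --> t] --> H t.
  move=> t0; have d : derivable H t 1 by case: (H_derive t0).
  by have /derivable1_diffP/differentiable_continuous := d.
rewrite (@continuous_FTC2 _ h H)//.
- rewrite -EFinB lee_fin lerBlDr (@le_trans _ _ 1)//; last by rewrite lerDl powR_ge0.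
  rewrite -[leRHS](congr1 (@^~ x) (powR1 R)); apply: ge0_ler_powR; rewrite ?nnegrE ?(ltW x_gt0)//.
  by rewrite ler_pdivrMr ?addr_gt0// mul1r lerDr.
- apply: continuous_in_subspaceT => t; rewrite inE => /pos; exact: h_cvg.
- split.
  + move=> t; rewrite in_itv/= => /andP[t1 t2].
    have t0 : 0 < t by apply: lt_trans t1; rewrite invr_gt0.
    by case: (H_derive t0).
  + by apply: cvg_at_right_filter; apply: Hc; rewrite invr_gt0.
  + by apply: cvg_at_left_filter; apply: Hc.
- move=> t; rewrite in_itv/= => /andP[t1 t2]; rewrite derive1E.
  have t0 : 0 < t by apply: lt_trans t1; rewrite invr_gt0.
  by have := H_derive t0 => d; rewrite derive_val.
Qed.

(** [Gamma] is the real part of an extended integral, and an infinite integral would be read as [0]: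
    positivity needs finiteness. Monotone convergence reduces it to the intervals [I n]. *)
Let int_f_lty : (\int[mu]_(t in `]0%R, +oo[) (f t)%:E < +oo)%E.
Proof.
have sub n : I n `<=` `]0, +oo[%classic.
  by move=> t It; rewrite /= in_itv/= (I_gt0 It).
have mI n : measurable (I n) by exact: measurable_itv.
have K0 : 0 <= (x + 1) `^ (x + 1) / x by rewrite divr_ge0 ?powR_ge0 ?ltW.
set K := _ / x in K0.
apply: (@le_lt_trans _ _ K%:E); last exact: ltry.
rewrite -I_bigcup.
have cv : (\int[mu]_(t in I i) (f t)%:E)%E @[i --> \oo] -->
    (\int[mu]_(t in \bigcup_i I i) (f t)%:E)%E.
  apply: ge0_nondecreasing_set_cvg_integral => //.
  - apply/nondecreasing_seqP => n; apply/subsetPset => t; rewrite /I/= !in_itv/=.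
    move=> /andP[t1 t2]; apply/andP; split.
      by apply: le_trans t1; rewrite lef_pV2 ?posrE// ler_nat.
    by apply: le_trans t2 _; rewrite ler_nat.
  - move=> n; apply/measurable_EFinP; apply: measurable_funS mf => //.
  - by move=> n t _; rewrite lee_fin.
rewrite -(cvg_lim _ cv)//; apply: lime_le; first exact: cvgP cv.
near=> n.
apply: (@le_trans _ _ (\int[mu]_(t in I n) (K%:E * (h t)%:E))%E).
  apply: ge0_le_integral => //.
  - exact: measurable_itv.
  - by move=> t _; rewrite lee_fin.
  - by apply/measurable_EFinP; apply: measurable_funS mf.
  - apply/measurable_EFinP; apply: measurable_funM => //.
    apply: subspace_continuous_measurable_fun => //.
    apply: continuous_in_subspaceT => t; rewrite inE => /I_gt0; exact: h_cvg.
  - by move=> t /I_gt0 t0; rewrite -EFinM lee_fin f_le.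
rewrite ge0_integralZl//.
- rewrite -[leRHS]mule1; apply: lee_wpmul2l; [by rewrite lee_fin|exact: int_h_le].
- exact: measurable_itv.
- apply/measurable_EFinP; apply: subspace_continuous_measurable_fun => //.
  apply: continuous_in_subspaceT => t; rewrite inE => /I_gt0; exact: h_cvg.
- by move=> t It; rewrite lee_fin !mulr_ge0 ?powR_ge0// ltW.
Unshelve. all: by end_near.
Qed.

Lemma Gamma_gt0 : 0 < Gamma x.
Proof.
(* A lower bound of the integrand on [[1, 2]], whatever the sign of [x - 1]. *)
pose c : R := 2 `^ (- `|x - 1|) * expR (- 2).
have c0 : 0 < c by rewrite mulr_gt0 ?powR_gt0 ?expR_gt0.
have fc t : t \in `[1, 2] -> c <= f t.
  rewrite in_itv/= => /andP[t1 t2]; apply: ler_pM; rewrite ?powR_ge0 ?expR_ge0//.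
    apply: (@le_trans _ _ (t `^ (- `|x - 1|))).
      rewrite !powRN lef_pV2 ?posrE ?powR_gt0 ?(lt_le_trans ltr01 t1)//.
      by apply: ge0_ler_powR; rewrite ?nnegrE//; apply: le_trans t1.
    by rewrite ler_powR// lerNl -normrN ler_norm.
  by rewrite ler_expR lerN2.
have h1 : (c%:E <= \int[mu]_(t in `]0%R, +oo[) (f t)%:E)%E.
  apply: (@le_trans _ _ (\int[mu]_(t in `[1%R, 2%R]) (f t)%:E)%E).
    apply: (@le_trans _ _ (\int[mu]_(t in `[1%R, 2%R]) cst c%:E t)%E).
      rewrite integral_cst//= lebesgue_measure_itv/= lte_fin ltr1n/= -EFinB -EFinM.
      by rewrite lee_fin (_ : 2 - 1 = 1) ?mulr1//; ring.
    apply: ge0_le_integral => //.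
    - by move=> t _; rewrite lee_fin ltW.
    - apply/measurable_EFinP; apply: measurable_funS mf => // t.
      by rewrite /= !in_itv/= => /andP[t1 _]; rewrite (lt_le_trans ltr01).

  apply: ge0_subset_integral => //.
  - exact/measurable_EFinP.
  - by move=> t _; rewrite lee_fin.
  - by move=> t; rewrite /= !in_itv/= => /andP[t1 _]; rewrite (lt_le_trans ltr01).
apply: (lt_le_trans c0); rewrite /Gamma /Rintegral -lee_fin fineK//.
rewrite ge0_fin_numE; first exact: int_f_lty.
by apply: integral_ge0 => t _; rewrite lee_fin; exact: f_ge0.
Qed.

End Gamma.

(** * Concentration of the local clustering *)

Lemma bin2_natr (R : realType) d : 'C(d, 2)%:R = d%:R * (d%:R - 1) / 2 :> R.
Proof.
case: d => [|d]; first by rewrite bin0n mul0r mul0r.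
apply: (mulfI (_ : 2%:R != 0)); first by rewrite pnatr_eq0.
rewrite mulrCA mulfV ?pnatr_eq0// mulr1 -natrM -mul_bin_diag bin1 natrM.
by rewrite -[X in _ = _ * (X - 1)]natr1 addrK.
Qed.

Section Clustering.
Context {R : realType} {dT : measure_display} {T : measurableType dT}.
Variables (P : probability T R) (m n0 b : nat) (A B D C : R).
Variable G : forall n : nat, T -> 'M[nat]_n.
Hypothesis law : attachment_law P m n0 b A B D G C.

Let A_gt0 : 0 < A := law_A_gt0 law.
Let A_lt1 : A < 1 := law_A_lt1 law.
Let D_gt0 : 0 < D := law_D_gt0 law.
Let AB : 2 * m%:R * A + B = m%:R := law_AB law.
Let m_gt0 : (0 < m)%N := law_m_gt0 law.
Let n0_gt0 : (0 < n0)%N := law_n0_gt0 law.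
Let process : graph_process m n0 G := law_process law.
Let bounded : forall n w i j, (n0 <= n)%N -> (G n w i j <= b)%N := law_bounded law.

Local Notation mean := (mean P b G).
Local Notation c := (deg_density A B m).
Local Notation mt := (mean_triangles A B D m).
Local Notation k := (tri_density A B D m).
Local Notation p := (A^-1).

Let N_gt0 n : (n0 <= n)%N -> 0 < n%:R :> R.
Proof. by move=> hn; rewrite ltr0n (leq_trans n0_gt0). Qed.

Let pw_addE n (r s : R) : (n0 <= n)%N -> n%:R `^ r * n%:R `^ s = n%:R `^ (r + s) :> R.
Proof. by move=> /N_gt0 hn; rewrite powRD// (gt_eqF hn) implybT. Qed.

(** Squared relative errors of the two counts, in units of [theta]. Since this is at least [1] once
    either relative error exceeds [theta], its mean plays the role of Chebyshev's bound. *)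
Definition deviation n (theta : R) d (g : 'M[nat]_n) : R :=
  ((nb_vertices_deg g d)%:R - c d * n%:R) ^+ 2 / (theta * (c d * n%:R)) ^+ 2
  + ((nb_triangles_deg g d)%:R - k d * n%:R) ^+ 2 / (theta * (k d * n%:R)) ^+ 2.

(** With [c d >= k1 d^(-1 - p)] and [mean_triangles d >= k2 d], both [d n / (c d n)^2] and
    [d^3 n / (k d n)^2] become [O(d^(3 + 2 p) / n)], and [c d n^(3/2) / (k d n)^2] becomes
    [O(d^(p - 1) n^(-1/2))]. *)
Lemma deviation_mean (gam zeta x : R) : 0 < gam -> 2 * A < 1 + gam ->
  exists2 K : R, 0 <= K & forall n d, (n0 <= n)%N -> (m <= d)%N ->
    d%:R <= n%:R `^ x ->
    mean (@deviation n (n%:R `^ (- zeta)) d) <=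
    K * (n%:R `^ (2 * zeta + gam - 1 + x * (3 + 2 * p))
         + n%:R `^ (2 * zeta + gam - 2^-1 + x * (p - 1))).
Proof.
move=> gam0 Agam.
have [M1 M10 h1] := degree_variance law.
have [M2 M20 h2] := triangle_variance law gam0 Agam.
have [k1 k10 hk1] := deg_density_ge A_gt0 A_lt1 m_gt0 AB.
have [k2 k20 hk2] := mean_triangles_ge A_gt0 A_lt1 m_gt0 D_gt0 AB.
have p0 : 0 < p by rewrite invr_gt0.
have p1 : 1 < p by rewrite invf_gt1.
pose K : R := M1 / k1 ^+ 2 + M2 / (k1 * k2) ^+ 2 + M2 / (k1 * k2 ^+ 2).
have q1 : 0 <= M1 / k1 ^+ 2 by rewrite divr_ge0 ?sqr_ge0.
have q2 : 0 <= M2 / (k1 * k2) ^+ 2 by rewrite divr_ge0 ?sqr_ge0.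
have q3 : 0 <= M2 / (k1 * k2 ^+ 2) by rewrite divr_ge0// mulr_ge0 ?sqr_ge0// ltW.
exists K => [|n d hn md dx]; first by rewrite !addr_ge0.
have n_gt0 := N_gt0 hn; have n1 : 1 <= n%:R :> R by rewrite ler1n -(ltr0n R).
have d_gt0 : 0 < d%:R :> R by rewrite ltr0n (leq_trans m_gt0).
have d1 : 1 <= d%:R :> R by rewrite ler1n -(ltr0n R).
have c0 := deg_density_gt0 A_gt0 A_lt1 m_gt0 AB md.
have mt0 := mean_triangles_gt0 A_gt0 A_lt1 m_gt0 D_gt0 AB md.
set t := n%:R `^ zeta; have t0 : 0 < t by rewrite powR_gt0.
set v := d%:R `^ (1 + p); have v0 : 0 < v by rewrite powR_gt0.
have cv : k1 <= c d * v.
  have := hk1 d md; rewrite powRN ler_pdivrMr//.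
have md2 : k2 <= mt d / d%:R by rewrite ler_pdivlMr// hk2.
have ne : [/\ n%:R != 0 :> R, d%:R != 0 :> R, c d != 0, mt d != 0 & t != 0].
  by rewrite !gt_eqF.
have [ne1 ne2 ne3 ne4 ne5] := ne; have ne6 : v != 0 by rewrite gt_eqF.
have cv0 : 0 < c d * v by rewrite mulr_gt0.
have md0 : 0 < mt d / d%:R by rewrite divr_gt0.
have inv_le (r s : R) : 0 < r -> r <= s -> s^-1 <= r^-1.
  by move=> r0 rs; rewrite lef_pV2 ?posrE// (lt_le_trans r0).
have sq_le (r s : R) : 0 <= r -> r <= s -> r ^+ 2 <= s ^+ 2.
  by move=> r0 rs; rewrite lerXn2r ?nnegrE// (le_trans r0).
pose E1 := d%:R * v ^+ 2 * (t ^+ 2 * (n%:R `^ gam / n%:R)).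
pose E2 := v / d%:R ^+ 2 * (t ^+ 2 * n%:R `^ (gam - 2^-1)).
have E10 : 0 <= E1.
  apply: mulr_ge0; first by rewrite mulr_ge0 ?sqr_ge0// ltW.
  by apply: mulr_ge0; rewrite ?sqr_ge0// divr_ge0 ?powR_ge0// ltW.
have E20 : 0 <= E2.
  by rewrite /E2 mulr_ge0 ?divr_ge0 ?sqr_ge0 ?powR_ge0 ?(ltW v0)// mulr_ge0 ?sqr_ge0 ?powR_ge0.
have a1 : (n%:R `^ (- zeta) * (c d * n%:R)) ^- 2 * (M1 * d%:R * n%:R) <=
    M1 / k1 ^+ 2 * E1.
  apply: (@le_trans _ _ (M1 * (d%:R * v ^+ 2 * (t ^+ 2 / n%:R)) * ((c d * v) ^+ 2)^-1)).
    rewrite powRN -/t le_eqVlt; apply/orP; left; apply/eqP; field.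
    by rewrite ?ne1 ?ne2 ?ne3 ?ne5 ?ne6.
  rewrite -[leRHS]mulrA [_^-1 * E1]mulrC [leRHS]mulrA; apply: ler_pM.
  - by rewrite mulr_ge0// mulr_ge0 ?mulr_ge0 ?divr_ge0 ?sqr_ge0// ltW.
  - by rewrite invr_ge0 sqr_ge0.
  - apply: ler_wpM2l => //; apply: ler_wpM2l; first by rewrite mulr_ge0 ?sqr_ge0// ltW.
    apply: ler_wpM2l; first exact: sqr_ge0.
    rewrite ler_peMl ?invr_ge0 ?(ltW n_gt0)//.
    by rewrite -[leLHS](powRr0 (n%:R : R)) ler_powR// ltW.
  - by apply: inv_le; [rewrite exprn_gt0|apply: sq_le => //; rewrite ltW].
have kE : k d = c d * mt d by [].
have a2 : (n%:R `^ (- zeta) * (k d * n%:R)) ^- 2 * (M2 * (d%:R ^+ 3 * n%:R `^ (1 + gam))) <=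
    M2 / (k1 * k2) ^+ 2 * E1.
  apply: (@le_trans _ _ (M2 * E1 * ((c d * v * (mt d / d%:R)) ^+ 2)^-1)).
    rewrite -pw_addE// powRr1 ?(ltW n_gt0)// kE powRN -/t /E1 le_eqVlt.
    apply/orP; left; apply/eqP; field.
    by rewrite ?ne1 ?ne2 ?ne3 ?ne4 ?ne5 ?ne6.
  rewrite -[leRHS]mulrA [_^-1 * E1]mulrC [leRHS]mulrA.
  apply: ler_wpM2l; first exact: (mulr_ge0 M20 E10).
  apply: inv_le; first by rewrite exprn_gt0// mulr_gt0.
  apply: sq_le; first by rewrite mulr_ge0 ?(ltW k10) ?(ltW k20).
  by apply: ler_pM; rewrite ?(ltW k10) ?(ltW k20).
have a3 : (n%:R `^ (- zeta) * (k d * n%:R)) ^- 2 * (M2 * (c d * n%:R `^ (2^-1 + 1 + gam))) <=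
    M2 / (k1 * k2 ^+ 2) * E2.
  apply: (@le_trans _ _ (M2 * E2 * (c d * v * (mt d / d%:R) ^+ 2)^-1)).
    rewrite (_ : 2^-1 + 1 + gam = (gam - 2^-1) + (1 + 1)); last by field.
    rewrite /E2 -!pw_addE// powRr1 ?(ltW n_gt0)// kE [_ `^ (- zeta)]powRN -/t le_eqVlt.
    apply/orP; left; apply/eqP; field.
    by rewrite ?ne1 ?ne2 ?ne3 ?ne4 ?ne5 ?ne6.
  rewrite -[leRHS]mulrA [_^-1 * E2]mulrC [leRHS]mulrA.
  apply: ler_wpM2l; first exact: (mulr_ge0 M20 E20).
  apply: inv_le; first by rewrite mulr_gt0// exprn_gt0.
  apply: ler_pM; rewrite ?(ltW k10) ?sqr_ge0//.
  by apply: sq_le => //; exact: ltW.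
have dpow (r : R) : 0 <= r -> d%:R `^ r <= n%:R `^ (x * r).
  by move=> r0; rewrite powRrM; apply: ge0_ler_powR => //; rewrite nnegrE ?powR_ge0.
have dD (r s : R) : d%:R `^ r * d%:R `^ s = d%:R `^ (r + s) :> R.
  by rewrite powRD// ne2 implybT.
have b1 : E1 <= n%:R `^ (2 * zeta + gam - 1 + x * (3 + 2 * p)).
  have -> : E1 = d%:R `^ (3 + 2 * p) * n%:R `^ (2 * zeta + gam - 1).
    rewrite (_ : 3 + 2 * p = 1 + ((1 + p) + (1 + p))); last by ring.
    rewrite (_ : 2 * zeta + gam - 1 = (zeta + zeta) + (gam - 1)); last by ring.
    by rewrite /E1 /v -!dD -!pw_addE// powRr1// powRN powRr1 ?(ltW n_gt0).
  rewrite [leLHS]mulrC -[leRHS]pw_addE// ler_wpM2l ?powR_ge0// dpow//.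
  by rewrite addr_ge0// mulr_ge0// ltW.
have b2 : E2 <= n%:R `^ (2 * zeta + gam - 2^-1 + x * (p - 1)).
  have -> : E2 = d%:R `^ (p - 1) * n%:R `^ (2 * zeta + gam - 2^-1).
    rewrite (_ : 2 * zeta + gam - 2^-1 = (zeta + zeta) + (gam - 2^-1)); last by ring.
    rewrite -!(pw_addE _ _ hn) /E2 -(pw_addE _ _ hn) -/t.
    have -> : v = d%:R `^ (p - 1) * (d%:R * d%:R).
      rewrite /v (_ : 1 + p = p - 1 + (1 + 1)); last by ring.
      by rewrite -!dD powRr1.
    by field.
  rewrite [leLHS]mulrC -[leRHS]pw_addE// ler_wpM2l ?powR_ge0// dpow//.
  by rewrite subr_ge0 ltW.
apply: (@le_trans _ _ (K * (E1 + E2))); last first.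
  by rewrite ler_wpM2l ?lerD// !addr_ge0.
have -> : mean (@deviation n (n%:R `^ (- zeta)) d) =
    (n%:R `^ (- zeta) * (c d * n%:R)) ^- 2 *
      mean (fun g : 'M[nat]_n => ((nb_vertices_deg g d)%:R - c d * n%:R) ^+ 2)
    + (n%:R `^ (- zeta) * (k d * n%:R)) ^- 2 *
      mean (fun g : 'M[nat]_n => ((nb_triangles_deg g d)%:R - k d * n%:R) ^+ 2).
  by rewrite -!meanZ -meanD; apply: eq_wmean => g; rewrite /deviation mulrC [X in _ + X]mulrC.
have i1 : 0 <= (n%:R `^ (- zeta) * (c d * n%:R)) ^- 2 by rewrite invr_ge0 sqr_ge0.
have i2 : 0 <= (n%:R `^ (- zeta) * (k d * n%:R)) ^- 2 by rewrite invr_ge0 sqr_ge0.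
apply: le_trans (lerD (ler_wpM2l i1 (h1 n d hn md)) (ler_wpM2l i2 (h2 n d hn md))) _.
rewrite mulrDr [X in _ + X]mulrDr.
have z1 := mulr_ge0 q1 E20; have z2 := mulr_ge0 q2 E20; have z3 := mulr_ge0 q3 E10.
by move: a1 a2 a3 z1 z2 z3; rewrite /K; lra.
Qed.

(** By contraposition: if both relative errors are at most [theta <= 1/2], at least [c d n / 2]
    vertices have degree [d], so the quotient is a genuine one. Its numerator, once the limit is
    subtracted, is at most [2 theta k d n], where [k d = O(d * c d)]; the binomial coefficient, at
    least [d^2 / 4], leaves [O(theta / d)]. *)
Lemma clustering_deviation : exists2 K : R, 0 < K &
  forall n d (g : 'M[nat]_n) (theta : R), (n0 <= n)%N -> (m <= d)%N -> (2 <= d)%N ->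
  0 < theta <= 2^-1 ->
  K * theta / d%:R <= `|local_clustering R g d - mt d / 'C(d, 2)%:R| ->
  1 <= deviation theta d g.
Proof.
have [Ck Ck0 hCk] := mean_triangles_le A_gt0 A_lt1 m_gt0 D_gt0 AB.
(* The estimate yields [16 * Ck]; the larger constant makes the inequality strict. *)
exists (17 * Ck) => [|n d g th hn md d2 /andP[th0 th1]]; first by rewrite mulr_gt0.
have n_gt0 := N_gt0 hn.
have d_gt0 : 0 < d%:R :> R by rewrite ltr0n (leq_trans m_gt0).
have c0 := deg_density_gt0 A_gt0 A_lt1 m_gt0 AB md.
have mt0 := mean_triangles_gt0 A_gt0 A_lt1 m_gt0 D_gt0 AB md.
have k0 : 0 < k d by rewrite mulr_gt0.
pose X : R := (nb_vertices_deg g d)%:R; pose Y : R := (nb_triangles_deg g d)%:R.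
have e1 : 0 < th * (c d * n%:R) by rewrite !mulr_gt0.
have e2 : 0 < th * (k d * n%:R) by rewrite !mulr_gt0.
have s1 : 0 <= (X - c d * n%:R) ^+ 2 / (th * (c d * n%:R)) ^+ 2 by rewrite divr_ge0 ?sqr_ge0.
have s2 : 0 <= (Y - k d * n%:R) ^+ 2 / (th * (k d * n%:R)) ^+ 2 by rewrite divr_ge0 ?sqr_ge0.
have big (z e : R) : 0 < e -> e < `|z| -> 1 <= z ^+ 2 / e ^+ 2.
  move=> e0 ez; rewrite ler_pdivlMr ?exprn_gt0// mul1r -[leRHS]real_normK ?num_real//.
  by rewrite lerXn2r ?nnegrE ?(ltW e0)// ltW.
rewrite /deviation -/X -/Y.
have [hX|/(big _ _ e1) hX] := lerP `|X - c d * n%:R| (th * (c d * n%:R)); last first.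
  by move=> _; rewrite (le_trans hX)// lerDl.
have [hY|/(big _ _ e2) hY] := lerP `|Y - k d * n%:R| (th * (k d * n%:R)); last first.
  by move=> _; rewrite (le_trans hY)// lerDr.
rewrite leNgt => /negP[].
have cn0 : 0 < c d * n%:R by rewrite mulr_gt0.
have X0 : c d * n%:R / 2 <= X.
  have h : th * (c d * n%:R) <= 2^-1 * (c d * n%:R) by rewrite ler_wpM2r// ltW.
  by move: hX; rewrite ler_norml => /andP[hX _]; lra.
have Xp : 0 < X by apply: lt_le_trans X0; rewrite divr_gt0.
have C20 : 0 < 'C(d, 2)%:R :> R by rewrite ltr0n bin_gt0.
have C2 : d%:R ^+ 2 / 4 <= 'C(d, 2)%:R :> R.
  have d2' : 2 <= d%:R :> R by rewrite ler_nat.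
  rewrite bin2_natr; have : 0 <= d%:R * (d%:R - 2) :> R by rewrite mulr_ge0// subr_ge0.
  by lra.
have -> : local_clustering R g d - mt d / 'C(d, 2)%:R = (Y - mt d * X) / (X * 'C(d, 2)%:R).
  by rewrite /local_clustering -/X -/Y; field; rewrite !gt_eqF.
have num : `|Y - mt d * X| <= 2 * (th * (k d * n%:R)).
  have -> : Y - mt d * X = (Y - k d * n%:R) - mt d * (X - c d * n%:R).
    by rewrite /tri_density; ring.
  apply: le_trans (ler_normB _ _) _; rewrite normrM (gtr0_norm mt0).
  have : mt d * `|X - c d * n%:R| <= mt d * (th * (c d * n%:R)) by rewrite ler_pM2l.
  have : mt d * (th * (c d * n%:R)) = th * (k d * n%:R) by rewrite /tri_density; ring.
  by move: hY; lra.
rewrite normf_div [`|X * _|]gtr0_norm ?mulr_gt0//.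
apply: (@le_lt_trans _ _ (16 * Ck * th / d%:R)); last first.
  by rewrite ltr_pM2r ?invr_gt0// ltr_pM2r// ltr_pM2r// ltr_nat.
rewrite ler_pdivrMr ?mulr_gt0//; apply: (le_trans num).
apply: (@le_trans _ _ (16 * Ck * th / d%:R * ((c d * n%:R / 2) * (d%:R ^+ 2 / 4)))).
  rewrite [leRHS](_ : _ = 2 * (th * (c d * (Ck * d%:R) * n%:R))); last first.
    by field; rewrite gt_eqF.
  rewrite ler_pM2l// ler_pM2l// ler_pM2r// /tri_density ler_pM2l//.
  exact: hCk.
rewrite ler_wpM2l ?divr_ge0 ?mulr_ge0 ?(ltW Ck0) ?(ltW th0)//.
by apply: ler_pM => //; rewrite ?divr_ge0 ?sqr_ge0 ?(ltW cn0).
Qed.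

(** The union bound over at most [n^x] degrees adds [x] to both exponents of [deviation_mean],
    turning [3 + 2 p] into [4 + 2 p] and [p - 1] into [p]. *)
Theorem clustering_cvg (gam zeta x : R) : 0 < gam -> 2 * A < 1 + gam -> 0 < zeta ->
  2 * zeta + gam - 1 + x * (4 + 2 * p) < 0 -> 2 * zeta + gam - 2^-1 + x * p < 0 ->
  exists K : R, P [set w | exists d : nat, [/\ (m <= d)%N, (2 <= d)%N,
      d%:R <= n%:R `^ x &
      K * n%:R `^ (- zeta) / d%:R <=
        `|local_clustering R (G n w) d - mt d / 'C(d, 2)%:R| ]]
    @[n --> \oo] --> 0%E.
Proof.
move=> gam0 Agam z0 ex1 ex2.
have [K1 K10 h1] := deviation_mean zeta x gam0 Agam.
have [K2 K20 h2] := clustering_deviation; exists K2.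
pose q n (g : 'M[nat]_n) (d : nat) : Prop := [/\ (m <= d)%N, (2 <= d)%N,
      d%:R <= n%:R `^ x &
      K2 * n%:R `^ (- zeta) / d%:R <= `|local_clustering R g d - mt d / 'C(d, 2)%:R| ].
pose Q n (g : 'M[nat]_n) : bool := `[< exists d, q n g d >].
have setE n : [set w | exists d : nat, q n (G n w) d] = [set w | Q n (G n w)].
  by apply/seteqP; split=> w /= /asboolP.
rewrite -/(q _ _ _).
under eq_fun do rewrite setE.
apply/fine_cvgP; split.
  exists n0 => // n /= hn; rewrite fin_num_measure//.
  exact: (measurable_event process bounded).
have [N hN] := powR_nat_ge 2 z0.
pose e1 := 2 * zeta + gam - 1 + x * (4 + 2 * p).
pose e2 := 2 * zeta + gam - 2^-1 + x * p.
have bound n : (maxn n0 N <= n)%N -> 0 <= fine (P [set w | Q n (G n w)]) <=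
    K1 * (n%:R `^ e1 + n%:R `^ e2).
  rewrite geq_max => /andP[hn hnN]; rewrite fine_ge0//=.
  have n_gt0 := N_gt0 hn.
  rewrite (mean_event P process bounded (Q n) hn).
  have thn : 0 < (n%:R : R) `^ (- zeta) <= 2^-1.
    rewrite powR_gt0//= powRN lef_pV2 ?posrE ?powR_gt0//; exact: hN.
  pose L := (Num.truncn (n%:R `^ x : R)).+1.
  have LP d : (d < L)%N = (d%:R <= n%:R `^ x).
    by rewrite /L ltnS truncn_ge_nat ?powR_ge0.
  apply: (@le_trans _ _ (mean (fun g : 'M[nat]_n =>
      \sum_(d < L | (m <= d)%N) deviation (n%:R `^ (- zeta)) d g))).
    apply: mean_le => g hg; rewrite /Q; case: asboolP => [[d [md d2 dx hd]]|_]; last first.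
      by apply: sumr_ge0 => d _; rewrite addr_ge0 ?divr_ge0 ?sqr_ge0.
    have dL : (d < L)%N by rewrite LP.
    rewrite (bigD1 (Ordinal dL))//= -[leLHS]addr0; apply: lerD.
      exact: (h2 n d g _ hn md d2 thn hd).
    by apply: sumr_ge0 => j _; rewrite addr_ge0 ?divr_ge0 ?sqr_ge0.
  rewrite mean_sum.
  set E := n%:R `^ (2 * zeta + gam - 1 + x * (3 + 2 * p))
         + n%:R `^ (2 * zeta + gam - 2^-1 + x * (p - 1)).
  have E0 : 0 <= E by rewrite addr_ge0 ?powR_ge0.
  apply: (@le_trans _ _ (\sum_(d < L | (m <= d)%N) K1 * E)).
    by apply: ler_sum => d md; apply: (h1 n d hn md); rewrite -LP.
  rewrite sumr_const -[leLHS]mulr_natr.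
  apply: (@le_trans _ _ (K1 * E * n%:R `^ x)).
    rewrite ler_wpM2l ?mulr_ge0//.
    (* Degree [0] is excluded by [m >= 1], so at most [L - 1 <= n^x] degrees are counted and no
       additive constant appears. *)
    apply: (@le_trans _ _ L.-1%:R); last by rewrite -LP.
    rewrite ler_nat.
    have -> : L.-1 = #|[set d : 'I_L | d != ord0]%SET|.
      by have := cardsC1 (ord0 : 'I_L); rewrite card_ord => <-; apply: eq_card => d; rewrite !inE.
    apply: subset_leq_card; apply/fintype.subsetP => d; rewrite !inE => md.
    by rewrite -lt0n (leq_trans m_gt0).
  rewrite -mulrA ler_wpM2l// /E mulrDl !pw_addE// le_eqVlt; apply/orP; left; apply/eqP.
  by congr (_ `^ _ + _ `^ _); rewrite /e1 /e2; ring.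
have up : (fun n : nat => K1 * (n%:R `^ e1 + n%:R `^ e2)) @ \oo --> (0 : R).
  rewrite -[0](mulr0 K1) -[in X in K1 * X](addr0 0); apply: cvgM; first exact: cvg_cst.
  apply: cvgD; [rewrite -[e1]opprK|rewrite -[e2]opprK]; apply: cvg_powR_natN;
    by rewrite oppr_gt0.
apply: (squeeze_cvgr _ (@cvg_cst _ (0 : R) _ _ _) up).
by exists (maxn n0 N) => // n /= hn; apply: bound.
Qed.

End Clustering.

(** * Closed form and asymptotics of the limiting clustering *)

Section Limit.
Context {R : realType}.
Variables (A B D : R) (m : nat).
Hypotheses (A_gt0 : 0 < A) (A_lt1 : A < 1) (D_gt0 : 0 < D) (m_gt0 : (0 < m)%N).
Hypothesis AB : 2 * m%:R * A + B = m%:R.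
Local Notation mt := (mean_triangles A B D m).

Lemma Kdeg_ratio d : (m <= d)%N ->
  Kdeg A B D m d / ('C(d, 2)%:R * cdeg A B m d) = mt d / 'C(d, 2)%:R.
Proof.
move=> md; have m0 : 0 < m%:R :> R by rewrite ltr0n.
have mA : 0 < m%:R + B / A.
  have -> : m%:R + B / A = m%:R * (1 - A) / A.
    by rewrite (_ : B = m%:R - 2 * m%:R * A); [field; rewrite gt_eqF|rewrite -[X in X - _]AB; ring].
  by rewrite divr_gt0 ?mulr_gt0 ?subr_gt0.
have dA : 0 < d%:R + B / A by apply: lt_le_trans mA _; rewrite lerD2r ler_nat.
have iA : 0 < A^-1 by rewrite invr_gt0.
have mA1 : 0 < m%:R + (B + 1) / A by rewrite mulrDl addrA mul1r addr_gt0.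
have dA1 : 0 < d%:R + (B + A + 1) / A.
  have -> : d%:R + (B + A + 1) / A = d%:R + B / A + 1 + A^-1.
    by field; rewrite gt_eqF.
  exact: (addr_gt0 (addr_gt0 dA ltr01) iA).
have c0 : cdeg A B m d != 0.
  by rewrite gt_eqF// /cdeg divr_gt0 ?mulr_gt0 ?Gamma_gt0.
rewrite /Kdeg -/(mt d) [X in _ / X]mulrC -mulf_div mulfV// mul1r.
by [].
Qed.

Lemma Kdeg_ratio_sum d : (m <= d)%N -> (2 <= d)%N ->
  Kdeg A B D m d / ('C(d, 2)%:R * cdeg A B m d) =
  2 * D / (d%:R * (d%:R - 1) * m%:R) *
    (m%:R + \sum_(m <= i < d) (i%:R / (A * i%:R + B))).
Proof.
move=> md d2; rewrite Kdeg_ratio// bin2_natr /mean_triangles.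
have m0 : m%:R != 0 :> R by rewrite pnatr_eq0 -lt0n.
have d0 : d%:R != 0 :> R by rewrite pnatr_eq0 -lt0n (leq_trans m_gt0).
have d1 : d%:R - 1 != 0 :> R by rewrite subr_eq0 -[1]/(1%:R) eqr_nat gtn_eqF.
rewrite /rate; field; by rewrite m0 d0 d1.
Qed.

(** Each increment differs from [D / (m A)] by a multiple of [1 / rate d], that is by [O(1 / d)].
    The errors would add up to a logarithm; [powR_succ_diff] bounds them by a square root, which
    suffices for the equivalence. *)
Let mean_triangles_linear : exists2 K : R, 0 <= K & forall d, (m <= d)%N ->
  `|mt d - D / (m%:R * A) * d%:R| <= K * d%:R `^ 2^-1.
Proof.
have m0 : 0 < m%:R :> R by rewrite ltr0n.
pose a : R := Num.min A (1 - A); have a0 : 0 < a by exact: minA_gt0.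
pose K0 : R := D / m%:R * `|B / A| / a.
have K00 : 0 <= K0.
  by apply: divr_ge0; rewrite ?(ltW a0)// mulr_ge0 ?divr_ge0// ltW.
pose K1 : R := `|mt m - D / (m%:R * A) * m%:R|.
exists (K1 + 4 * K0) => [|d md]; first exact: (addr_ge0 (normr_ge0 _) (mulr_ge0 (ler0n _ 4) K00)).
suff h : `|mt d - D / (m%:R * A) * d%:R| <= K1 + 4 * K0 * d%:R `^ 2^-1.
  apply: (le_trans h); rewrite [leRHS]mulrDl lerD2r ler_peMr ?normr_ge0//.
  rewrite -[leLHS](powRr0 (d%:R : R)) ler_powR//.
  by rewrite ler1n (leq_trans m_gt0).
elim: d md => [|d IH]; first by move=> h; move: m_gt0; rewrite ltnNge h.
rewrite leq_eqVlt => /predU1P[<-|].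
  by rewrite -/K1 lerDl; apply: mulr_ge0 (powR_ge0 _ _); exact: mulr_ge0.
rewrite ltnS => md.
have d_gt0 : (0 < d)%N by rewrite (leq_trans m_gt0).
have d0 : 0 < d%:R :> R by rewrite ltr0n.
have r0 : 0 < rate A B d by exact: rate_gt0 A_gt0 A_lt1 m_gt0 AB _ md.
have -> : mt d.+1 - D / (m%:R * A) * d.+1%:R = (mt d - D / (m%:R * A) * d%:R)
    - D / m%:R * (B / A) / rate A B d.
  rewrite mean_trianglesS// -natr1; rewrite /rate in r0 *.
  by field; rewrite !gt_eqF.
apply: le_trans (ler_normB _ _) _.
have step : `|D / m%:R * (B / A) / rate A B d| <= K0 / d%:R.
  rewrite /K0 normf_div (gtr0_norm r0) normrM [`|D / _|]gtr0_norm ?divr_gt0//.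
  rewrite -[leRHS]mulrA -invfM; apply: ler_wpM2l.
    by rewrite mulr_ge0// divr_ge0// ltW.
  by rewrite lef_pV2 ?posrE ?mulr_gt0//; exact: rate_ge A_gt0 A_lt1 m_gt0 AB _ md.
have half0 : 0 <= 2^-1 :> R by rewrite invr_ge0.
have := powR_succ_diff d_gt0 half0; set u := d%:R `^ 2^-1; set w := d.+1%:R `^ 2^-1.
rewrite (_ : 2^-1 / (2 * d%:R) = 4^-1 / d%:R); last by field; rewrite gt_eqF.
move=> hw; have : 4 * K0 * (u + 4^-1 / d%:R) <= 4 * K0 * w.
  by apply: ler_wpM2l hw; exact: mulr_ge0.
rewrite mulrDr (_ : 4 * K0 * (4^-1 / d%:R) = K0 / d%:R); last by field; rewrite gt_eqF.
by move: (IH md) step; rewrite -/u; lra.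
Qed.

Lemma Kdeg_ratio_equiv :
  (fun d : nat => Kdeg A B D m d / ('C(d, 2)%:R * cdeg A B m d)) ~_\oo
  (fun d : nat => 2 * D / (m%:R * A) * d%:R^-1).
Proof.
have [K K0 hK] := mean_triangles_linear.
have m0 : 0 < m%:R :> R by rewrite ltr0n.
pose l := D / (m%:R * A); have l0 : 0 < l by rewrite divr_gt0// mulr_gt0.
apply/eqaddoP => eps eps0.
have half0 : 0 < 2^-1 :> R by rewrite invr_gt0.
(* The factor [2] compensates for [d - 1 >= d / 2]. *)
have [N hN] := powR_nat_ge (2 * (K + l) / (eps * l)) half0.
exists (maxn 2 (maxn m N)) => // d /=; rewrite !geq_max => /and3P[d2 md Nd].
have d1 : 1 <= d%:R :> R by rewrite ler1n ltnW.
have d0 : 0 < d%:R :> R by rewrite (lt_le_trans ltr01).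
have d2' : 2 <= d%:R :> R by rewrite ler_nat.
have dm1 : 0 < d%:R - 1 :> R by lra.
rewrite /GRing.add_fun/= -[X in `|X|]/(_ - _) Kdeg_ratio// bin2_natr.
(* Over the common denominator [2 l / d] has numerator [l (d - 1)], whence the additional [l]. *)
have e : mt d / (d%:R * (d%:R - 1) / 2) - 2 * D / (m%:R * A) * d%:R^-1 =
    2 / (d%:R * (d%:R - 1)) * (mt d - l * d%:R + l).
  by rewrite /l; field; rewrite !gt_eqF.
have /= := hN d Nd; set u := d%:R `^ 2^-1 => hu.
have u1 : 1 <= u.
  by rewrite -[leLHS](powRr0 (d%:R : R)) ler_powR// ltW.
have uu : u * u = d%:R.
  by rewrite /u -powRD ?(gt_eqF d0) ?implybT// -[RHS](powRr1 (ltW d0)); congr (_ `^ _); field.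
have bound : `|mt d - l * d%:R + l| <= (K + l) * u.
  apply: le_trans (ler_normD _ _) _; rewrite mulrDl (gtr0_norm l0).
  by apply: lerD; [exact: hK|rewrite ler_peMr// ltW].
have q0 : 0 < 2 / (d%:R * (d%:R - 1)) :> R by rewrite divr_gt0// mulr_gt0.
rewrite [X in `|X| <= _]e normrM (gtr0_norm q0).
have -> : `|2 * D / (m%:R * A) * d%:R^-1| = 2 * l / d%:R.
  rewrite (_ : _ * _ = 2 * l / d%:R); last by rewrite /l; ring.
  by rewrite gtr0_norm// divr_gt0// mulr_gt0.
apply: (le_trans (ler_wpM2l (ltW q0) bound)).
rewrite [leRHS](_ : _ = 2 / (d%:R * (d%:R - 1)) * (eps * l * (d%:R - 1))); last first.
  by field; rewrite !gt_eqF.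
rewrite ler_pM2l//.
have el : 0 < eps * l by rewrite mulr_gt0.
move: hu; rewrite ler_pdivrMr// => hu.
have h1 : 2 * (K + l) * u <= u * (eps * l) * u.
  by rewrite ler_wpM2r// (le_trans ler01).
have h2 : u * (eps * l) * u = eps * l * d%:R by rewrite -uu; ring.
have h3 : eps * l * 2 <= eps * l * d%:R by rewrite ler_pM2l.
by move: h1 h2 h3; lra.
Qed.

End Limit.

(** * Choice of the exponents *)

Theorem theorem6 (R : realType) (dT : measure_display) (T : measurableType dT)
    (P : probability T R) (m n0 : nat) (hm : (1 <= m)%N) (hn0 : (1 <= n0)%N)
    (A B D : R) (hA : 0 < A) (hD : 0 < D)
    (G : forall n : nat, T -> 'M[nat]_n)
    (hG : T_subclass P m n0 A B D G) :
  (forall delta : R, 0 < delta ->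
    exists phi : nat -> R,
      [/\ phi n @[n --> \oo] --> (0 : R),
          2 * A <= 1 ->
            P [set w | exists d : nat,
                 [/\ (m <= d)%N, (2 <= d)%N,
                     d%:R <= n%:R `^ ((A - delta) / (4 * A + 2)) &
                     phi n / d%:R <=
                     `|local_clustering R (G n w) d
                       - Kdeg A B D m d / ('C(d, 2)%:R * cdeg A B m d)| ]]
              @[n --> \oo] --> 0%E &
          1 < 2 * A ->
            P [set w | exists d : nat,
                 [/\ (m <= d)%N, (2 <= d)%N,
                     d%:R <=
                     n%:R `^ ((A * (3 - 4 * A) - delta) / (4 * A + 2)) &
                     phi n / d%:R <=
                     `|local_clustering R (G n w) d
                       - Kdeg A B D m d / ('C(d, 2)%:R * cdeg A B m d)| ]]
              @[n --> \oo] --> 0%E ]) /\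
  (A < 1 ->
    (forall d : nat, (m <= d)%N -> (2 <= d)%N ->
      Kdeg A B D m d / ('C(d, 2)%:R * cdeg A B m d) =
      2 * D / (d%:R * (d%:R - 1) * m%:R) *
        (m%:R + \sum_(m <= i < d) (i%:R / (A * i%:R + B)))) /\
    (fun d : nat => Kdeg A B D m d / ('C(d, 2)%:R * cdeg A B m d)) ~_\oo
      (fun d : nat => 2 * D / (m%:R * A) * d%:R^-1)).
Proof.
have AB := PA_sum (T_PA hG).
split=> [delta delta0|A1]; last first.
  by split=> [d md d2|]; [exact: Kdeg_ratio_sum|exact: Kdeg_ratio_equiv].
have s0 : 0 < 4 * A + 2 by rewrite addr_gt0 ?mulr_gt0.
(* The two cases exclude each other, so a [phi] chosen for the exponent of the case at hand serves
   both. *)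
pose x : R := if 2 * A <= 1 then (A - delta) / (4 * A + 2)
  else (A * (3 - 4 * A) - delta) / (4 * A + 2).
suff [phi phi0 hphi] : exists2 phi : nat -> R, phi n @[n --> \oo] --> (0 : R) &
    P [set w | exists d : nat, [/\ (m <= d)%N, (2 <= d)%N, d%:R <= n%:R `^ x &
      phi n / d%:R <= `|local_clustering R (G n w) d
        - Kdeg A B D m d / ('C(d, 2)%:R * cdeg A B m d)| ]] @[n --> \oo] --> 0%E.
  exists phi; split=> // h; move: hphi; rewrite /x; first by rewrite h.
  by rewrite leNgt h.
(* For [x <= 0] no [d >= 2] is in range; this includes [A = 1], for which there
   is no attachment law. *)
have [x0|x0] := lerP x 0.
  exists (fun=> 0); first exact: cvg_cst.
  apply: (@cvg_near_cst _ _ _ _ _ _ _).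
  exists 1%N => // n /= n1.
  rewrite [X in P X](_ : _ = set0) ?measure0//; apply/seteqP; split=> w //=.
  case=> d [_ d2 dx _].
  have : 2 <= 1 :> R.
    apply: (@le_trans _ _ d%:R); first by rewrite ler_nat.
    apply: (le_trans dx); rewrite -[leRHS](powRr0 (n%:R : R)) ler_powR//.
    by rewrite ler1n.
  by rewrite leNgt ltr1n.
have xs : x * (4 * A + 2) = if 2 * A <= 1 then A - delta else A * (3 - 4 * A) - delta.
  by rewrite /x; case: ifP => _; rewrite divfK ?gt_eqF.
(* When [2 A > 1], a positive [x] forces [3 - 4 A > 0]; in both cases [A < 1] follows. *)
have A34 : 2 * A <= 1 \/ (1 < 2 * A) /\ A < 3 / 4.
  have [h|h] := lerP (2 * A) 1; [by left|right; split=> //].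
  have : 0 < x * (4 * A + 2) by rewrite mulr_gt0.
  rewrite xs leNgt h/= => h1; have h2 : 0 < A * (3 - 4 * A) by lra.
  by move: h2; rewrite pmulr_rgt0//; lra.
have A1 : A < 1 by case: A34 => [|[]]; lra.
have [b [C law]] := attachment_law_subclass hm hn0 hA A1 hG.
suff [gam [zeta [gam0 Agam z0 e1 e2]]] : exists gam zeta : R, [/\ 0 < gam, 2 * A < 1 + gam,
    0 < zeta, 2 * zeta + gam - 1 + x * (4 + 2 / A) < 0 &
    2 * zeta + gam - 2^-1 + x / A < 0].
  have [K hK] := clustering_cvg law gam0 Agam z0 e1 e2.
  exists (fun n => K * n%:R `^ (- zeta)).
    by rewrite -[0](mulr0 K); apply: cvgM; [exact: cvg_cst|exact: cvg_powR_natN].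
  rewrite (_ : (fun n => _) = (fun n => P [set w | exists d : nat,
      [/\ (m <= d)%N, (2 <= d)%N, d%:R <= n%:R `^ x & K * n%:R `^ (- zeta) / d%:R <=
        `|local_clustering R (G n w) d - mean_triangles A B D m d / 'C(d, 2)%:R| ]]))//.
  apply/funext => n; congr (P _); apply/seteqP; split=> w /= [d [md d2 dx hd]];
    by exists d; split=> //; move: hd; rewrite Kdeg_ratio.
pose y := x / A; have xy : x = A * y by rewrite /y mulrC divfK ?gt_eqF.
have y0 : 0 < y by rewrite divr_gt0.
have -> : x * (4 + 2 / A) = y * (4 * A + 2) by rewrite /y; field; rewrite gt_eqF.
rewrite -/y.
(* The critical value of the loss exponent, [max(0, 2 A - 1)]. The strict inequalities at [g0] leave
   room for an admissible [gam] above it. *)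
pose g0 : R := if 2 * A <= 1 then 0 else 2 * A - 1.
have g00 : 0 <= g0 by rewrite /g0; case: ifPn => //; rewrite -ltNge subr_ge0 => /ltW.
suff [h1 h2] : g0 - 1 + y * (4 * A + 2) < 0 /\ g0 - 2^-1 + y < 0.
  (* With [gam = g0 + s / 4] and [zeta = s / 4], the sum [2 * zeta + gam] exceeds [g0] by [3 s / 4],
     less than the slack [s] of both conditions. *)
  pose s := Num.min (- (g0 - 1 + y * (4 * A + 2))) (- (g0 - 2^-1 + y)).
  have sp : 0 < s by rewrite lt_min !oppr_gt0 h1.
  have s1 : s <= - (g0 - 1 + y * (4 * A + 2)) by rewrite ge_min lexx.
  have s2 : s <= - (g0 - 2^-1 + y) by rewrite ge_min lexx orbT.
  exists (g0 + s / 4), (s / 4); split; [lra| |lra|lra|lra].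
  by rewrite /g0; case: ifPn => [|_]; lra.
have yA : 0 < y * A by rewrite mulr_gt0.
move: xs; rewrite xy -mulrA /g0; case: A34 => [A12|[A12 A34]]; rewrite ?A12.
  move=> e; have : A * (y * (4 * A + 2)) < A * 1 by rewrite e; lra.
  by rewrite ltr_pM2l// => h; split; lra.
rewrite leNgt A12 /= => e.
have : A * (y * (4 * A + 2)) < A * (3 - 4 * A) by rewrite e; lra.
rewrite ltr_pM2l// => h; split; first lra.
(* Inserting the bound [3 - 4 A] for [y (4 A + 2)] leaves [8 A (3/4 - A)] in the product below. *)
have h3 : 0 < A * (3 / 4 - A) by rewrite mulr_gt0// subr_gt0.
have : 0 < (3 / 2 - 2 * A - y) * (4 * A + 2) by lra.
by rewrite pmulr_lgt0//; lra.
Qed.
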